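(* Consider the $\beta$-model with true parameter $\boldsymbol\beta\in\mathbb R^n$. Let $r=r_n\in\{1,\dots,n\}$ with $r\to\infty$, let $\beta_1^0,\dots,\beta_r^0$ be known numbers, and assume the specified null $H_0:\beta_i=\beta_i^0$, $i=1,\dots,r$, holds, i.e. $\beta_i=\beta_i^0$ for $i\le r$. Let $\Theta_0=\{\boldsymbol\gamma\in\mathbb R^n:(\gamma_1,\dots,\gamma_r)=(\beta_1^0,\dots,\beta_r^0)\}$ and $\hat{\boldsymbol\beta}^0=\arg\max_{\boldsymbol\gamma\in\Theta_0}\ell(\boldsymbol\gamma)$. If $b_n^5/c_n^2=o\big(r^{1/2}/(\log n)^2\big)$, then with probability tending to one $\hat{\boldsymbol\beta}$ and $\hat{\boldsymbol\beta}^0$ exist, and $$\frac{2\{\ell(\hat{\boldsymbol\beta})-\ell(\hat{\boldsymbol\beta}^0)\}-r}{\sqrt{2r}}\xrightarrow{d}N(0,1)\quad\text{as } r\to\infty .$$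
   Context: All quantities may depend on $n$; asymptotics are as $n\to\infty$. $\beta$-model: for $\boldsymbol\beta=(\beta_1,\dots,\beta_n)^\top\in\mathbb R^n$, the symmetric adjacency matrix $A=(a_{ij})$ of an undirected graph on nodes $\{1,\dots,n\}$ has $a_{ii}=0$, $a_{ji}=a_{ij}$, and $a_{ij}$ ($1\le i<j\le n$) mutually independent Bernoulli with $P(a_{ij}=1)=\mu(\beta_i+\beta_j)$, where $\mu(x)=e^x/(1+e^x)$. Degrees: $d_i=\sum_{j\ne i}a_{ij}$. Log-likelihood: $\ell(\boldsymbol\gamma)=\sum_{i=1}^n\gamma_id_i-\sum_{1\le i<j\le n}\log(1+e^{\gamma_i+\gamma_j})$, $\boldsymbol\gamma\in\mathbb R^n$; $\hat{\boldsymbol\beta}$ denotes its maximizer over $\mathbb R^n$ (the MLE). $b_n=\max_{i\ne j}(1+e^{\beta_i+\beta_j})^2/e^{\beta_i+\beta_j}$ and $c_n=\min_{i\ne j}(1+e^{\beta_i+\beta_j})^2/e^{\beta_i+\beta_j}$, computed at the true $\boldsymbol\beta$ (so $b_n\ge c_n\ge4$). *)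

(* Defs.v *)
From HB Require Import structures.
From mathcomp Require Import all_boot all_order all_algebra.
From mathcomp Require Import all_classical all_reals all_analysis.
Set Implicit Arguments. Unset Strict Implicit. Unset Printing Implicit Defensive.
Import Order.TTheory GRing.Theory Num.Theory.
Local Open Scope ring_scope.

(* Sample space of the beta-model on n nodes: the upper-triangular entries
   a_ij (i<j) of the adjacency matrix; the rest is determined by symmetry
   and a_ii = 0. *)
Definition upair (n : nat) := {p : 'I_n * 'I_n | (p.1 < p.2)%N}.
Definition graph (n : nat) := {ffun upair n -> bool}.

Definition adj {R : realType} (n : nat) (w : graph n) (i j : 'I_n) : R :=
  match @insub _ (fun p : 'I_n * 'I_n => (p.1 < p.2)%N) (upair n) (i, j) with
  | Some p => (w p)%:R
  | None =>
    match @insub _ (fun p : 'I_n * 'I_n => (p.1 < p.2)%N) (upair n) (j, i) with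
    | Some p => (w p)%:R
    | None => 0
    end
  end.

Definition degree {R : realType} (n : nat) (w : graph n) (i : 'I_n) : R :=
  \sum_(j < n | j != i) adj w i j.

Definition mu {R : realType} (x : R) : R := expR x / (1 + expR x).

Definition weight {R : realType} (n : nat) (beta : 'I_n -> R) (w : graph n) : R :=
  \prod_(p : upair n)
     (let q := mu (beta (val p).1 + beta (val p).2) in if w p then q else 1 - q).

Definition Prob {R : realType} (n : nat) (beta : 'I_n -> R) (E : graph n -> Prop) : R :=
  \sum_(w : graph n | `[< E w >]) weight beta w.

Definition loglik {R : realType} (n : nat) (w : graph n) (g : 'I_n -> R) : R :=
  \sum_(i < n) g i * degree w i
  - \sum_(p : 'I_n * 'I_n | (p.1 < p.2)%N) ln (1 + expR (g p.1 + g p.2)).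

Definition is_argmax {R : realType} (n : nat) (f : ('I_n -> R) -> R)
  (S : ('I_n -> R) -> Prop) (g : 'I_n -> R) : Prop :=
  S g /\ forall g', S g' -> f g' <= f g.

Definition Theta0 {R : realType} (n r : nat) (beta0 : 'I_n -> R) (g : 'I_n -> R) : Prop :=
  forall i : 'I_n, (i < r)%N -> g i = beta0 i.

Definition vfun {R : realType} (x : R) : R := (1 + expR x) ^+ 2 / expR x.

(* b_n and c_n (max / min over i <> j); for n < 2 these are 0 (irrelevant) *)
Definition b_n {R : realType} (n : nat) (beta : 'I_n -> R) : R :=
  \big[Num.max/0]_(p : 'I_n * 'I_n | p.1 != p.2) vfun (beta p.1 + beta p.2).
Definition c_n {R : realType} (n : nat) (beta : 'I_n -> R) : R :=
  \big[Num.min/b_n beta]_(p : 'I_n * 'I_n | p.1 != p.2) vfun (beta p.1 + beta p.2).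

Definition LR_event {R : realType} (n r : nat) (beta0 : 'I_n -> R) (x : R)
  (w : graph n) : Prop :=
  exists g1 g0 : 'I_n -> R,
    is_argmax (loglik w) (fun _ => True) g1 /\
    is_argmax (loglik w) (Theta0 r beta0) g0 /\
    (2 * (loglik w g1 - loglik w g0) - r%:R) / Num.sqrt (2 * r%:R) <= x.

Definition MLEs_exist {R : realType} (n r : nat) (beta0 : 'I_n -> R)
  (w : graph n) : Prop :=
  (exists g1 : 'I_n -> R, is_argmax (loglik w) (fun _ => True) g1) /\
  (exists g0, is_argmax (loglik w) (Theta0 r beta0) g0).

(* Main.v *)
(** Write [d_i] for the centred degrees, [v_ij] for the edge variances and
    [v_ii] for their row sums, so that [1/b_n <= v_ij <= 1].  Let [S] be the
    set of free coordinates and [delta_i = d_i / v_ii] on [S], [0] off [S].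

    The gradient of the log-likelihood at [beta + delta] has squared norm
    [O_P(n b_n)], since it consists of the off-diagonal part of the Fisher
    information applied to [delta] and of quadratic Taylor remainders.  On the
    cube of radius 1/2 around [beta + delta] the Hessian is at most
    [- c n / b_n], so a maximizer exists in the interior of that cube, is global
    by concavity, and its value exceeds that of [beta + delta] by [O_P(b_n^2)].
    A Taylor expansion at [beta], in which the bilinear and cubic terms are
    [O_P(b_n)] by the Efron--Stein inequality, then gives

      2 (max_S loglik - loglik beta) = sum_(i in S) d_i^2 / v_ii + O_P(b_n^2).

    Subtracting the expansions for all coordinates and for the last [n - r]
    ones, the likelihood ratio is [sum_(i < r) d_i^2 / v_ii] up to
    [O_P(b_n^2) = o_P(sqrt r)], because the hypothesis forces
    [b_n^3 = o(sqrt r)].  The normalized quadratic form is asymptotically normal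
    by Stein's method: integration by parts in each Bernoulli variable shows
    that [E (f'(W) - W f(W))] tends to 0, and explicit [f] make [f'(x) - x f(x)]
    a one-sided approximation of a centred indicator of a half-line. *)

(* Error bounds free of n rest on cancellation. Estimated in absolute value, the bilinear form and
   the cubic term would each be of order sqrt n, since an entry of delta is of order n^(-1/2); their
   means and variances are nevertheless bounded in terms of b_n. Only the fourth-order remainder
   (n^2 edges of size n^(-2)) is small enough to be bounded termwise, which is why the expansion
   goes to third order.

   The maximization is centred at beta + delta because at beta the squared gradient is of order n^2,
   no smaller than the square of the curvature n / b_n, so a maximizer could not be confined to a
   fixed cube. The step inverts only the diagonal of the Fisher information, so no approximate
   inverse of the full matrix is required.

   A single condition, [step_err] small against n / b_n, yields existence, localization and
   expansion together; the fourth powers in it also bound all coordinates of delta at once. The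
   rates b_n^2 / sqrt r of the expansion and b_n^3 / n of the existence are both at most a constant
   times b_n^3 / sqrt r. *)
Require Import Defs.
From HB Require Import structures.
From mathcomp Require Import all_boot all_order all_algebra.
From mathcomp Require Import all_classical all_reals all_analysis.
From mathcomp Require Import ring lra.
Import Order.TTheory GRing.Theory Num.Theory numFieldNormedType.Exports.
Local Open Scope classical_set_scope.
Local Open Scope ring_scope.
Set Implicit Arguments. Unset Strict Implicit. Unset Printing Implicit Defensive.

(** * Product Bernoulli measures on a discrete cube *)

(* Locked, so that unification never compares two updates by computing them. *)
HB.lock Definition upd (T : finType) (w : {ffun T -> bool}) (p : T) (b : bool)
  : {ffun T -> bool} := [ffun x => if x == p then b else w x].

Lemma updE (T : finType) (w : {ffun T -> bool}) p b x :
  upd w p b x = if x == p then b else w x.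
Proof. by rewrite upd.unlock ffunE. Qed.

Section BernoulliCube.
Context {R : realType} {T : finType} (q : T -> R).
Hypothesis q01 : forall p, 0 <= q p <= 1.

Implicit Types (w : {ffun T -> bool}) (F G : {ffun T -> bool} -> R) (p : T).

Definition cube_wt w : R := \prod_p (if w p then q p else 1 - q p).

Definition cube_E F : R := \sum_w cube_wt w * F w.

Definition dif p F w : R := F (upd w p true) - F (upd w p false).

(** The conditional expectation of [F] given all coordinates but [p], kept as a function on the
    whole cube. *)
Definition avg p F w : R :=
  q p * F (upd w p true) + (1 - q p) * F (upd w p false).

Definition bvar p : R := q p * (1 - q p).

Lemma bvar_ge0 p : 0 <= bvar p.
Proof. by have /andP[? ?] := q01 p; rewrite mulr_ge0 ?subr_ge0. Qed.

Lemma cube_wt_ge0 w : 0 <= cube_wt w.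
Proof.
apply: prodr_ge0 => p _; have /andP[? ?] := q01 p.
by case: (w p); rewrite ?subr_ge0.
Qed.

Lemma cube_E1 : cube_E (fun=> 1) = 1.
Proof.
rewrite /cube_E; under eq_bigr do rewrite mulr1.
transitivity (\prod_(p : T) \sum_(b : bool) (if b then q p else 1 - q p)).
  by rewrite bigA_distr_bigA.
by apply: big1 => p _; rewrite big_bool /=; ring.
Qed.

Lemma eq_cube_E F G : (forall w, F w = G w) -> cube_E F = cube_E G.
Proof. by move=> FG; apply: eq_bigr => w _; rewrite FG. Qed.

Lemma cube_ED F G : cube_E (fun w => F w + G w) = cube_E F + cube_E G.
Proof. by rewrite -big_split /=; apply: eq_bigr => w _; rewrite mulrDr. Qed.

Lemma cube_EZ c F : cube_E (fun w => c * F w) = c * cube_E F.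
Proof. by rewrite mulr_sumr; apply: eq_bigr => w _; rewrite mulrCA. Qed.

Lemma cube_EB F G : cube_E (fun w => F w - G w) = cube_E F - cube_E G.
Proof.
rewrite -[- cube_E G]mulN1r -cube_EZ -cube_ED.
by apply: eq_cube_E => w; rewrite mulN1r.
Qed.

Lemma cube_Ecst c : cube_E (fun=> c) = c.
Proof.
rewrite -[RHS]mulr1 -cube_E1 -cube_EZ.
by apply: eq_cube_E => w; rewrite mulr1.
Qed.

Lemma cube_E_sum (I : Type) (s : seq I) (P : pred I)
    (F : I -> {ffun T -> bool} -> R) :
  cube_E (fun w => \sum_(i <- s | P i) F i w) = \sum_(i <- s | P i) cube_E (F i).
Proof.
rewrite exchange_big /=; apply: eq_bigr => w _.
by rewrite mulr_sumr.
Qed.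

Lemma cube_E_le F G : (forall w, F w <= G w) -> cube_E F <= cube_E G.
Proof. by move=> FG; apply: ler_sum => w _; rewrite ler_wpM2l ?cube_wt_ge0. Qed.

Lemma cube_E_ge0 F : (forall w, 0 <= F w) -> 0 <= cube_E F.
Proof. by move=> F0; rewrite -(cube_Ecst 0); exact: cube_E_le. Qed.

Lemma cube_E_norm F : `|cube_E F| <= cube_E (fun w => `|F w|).
Proof.
rewrite ler_norml -mulN1r -cube_EZ; apply/andP; split; apply: cube_E_le => w.
  by rewrite mulN1r lerNl ler_normr lexx orbT.
exact: ler_norm.
Qed.

Lemma cube_E_sqr_dev F m : cube_E (fun w => (F w - m) ^+ 2) =
  cube_E (fun w => F w ^+ 2) - 2 * m * cube_E F + m ^+ 2.
Proof.
rewrite -[X in _ = _ + X]cube_Ecst -cube_EZ -cube_EB -cube_ED.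
by apply: eq_cube_E => w; ring.
Qed.

Lemma upd_id w p : upd w p (w p) = w.
Proof. by apply/ffunP => x; rewrite updE; case: eqP => // ->. Qed.

Lemma upd_upd w p b c : upd (upd w p b) p c = upd w p c.
Proof. by apply/ffunP => x; rewrite !updE; case: eqP. Qed.

Lemma upd_same w p b : upd w p b p = b.
Proof. by rewrite updE eqxx. Qed.

Lemma upd_comm w p p' b c : p != p' ->
  upd (upd w p b) p' c = upd (upd w p' c) p b.
Proof.
move=> pp'; apply/ffunP => x; rewrite !updE.
by case: eqP => // ->; rewrite eq_sym (negPf pp').
Qed.

Let off_wt p w : R := \prod_(x | x != p) (if w x then q x else 1 - q x).

Let cube_wtE p w :
  cube_wt w = (if w p then q p else 1 - q p) * off_wt p w.
Proof. by rewrite /cube_wt (bigD1 p). Qed.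

Let off_wt_upd p w b : off_wt p (upd w p b) = off_wt p w.
Proof. by apply: eq_bigr => x xp; rewrite updE (negPf xp). Qed.

(** Switching [p] off is a bijection between the configurations with [p] on and those with [p] off,
    so the expectation can be summed over such pairs. *)
Let cube_E_pair p F : cube_E F =
  \sum_(w : {ffun T -> bool} | w p) off_wt p w * (q p * F w + (1 - q p) * F (upd w p false)).
Proof.
rewrite /cube_E (bigID (fun w : {ffun T -> bool} => w p)) /=.
rewrite [X in _ + X](reindex_onto (fun w => upd w p false) (fun w => upd w p true)) /=; last first.
  by move=> w wp; rewrite upd_upd -{2}(upd_id w p) (negbTE wp).
rewrite [X in _ + X](eq_bigl (fun w : {ffun T -> bool} => w p)); last first.
  move=> w; rewrite upd_same upd_upd /=.
  by apply/eqP/idP => [<-|wp]; [rewrite upd_same|rewrite -[RHS](upd_id w p) wp].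
rewrite -big_split /=; apply: eq_bigr => w wp.
by rewrite !(cube_wtE p) upd_same wp off_wt_upd; ring.
Qed.

Lemma cube_E_avg p F : cube_E (avg p F) = cube_E F.
Proof.
rewrite !(cube_E_pair p); apply: eq_bigr => w wp.
have E : upd w p true = w by rewrite -[RHS](upd_id w p) wp.
by rewrite /avg !upd_upd E; ring.
Qed.

(** Given the other coordinates, the centred variable is [1 - q p] with probability [q p] and
    [- q p] otherwise, so its product with [F] averages to the variance times a difference. *)
Lemma cube_E_ibp p F :
  cube_E (fun w => ((w p)%:R - q p) * F w) = bvar p * cube_E (dif p F).
Proof.
rewrite -(cube_E_avg p) -cube_EZ; apply: eq_cube_E => w.
by rewrite /avg /dif /bvar !upd_same /=; ring.
Qed.

Lemma dif_avg p p' F : p != p' -> dif p (avg p' F) = avg p' (dif p F).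
Proof.
move=> pp'; apply/funext => w; rewrite /dif /avg !(upd_comm w _ _ pp').
by ring.
Qed.

Lemma avg_sqr_le p F w : avg p F w ^+ 2 <= avg p (fun w => F w ^+ 2) w.
Proof.
rewrite /avg; have /andP[q0 q1] := q01 p.
set x := F _; set y := F _.
have : 0 <= q p * (1 - q p) * (x - y) ^+ 2.
  by rewrite mulr_ge0 ?sqr_ge0 // mulr_ge0 // subr_ge0.
by nra.
Qed.

Let avgs (s : seq T) F := foldr avg F s.

Let cube_E_avgs_sqr s F :
  cube_E (fun w => avgs s F w ^+ 2) <= cube_E (fun w => F w ^+ 2).
Proof.
elim: s => [|p s IH] /=; first exact: lexx.
apply: le_trans IH; rewrite -[leRHS](cube_E_avg p).
by apply: cube_E_le => w; exact: avg_sqr_le.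
Qed.

Let dif_avgs p s F : p \notin s -> dif p (avgs s F) = avgs s (dif p F).
Proof.
elim: s => //= p' s IH; rewrite inE negb_or => /andP[pp' ps].
by rewrite dif_avg // IH.
Qed.

Let cube_E_avg_sqr p F : cube_E (fun w => F w ^+ 2) =
  cube_E (fun w => avg p F w ^+ 2) + bvar p * cube_E (fun w => dif p F w ^+ 2).
Proof.
rewrite -[LHS](cube_E_avg p) -cube_EZ -cube_ED; apply: eq_cube_E => w.
by rewrite /avg /dif /bvar; ring.
Qed.

(** Averaging out one more coordinate costs exactly its mean conditional variance
    ([cube_E_avg_sqr]). The difference operator commutes with the averages already taken, and these
    contract the second moment by Jensen's inequality. *)
Let avgs_sqr_le s F : uniq s -> cube_E (fun w => F w ^+ 2) <=
  cube_E (fun w => avgs s F w ^+ 2) +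
  \sum_(p <- s) bvar p * cube_E (fun w => dif p F w ^+ 2).
Proof.
elim: s => [|p s IH] /=; first by rewrite big_nil addr0.
move=> /andP[ps us]; apply: (le_trans (IH us)).
rewrite big_cons addrA lerD2r (cube_E_avg_sqr p) lerD2l.
by rewrite ler_wpM2l ?bvar_ge0 // dif_avgs.
Qed.

Let avgs_upd s F p b w : p \in s -> avgs s F (upd w p b) = avgs s F w.
Proof.
elim: s w => //= p' s IH w; rewrite inE.
have [->|pp'] := eqVneq p p'; first by rewrite /avg !upd_upd.
by move=> /= ps; rewrite /avg !(upd_comm _ _ _ pp') !IH.
Qed.

Let avgs_cst F w w' : avgs (enum T) F w = avgs (enum T) F w'.
Proof.
(* Pass from [w] to [w'] one coordinate at a time: each of them has been averaged out. *)
suff H (s : seq T) : avgs (enum T) F w =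
    avgs (enum T) F [ffun x => if x \in s then w' x else w x].
  rewrite (H (enum T)); congr avgs; apply/ffunP => x.
  by rewrite ffunE mem_enum.
elim: s => [|p s IH].
  by congr (avgs _ _); apply/ffunP => x; rewrite ffunE.
rewrite IH -[in RHS](avgs_upd F (w p)  _ (mem_enum T p)) -[in LHS](avgs_upd F (w p)  _ (mem_enum T p)).
congr avgs; apply/ffunP => x; rewrite !updE !ffunE inE.
by case: eqP.
Qed.

Let cube_E_avgs s F : cube_E (avgs s F) = cube_E F.
Proof. by elim: s => //= p s IH; rewrite cube_E_avg. Qed.

(** The Efron--Stein inequality: once all coordinates are averaged out, only the constant [cube_E F]
    remains. *)
Lemma cube_poincare F : cube_E (fun w => F w ^+ 2) <=
  cube_E F ^+ 2 + \sum_p bvar p * cube_E (fun w => dif p F w ^+ 2).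
Proof.
have /= := avgs_sqr_le F (enum_uniq T).
rewrite big_enum /=; suff -> : cube_E (fun w => avgs (enum T) F w ^+ 2) = cube_E F ^+ 2 by [].
pose w0 : {ffun T -> bool} := [ffun=> true].
rewrite -(cube_E_avgs (enum T) F).
rewrite (eq_cube_E (fun w => congr1 (fun x => x ^+ 2) (avgs_cst F w w0))).
by rewrite (eq_cube_E (fun w => avgs_cst F w w0)) !cube_Ecst.
Qed.

Definition lin_form (c : T -> R) w : R := \sum_p c p * ((w p)%:R - q p).

Lemma cube_E_lin_form c F : cube_E (fun w => lin_form c w * F w) =
  \sum_p bvar p * c p * cube_E (dif p F).
Proof.
rewrite (eq_cube_E (G := fun w => \sum_p c p * (((w p)%:R - q p) * F w))).
  rewrite cube_E_sum; apply: eq_bigr => p _.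
  by rewrite cube_EZ cube_E_ibp mulrCA mulrA.
by move=> w; rewrite mulr_suml; apply: eq_bigr => p _; rewrite mulrA.
Qed.

Lemma dif_lin_form c p w : dif p (lin_form c) w = c p.
Proof.
rewrite /dif /lin_form -sumrB (bigD1 p) //= big1 ?addr0.
  by rewrite -mulrBr !upd_same /=; ring.
move=> p' pp'; rewrite -mulrBr !updE (negPf pp'); ring.
Qed.

Lemma upd_lin_form_near c p w b : `|lin_form c (upd w p b) - lin_form c w| <= `|c p|.
Proof.
have := dif_lin_form c p w; rewrite /dif => H.
have := upd_id w p; case: (w p) b => -[] => Hw; rewrite -{2}Hw ?subrr ?normr0 //.
  by rewrite -normrN opprB H.
by rewrite H.
Qed.

Lemma cube_E_lin_form0 c : cube_E (lin_form c) = 0.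
Proof.
rewrite -(eq_cube_E (F := fun w => lin_form c w * 1)); last by move=> w; rewrite mulr1.
rewrite cube_E_lin_form big1 // => p _.
by rewrite (eq_cube_E (G := fun=> 0)) ?cube_Ecst ?mulr0 // => w; rewrite /dif subrr.
Qed.

Lemma cube_E_lin_formM c d : cube_E (fun w => lin_form c w * lin_form d w) =
  \sum_p bvar p * c p * d p.
Proof.
rewrite cube_E_lin_form; apply: eq_bigr => p _.
by rewrite (eq_cube_E (dif_lin_form d p)) cube_Ecst.
Qed.

Lemma cube_E_lin_form2 c : cube_E (fun w => lin_form c w ^+ 2) =
  \sum_p bvar p * c p ^+ 2.
Proof.
rewrite (eq_cube_E (G := fun w => lin_form c w * lin_form c w)) //.
by rewrite cube_E_lin_formM; apply: eq_bigr => p _; rewrite -mulrA.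
Qed.

Lemma cube_E_lin_form_upd c p b :
  cube_E (fun w => lin_form c (upd w p b)) = c p * (b%:R - q p).
Proof.
have H w : lin_form c (upd w p b) =
  lin_form (fun x => if x == p then 0 else c x) w + c p * (b%:R - q p).
  rewrite /lin_form (bigD1 p) //= [X in _ = X + _](bigD1 p) //= eqxx upd_same.
  rewrite mul0r add0r addrC; congr +%R; apply: eq_bigr => x xp.
  by rewrite updE (negPf xp).
by rewrite (eq_cube_E H) cube_ED cube_E_lin_form0 add0r cube_Ecst.
Qed.

(** After one integration by parts the remaining factor is linear, and its mean is
    [c p * (1 - 2 * q p)] up to the factor [c p]. Hence no 3/2 power of the variance appears;
    [E_cubic_norm] depends on this. *)
Lemma cube_E_lin_form3 c : `|cube_E (fun w => lin_form c w ^+ 3)| <=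
  \sum_p bvar p * `|c p| ^+ 3.
Proof.
rewrite (eq_cube_E (G := fun w => lin_form c w * lin_form c w ^+ 2)) //.
rewrite cube_E_lin_form; apply: (le_trans (ler_norm_sum _ _ _)).
apply: ler_sum => p _.
rewrite (normrM (bvar p * c p)) (normrM (bvar p)) (ger0_norm (bvar_ge0 p)) exprS mulrA.
rewrite ler_wpM2l ?(mulr_ge0 (bvar_ge0 p)) //.
rewrite (eq_cube_E (G := fun w => c p * (lin_form c (upd w p true) + lin_form c (upd w p false)))); last first.
  by move=> w; rewrite /dif -(dif_lin_form c p w) /dif; ring.
rewrite cube_EZ cube_ED !cube_E_lin_form_upd /= -mulrDr !normrM mulrA -expr2.
rewrite -[leRHS]mulr1 ler_wpM2l ?sqr_ge0 //.
have /andP[? ?] := q01 p; rewrite ler_norml; apply/andP; split; lra.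
Qed.

(** Integration by parts leaves the difference of a cube, that is [c p] times a quadratic in two
    updated forms, each within [c p] of the form itself. *)
Lemma cube_E_lin_form4 c : cube_E (fun w => lin_form c w ^+ 4) <=
  6 * cube_E (fun w => lin_form c w ^+ 2) ^+ 2 + 6 * \sum_p bvar p * c p ^+ 4.
Proof.
rewrite (eq_cube_E (G := fun w => lin_form c w * lin_form c w ^+ 3)) //.
rewrite cube_E_lin_form.
set E2 := cube_E (fun w => lin_form c w ^+ 2).
have -> : 6 * E2 ^+ 2 + 6 * (\sum_p bvar p * c p ^+ 4) =
    \sum_p (6 * (bvar p * c p ^+ 2) * E2 + 6 * (bvar p * c p ^+ 4)).
  by rewrite big_split /= -mulr_suml -!mulr_sumr -cube_E_lin_form2 -/E2; ring.
apply: ler_sum => p _.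
suff H : c p * cube_E (dif p (fun w => lin_form c w ^+ 3)) <=
   6 * (c p ^+ 2 * E2) + 6 * c p ^+ 4.
  rewrite -mulrA; apply: (le_trans (ler_wpM2l (bvar_ge0 p) H)).
  by rewrite le_eqVlt; apply/orP; left; apply/eqP; ring.
rewrite -[X in _ + X](cube_Ecst) /E2 -!cube_EZ -cube_ED; apply: cube_E_le => w.
have -> : dif p (fun w => lin_form c w ^+ 3) w =
  c p * (lin_form c (upd w p true) ^+ 2 +
    lin_form c (upd w p true) * lin_form c (upd w p false) +
    lin_form c (upd w p false) ^+ 2).
  by rewrite -(dif_lin_form c p w) /dif; ring.
have := upd_lin_form_near c p w true; have := upd_lin_form_near c p w false.
set x1 := lin_form c _; set x0 := lin_form c w; set x2 := lin_form c _.
move=> h1 h2.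
have sqle x : `|x - x0| <= `|c p| -> x ^+ 2 <= 2 * x0 ^+ 2 + 2 * c p ^+ 2.
  move=> h; have : (x - x0) ^+ 2 <= c p ^+ 2.
    by rewrite -[leLHS]real_normK ?num_real // -[leRHS]real_normK ?num_real // lerXn2r ?nnegrE.
  have := sqr_ge0 (x - 2 * x0); nra.
have := sqle _ h1; have := sqle _ h2 => k2 k1.
have c2 : 0 <= c p ^+ 2 by exact: sqr_ge0.
have xx : x2 ^+ 2 + x2 * x1 + x1 ^+ 2 <= 6 * x0 ^+ 2 + 6 * c p ^+ 2.
  by have := sqr_ge0 (x2 - x1); nra.
have := ler_wpM2l c2 xx.
by rewrite (_ : 6 * c p ^+ 4 = c p ^+ 2 * (6 * c p ^+ 2)); [nra|ring].
Qed.

Lemma cube_markov F (a : R) : 0 < a -> (forall w, 0 <= F w) ->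
  cube_E (fun w => (a <= F w)%R%:R) <= cube_E F / a.
Proof.
move=> a0 F0; rewrite ler_pdivlMr // mulrC -cube_EZ; apply: cube_E_le => w.
by case: (leP a (F w)) => h /=; rewrite ?mulr1 ?mulr0 ?F0.
Qed.

End BernoulliCube.

(** * Derivatives and Taylor bounds for the logistic function *)

Section RealDerivatives.
Context {R : realType}.
Implicit Types (f g df : R -> R) (x : R).

Lemma cvg_add {T : Type} {F : set_system T} {FF : Filter F} (f g : T -> R) (a b : R) :
  f x @[x --> F] --> a -> g x @[x --> F] --> b -> f x + g x @[x --> F] --> a + b.
Proof. exact: cvgD. Qed.

Lemma cvg_sub {T : Type} {F : set_system T} {FF : Filter F} (f g : T -> R) (a b : R) :
  f x @[x --> F] --> a -> g x @[x --> F] --> b -> f x - g x @[x --> F] --> a - b.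
Proof. exact: cvgB. Qed.

Lemma cvg_mul {T : Type} {F : set_system T} {FF : Filter F} (f g : T -> R) (a b : R) :
  f x @[x --> F] --> a -> g x @[x --> F] --> b -> f x * g x @[x --> F] --> a * b.
Proof. exact: cvgM. Qed.

Lemma deriv1_cst (c x : R) : is_derive x 1 (fun _ : R => c) 0.
Proof. exact: is_derive_cst. Qed.

Lemma deriv1_id (x : R) : is_derive x 1 (fun y : R => y) 1.
Proof. exact: is_derive_id. Qed.

Lemma deriv1_add f g x a b : is_derive x 1 f a -> is_derive x 1 g b ->
  is_derive x 1 (fun y => f y + g y) (a + b).
Proof. by move=> Hf Hg; exact: is_deriveD. Qed.

Lemma deriv1_opp f x a : is_derive x 1 f a -> is_derive x 1 (fun y => - f y) (- a).
Proof. by move=> Hf; exact: is_deriveN. Qed.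

Lemma deriv1_mul f g x a b : is_derive x 1 f a -> is_derive x 1 g b ->
  is_derive x 1 (fun y => f y * g y) (a * g x + f x * b).
Proof.
move=> Hf Hg; apply: is_derive_eq.
by rewrite addrC; congr (_ + _); rewrite /GRing.scale /= mulrC.
Qed.

Lemma deriv1_comp f g x a b : is_derive (g x) 1 f a -> is_derive x 1 g b ->
  is_derive x 1 (fun y => f (g y)) (a * b).
Proof. by move=> Hf Hg; exact: is_derive1_comp. Qed.

Lemma deriv1_exp f n x a : is_derive x 1 f a ->
  is_derive x 1 (fun y => f y ^+ n.+1) (n.+1%:R * f x ^+ n * a).
Proof.
move=> Hf; have -> : (fun y => f y ^+ n.+1) = f ^+ n.+1.
  by apply/funext => y; rewrite exprfctE.
exact: is_deriveX.
Qed.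

Lemma deriv1_inv f x a : f x != 0 -> is_derive x 1 f a ->
  is_derive x 1 (fun y => (f y)^-1) (- (f x) ^- 2 * a).
Proof. by move=> f0 Hf; exact: is_deriveV. Qed.

Lemma derive_continuous f df : (forall x : R, is_derive x 1 f (df x)) -> continuous f.
Proof.
move=> Hf x; apply/differentiable_continuous/derivable1_diffP.
by have [] := Hf x.
Qed.

Lemma MVT_le f df a b : a <= b -> (forall x : R, is_derive x 1 f (df x)) ->
  exists2 c, a <= c <= b & f b - f a = df c * (b - a).
Proof.
move=> ab Hf.
have [|c ci E] := @MVT_segment R f df a b ab (fun x _ => Hf x).
  exact/continuous_subspaceT/(derive_continuous Hf).
by exists c => //; move: ci; rewrite in_itv.
Qed.

Lemma MVT_scaled f df x : (forall y : R, is_derive y 1 f (df y)) ->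
  exists2 t, 0 <= t <= 1 & f x - f 0 = df (t * x) * x.
Proof.
move=> Hf; have [->|x0] := eqVneq x 0.
  by exists 0; rewrite ?lexx ?ler01 // subrr mulr0.
have [xge|xlt] := leP 0 x.
  have [c /andP[c0 cx] E] := MVT_le xge Hf; exists (c / x).
    rewrite divr_ge0 //= ler_pdivrMr ?mul1r //.
    by rewrite lt_neqAle eq_sym x0.
  by rewrite divfK // E subr0.
have [c /andP[xc c0] E] := MVT_le (ltW xlt) Hf; exists (c / x).
  rewrite -mulrNN -invrN divr_ge0 ?oppr_ge0 // ?(ltW xlt) //=.
  by rewrite ler_pdivrMr ?oppr_gt0 // mul1r lerN2.
by rewrite divfK // -opprB E; ring.
Qed.

(** One integration of a Taylor remainder. The mean value theorem replaces the integral, so [K] is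
    kept and not divided by [k.+1]. *)
Lemma pow_bound_primitive f df (K : R) k : f 0 = 0 ->
  (forall y : R, is_derive y 1 f (df y)) ->
  (forall y, `|y| <= 1 -> `|df y| <= K * `|y| ^+ k) ->
  forall x, `|x| <= 1 -> `|f x| <= K * `|x| ^+ k.+1.
Proof.
move=> f0 Hf Hdf x x1; have [t /andP[t0 t1] E] := MVT_scaled x Hf.
move: E; rewrite f0 subr0 => ->; rewrite normrM.
have tx : `|t * x| <= `|x| by rewrite normrM (ger0_norm t0) ler_piMl.
have := Hdf (t * x) (le_trans tx x1) => H.
have K0 : 0 <= K by have := Hdf 1; rewrite normr1 expr1n mulr1 => /(_ (lexx _)); exact: le_trans.
rewrite exprSr mulrA ler_wpM2r //; apply: (le_trans H); rewrite ler_wpM2l //.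
by rewrite lerXn2r // nnegrE.
Qed.

End RealDerivatives.

(* Class resolution is bypassed: it would pick the library instances, whose
   derivatives are stated with scaling of functions. *)
Ltac derive_auto :=
  repeat first [ eassumption
    | notypeclasses refine (deriv1_cst _ _) | notypeclasses refine (deriv1_id _)
    | notypeclasses refine (is_derive_expR _)
    | notypeclasses refine (deriv1_opp _)
    | notypeclasses refine (deriv1_exp _ _)
    | notypeclasses refine (deriv1_add _ _)
    | notypeclasses refine (deriv1_mul _ _)
    | notypeclasses refine (deriv1_inv _ _) ].

Ltac derive_as := notypeclasses refine (is_derive_eq _ _); [derive_auto|cbv beta].

(** * The logistic function: derivatives, local comparison, Taylor bounds and convexity *)

Section Logistic.
Context {R : realType}.
Implicit Types x y h : R.

Definition softplus x : R := ln (1 + expR x).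
Definition dmu x : R := mu x * (1 - mu x).
Definition ddmu x : R := dmu x * (1 - 2 * mu x).
Definition dddmu x : R := dmu x * (1 - 6 * mu x + 6 * mu x ^+ 2).

Lemma one_expR_gt0 x : 0 < 1 + expR x.
Proof. by rewrite ltr_wpDr ?ltr01 ?expR_ge0. Qed.

Lemma mu_gt0 x : 0 < mu x.
Proof. by rewrite divr_gt0 ?expR_gt0 ?one_expR_gt0. Qed.

Lemma mu_lt1 x : mu x < 1.
Proof. by rewrite ltr_pdivrMr ?one_expR_gt0 // mul1r ltrDr ltr01. Qed.

Lemma mu_01 x : 0 <= mu x <= 1.
Proof. by rewrite (ltW (mu_gt0 x)) (ltW (mu_lt1 x)). Qed.

Lemma dmu_gt0 x : 0 < dmu x.
Proof. by rewrite mulr_gt0 ?mu_gt0 // subr_gt0 mu_lt1. Qed.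

Lemma dmu_le1 x : dmu x <= 1.
Proof. by have := mu_gt0 x; have := mu_lt1 x; rewrite /dmu; nra. Qed.

Lemma dmuE x : dmu x = expR x / (1 + expR x) ^+ 2.
Proof. by have := lt0r_neq0 (one_expR_gt0 x) => ?; rewrite /dmu /mu; field. Qed.

Lemma vfunE x : vfun x = (dmu x)^-1.
Proof. by rewrite dmuE invf_div. Qed.

Lemma derive_softplus x : is_derive x 1 softplus (mu x).
Proof.
have H : is_derive x 1 (fun y => 1 + expR y) (0 + expR x) by derive_auto.
have L : is_derive (1 + expR x) 1 (@ln R) (1 + expR x)^-1.
  exact/is_derive1_ln/one_expR_gt0.
have := deriv1_comp (g := fun y => 1 + expR y) L H.
by rewrite add0r /mu mulrC.
Qed.

Lemma derive_mu x : is_derive x 1 (@mu R) (dmu x).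
Proof.
have n0 := lt0r_neq0 (one_expR_gt0 x).
rewrite /mu; derive_as.
by rewrite dmuE; field.
Qed.

Lemma derive_dmu x : is_derive x 1 dmu (ddmu x).
Proof.
have H := derive_mu x; rewrite /dmu.
by derive_as; rewrite /ddmu /dmu; ring.
Qed.

Lemma derive_ddmu x : is_derive x 1 ddmu (dddmu x).
Proof.
have H := derive_mu x; have H1 := derive_dmu x; rewrite /ddmu.
by derive_as; rewrite /dddmu /ddmu /dmu; ring.
Qed.

Lemma ddmu_le x : `|ddmu x| <= dmu x.
Proof.
have := mu_gt0 x; have := mu_lt1 x; have d0 := dmu_gt0 x => m1 m0.
rewrite normrM (gtr0_norm d0) ger_pMr // ler_norml; apply/andP; split; lra.
Qed.

Lemma dddmu_le x : `|dddmu x| <= dmu x.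
Proof.
have := mu_gt0 x; have := mu_lt1 x; have d0 := dmu_gt0 x => m1 m0.
rewrite normrM (gtr0_norm d0) ger_pMr // ler_norml; apply/andP; split; nra.
Qed.

Lemma expR1_le4 : expR 1 <= 4 :> R.
Proof.
have h : 2^-1 <= expR (- 2^-1) :> R.
  by apply: le_trans (expR_ge1Dx _); lra.
have -> : 1 = - (- 2^-1) + - (- 2^-1) :> R by lra.
rewrite expRD expRN.
have e0 : 0 < expR (- 2^-1) :> R by exact: expR_gt0.
have : (expR (- 2^-1))^-1 <= 2 :> R.
  by rewrite -[leRHS]invrK lef_pV2 ?posrE ?invr_gt0 ?ltr0n.
have : 0 < (expR (- 2^-1))^-1 :> R by rewrite invr_gt0.
nra.
Qed.

(** The logarithmic derivative of [dmu] is [1 - 2 * mu], of absolute value at most 1. The proof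
    checks the resulting bound algebraically, by the sign of [h]. *)
Lemma dmu_shift_le x h : dmu (x + h) <= expR `|h| * dmu x.
Proof.
rewrite !dmuE mulrA ler_pdivrMr ?exprn_gt0 ?one_expR_gt0 //.
rewrite mulrAC ler_pdivlMr ?exprn_gt0 ?one_expR_gt0 // expRD.
have a0 := expR_gt0 x; have b0 := expR_gt0 h.
set a := expR x in a0 *; set b := expR h in b0 *.
have [h0|h0] := leP 0 h.
  have b1 : 1 <= b by rewrite /b -expR0 ler_expR.
  have k : (1 + a) ^+ 2 <= (1 + a * b) ^+ 2.
    rewrite lerXn2r ?nnegrE ?addr_ge0 ?mulr_ge0 ?ler01 ?(ltW a0) ?(ltW b0) //.
    by rewrite lerD2l ler_peMr // ltW.
  rewrite (ger0_norm h0) -/b [b * a]mulrC ler_wpM2l //.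
  by rewrite mulr_ge0 ?(ltW a0) ?(ltW b0).
rewrite (ltr0_norm h0) expRN -/b.
have b1 : b <= 1 by rewrite /b -expR0 ler_expR ltW.
have k : (b * (1 + a)) ^+ 2 <= (1 + a * b) ^+ 2.
  rewrite lerXn2r ?nnegrE ?addr_ge0 ?mulr_ge0 ?addr_ge0 ?ler01 ?(ltW a0) ?(ltW b0) //.
  by rewrite mulrDr mulr1 (mulrC a) lerD2r.
have c0 : 0 <= b^-1 * a by rewrite mulr_ge0 ?invr_ge0 ?(ltW a0) ?(ltW b0).
have := ler_wpM2l c0 k; rewrite (_ : b^-1 * a * (b * (1 + a)) ^+ 2 = a * b * (1 + a) ^+ 2) //.
by field; rewrite lt0r_neq0.
Qed.

Lemma dmu_near x h : `|h| <= 1 -> dmu (x + h) <= 4 * dmu x.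
Proof.
move=> h1; apply: (le_trans (dmu_shift_le x h)).
rewrite ler_wpM2r ?(ltW (dmu_gt0 _)) //; apply: le_trans expR1_le4.
by rewrite ler_expR.
Qed.

Lemma dmu_near_ge x h : `|h| <= 1 -> dmu x / 4 <= dmu (x + h).
Proof.
move=> h1; have := @dmu_near (x + h) (- h); rewrite normrN addrK => /(_ h1).
lra.
Qed.

Lemma derive_shift (f df : R -> R) a : (forall y : R, is_derive y 1 f (df y)) ->
  forall y : R, is_derive y 1 (fun y => f (a + y)) (df (a + y)).
Proof.
move=> Hf y; have H : is_derive y 1 (fun y => a + y) (0 + 1) by derive_auto.
by have := deriv1_comp (g := fun y => a + y) (Hf (a + y)) H; rewrite add0r mulr1.
Qed.

Lemma ddmu_primitive_bound a x : `|x| <= 1 -> `|dmu (a + x) - dmu a| <= 4 * dmu a * `|x|.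
Proof.
have H (y : R) : is_derive y 1 (fun y => dmu (a + y) - dmu a) (ddmu (a + y)).
  have H0 := derive_shift a derive_dmu y.
  by derive_as; ring.
move=> x1; rewrite -[`|x|]expr1.
apply: (pow_bound_primitive (k := 0) _ H) x1 => [|y y1]; first by rewrite addr0 subrr.
by rewrite expr0 mulr1 (le_trans (ddmu_le _)) // dmu_near.
Qed.

Lemma mu_taylor1 a x : `|x| <= 1 ->
  `|mu (a + x) - mu a - dmu a * x| <= 4 * dmu a * `|x| ^+ 2.
Proof.
move: x; apply: (pow_bound_primitive (df := fun y => dmu (a + y) - dmu a)).
- by rewrite addr0; ring.
- move=> y; have H0 := derive_shift a derive_mu y.
  by derive_as; ring.
by move=> y y1; rewrite expr1; exact: ddmu_primitive_bound.
Qed.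

Lemma softplus_taylor3 a x : `|x| <= 1 ->
  `|softplus (a + x) - softplus a - mu a * x - dmu a / 2 * x ^+ 2
    - ddmu a / 6 * x ^+ 3| <= 4 * dmu a * `|x| ^+ 4.
Proof.
have H0 y1 := derive_shift a derive_softplus y1.
have H1 y1 := derive_shift a derive_mu y1.
have H2 y1 := derive_shift a derive_dmu y1.
have H3 y1 := derive_shift a derive_ddmu y1.
(* The fourth derivative [dddmu] is at most [4 * dmu a] on the unit interval around [a]; four
   integrations of this bound give the claim. *)
have B3 y : `|y| <= 1 -> `|ddmu (a + y) - ddmu a| <= 4 * dmu a * `|y| ^+ 1.
  move: y; apply: (pow_bound_primitive (df := fun y => dddmu (a + y))).
  - by rewrite addr0 subrr.
  - move=> y; have H3y := H3 y.
    by derive_as; ring.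
  - by move=> y y1; rewrite expr0 mulr1 (le_trans (dddmu_le _)) // dmu_near.
have B2 y : `|y| <= 1 -> `|dmu (a + y) - dmu a - ddmu a * y| <= 4 * dmu a * `|y| ^+ 2.
  move: y; apply: (pow_bound_primitive _ _ B3); first by rewrite addr0; ring.
  move=> y; have H2y := H2 y.
  by derive_as; ring.
have B1 y : `|y| <= 1 -> `|mu (a + y) - mu a - dmu a * y - ddmu a / 2 * y ^+ 2|
    <= 4 * dmu a * `|y| ^+ 3.
  move: y; apply: (pow_bound_primitive _ _ B2); first by rewrite addr0; ring.
  move=> y; have H1y := H1 y.
  by derive_as; field.
move: x; apply: (pow_bound_primitive _ _ B1); first by rewrite addr0; ring.
move=> y; have H0y := H0 y.
by derive_as; field.
Qed.

(** The second derivative is at least [dmu a / 4] near [a], and 1/8 is half of 1/4. The mean value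
    theorem is applied twice after corresponding multiples of [dmu a] are subtracted. *)
Lemma softplus_quadratic_lower a y : `|y| <= 1 ->
  dmu a / 8 * y ^+ 2 <= softplus (a + y) - softplus a - mu a * y.
Proof.
move=> y1; have H0 := derive_shift a derive_softplus.
have H (z : R) : is_derive z 1 (fun y => softplus (a + y) - mu a * y - dmu a / 8 * y ^+ 2)
   (mu (a + z) - mu a - dmu a / 4 * z).
  have H0z := H0 z.
  by derive_as; field.
have H1 (z : R) : is_derive z 1 (fun y => mu (a + y) - dmu a / 4 * y) (dmu (a + z) - dmu a / 4).
  have H1z := derive_shift a derive_mu z.
  by derive_as; field.
have [t /andP[t0 t1] E] := MVT_scaled y H.
have [s /andP[s0 s1] E'] := MVT_scaled (t * y) H1.
have ty : `|s * (t * y)| <= 1.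
  rewrite !normrM (ger0_norm t0) (ger0_norm s0); apply: le_trans y1.
  by rewrite mulrA ler_piMl // mulr_ile1.
have := dmu_near_ge a ty; rewrite -subr_ge0; set e := _ - _ => e0.
move: E E'; rewrite !addr0 !mulr0 subr0 => E E'.
have E2 : mu (a + t * y) - mu a - dmu a / 4 * (t * y) = e * (t * y).
  by rewrite -E' /e; ring.
have : 0 <= e * t * y ^+ 2 by rewrite mulr_ge0 ?sqr_ge0 // mulr_ge0.
have : softplus (a + y) - mu a * y - dmu a / 8 * y ^+ 2 - softplus a = e * t * y ^+ 2.
  by move: E; rewrite E2 expr0n /= mulr0 !subr0 => ->; ring.
lra.
Qed.

Lemma mu_le x y : x <= y -> mu x <= mu y.
Proof.
move=> xy; have [c _ E] := MVT_le xy derive_mu.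
rewrite -subr_ge0 E mulr_ge0 ?subr_ge0 //; exact/ltW/dmu_gt0.
Qed.

Lemma softplus_tangent x y : softplus x + mu x * (y - x) <= softplus y.
Proof.
have [xy|yx] := leP x y.
  have [c /andP[xc _] E] := MVT_le xy derive_softplus.
  by have := ler_wpM2r (_ : 0 <= y - x) (mu_le xc); rewrite subr_ge0 => /(_ xy); lra.
have [c /andP[_ cx] E] := MVT_le (ltW yx) derive_softplus.
have := ler_wpM2r (_ : 0 <= x - y) (mu_le cx); rewrite subr_ge0 => /(_ (ltW yx)); lra.
Qed.

Lemma softplus_convex t x y : 0 <= t <= 1 ->
  softplus (x + t * (y - x)) <= softplus x + t * (softplus y - softplus x).
Proof.
move=> /andP[t0 t1]; set z := x + _.
have hx := softplus_tangent z x; have hy := softplus_tangent z y.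
have t1' : 0 <= 1 - t by rewrite subr_ge0.
have := ler_wpM2l t1' hx; have := ler_wpM2l t0 hy.
have : (1 - t) * (mu z * (x - z)) + t * (mu z * (y - z)) = 0 by rewrite /z; ring.
nra.
Qed.

End Logistic.

(** * The beta-model as a product Bernoulli measure on the edges *)

Section EdgeSums.
Context {R : realType} {n : nat}.
Implicit Types (p : upair n) (i j : 'I_n) (w : graph n).

Definition src p : 'I_n := (val p).1.
Definition tgt p : 'I_n := (val p).2.
Definition inc p i : R := ((i == src p) || (i == tgt p))%:R.

Lemma src_neq_tgt p : src p != tgt p.
Proof. by rewrite -val_eqE ltn_eqF //; exact: (valP p). Qed.

Lemma incE p i : inc p i = (i == src p)%:R + (i == tgt p)%:R.
Proof.
rewrite /inc; case: eqP => [->|_] /=; last by rewrite add0r.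
by rewrite (negPf (src_neq_tgt p)) addr0.
Qed.

Lemma inc_ge0 p i : 0 <= inc p i. Proof. exact: ler0n. Qed.

Lemma inc_le1 p i : inc p i <= 1. Proof. by rewrite /inc; case: (_ || _). Qed.

Lemma inc_sqr p i : inc p i ^+ 2 = inc p i.
Proof. by rewrite /inc; case: (_ || _); rewrite ?expr1n ?expr0n. Qed.

Lemma sum_endpoints p (X : 'I_n -> R) :
  \sum_i inc p i * X i = X (src p) + X (tgt p).
Proof.
under eq_bigr do rewrite incE mulrDl.
rewrite big_split /=; congr (_ + _).
  by rewrite (bigD1 (src p)) //= eqxx mul1r big1 ?addr0 // => i /negPf ->; rewrite mul0r.
by rewrite (bigD1 (tgt p)) //= eqxx mul1r big1 ?addr0 // => i /negPf ->; rewrite mul0r.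
Qed.

Let emb p : 'I_n * 'I_n := val p.

Lemma sum_edges (G : 'I_n * 'I_n -> R) :
  \sum_(x : 'I_n * 'I_n | (x.1 < x.2)%N) G x = \sum_(p : upair n) G (val p).
Proof.
rewrite (@reindex_omap _ _ _ _ _ emb
  (@insub _ (fun x : 'I_n * 'I_n => (x.1 < x.2)%N) (upair n))
  (fun x : 'I_n * 'I_n => (x.1 < x.2)%N) G) /=; last first.
  by move=> x x12; rewrite insubT.
by apply: eq_bigl => p; rewrite (valP p) valK eqxx.
Qed.

(** An edge at [i] is determined by its other end, and the symmetry of [F] makes it irrelevant which
    of the two is the source. *)
Lemma sum_incident i (F : 'I_n -> 'I_n -> R) : (forall a b, F a b = F b a) ->
  \sum_p inc p i * F (src p) (tgt p) = \sum_(j | j != i) F i j.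
Proof.
move=> symF.
rewrite -(sum_edges (fun x => ((i == x.1) || (i == x.2))%:R * F x.1 x.2)).
rewrite big_mkcond /=.
rewrite -(pair_big predT predT (fun a b : 'I_n => if (a < b)%N then ((i == a) || (i == b))%:R * F a b else 0)) /=.
rewrite (eq_bigr (fun a => \sum_(b < n) (((i == a) && (i < b)%N)%:R * F i b) +
    \sum_(b < n) (((i == b) && (a < i)%N)%:R * F i a))); last first.
  move=> a _; rewrite -big_split /=; apply: eq_bigr => b _.
  have [<-|ia] := eqVneq i a; have [<-|ib] := eqVneq i b;
    rewrite ?ltnn /= ?mul0r ?mul1r ?addr0 ?add0r //; do ?case: ifP => _ //;
    rewrite ?mul0r ?mul1r //; by rewrite symF.
rewrite big_split /= exchange_big /= -big_split /= [RHS]big_mkcond /=.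
apply: eq_bigr => j _.
rewrite [X in X + _](bigD1 i) //= eqxx /= [X in _ + X + _]big1 ?addr0; last first.
  by move=> k /negPf ki; rewrite eq_sym ki mul0r.
rewrite [X in _ + X](bigD1 i) //= eqxx /= [X in _ + (_ + X)]big1 ?addr0; last first.
  by move=> k /negPf ki; rewrite eq_sym ki mul0r.
rewrite -val_eqE /=; case: ltngtP => _ /=; rewrite ?mul1r ?mul0r ?addr0 ?add0r //.
Qed.

Lemma adj_sym w i j : adj w i j = adj w j i :> R.
Proof.
rewrite /adj; case: insubP => [p pi|nij]; last by case: insubP.
by case: insubP => // p'; move: pi => /= ij ji; move: (ltn_trans ij ji); rewrite ltnn.
Qed.

Lemma adj_edge w p : adj w (src p) (tgt p) = (w p)%:R :> R.
Proof. by rewrite /adj -surjective_pairing valK. Qed.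

Lemma degreeE w i : degree w i = \sum_p inc p i * (w p)%:R :> R.
Proof.
rewrite /degree -(@sum_incident i (adj w)); last exact: adj_sym.
by apply: eq_bigr => p _; rewrite adj_edge.
Qed.

(** In this edgewise form all later estimates reduce to statements about [softplus] in one
    variable. *)
Lemma loglikE w (g : 'I_n -> R) : loglik w g =
  \sum_p ((w p)%:R * (g (src p) + g (tgt p)) - softplus (g (src p) + g (tgt p))).
Proof.
rewrite /loglik sum_edges sumrB; congr (_ - _).
transitivity (\sum_i \sum_p inc p i * g i * (w p)%:R).
  by apply: eq_bigr => i _; rewrite degreeE mulr_sumr; apply: eq_bigr => p _; rewrite mulrCA mulrA.
rewrite exchange_big /=; apply: eq_bigr => p _.
by rewrite -mulr_suml sum_endpoints mulrC.
Qed.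

End EdgeSums.

Section BetaModel.
Context {R : realType} {n : nat} (beta : 'I_n -> R).
Implicit Types (p f : upair n) (i j k : 'I_n) (w : graph n).

Definition edge_par p : R := beta (src p) + beta (tgt p).
Definition edge_prob p : R := mu (edge_par p).
Definition edge_var p : R := dmu (edge_par p).
(** The off-diagonal part of the Fisher information at [beta]; [deg_var] is its diagonal. *)
Definition var_mx i j : R := if i == j then 0 else dmu (beta i + beta j).
Definition deg_var i : R := \sum_p edge_var p * inc p i.
Definition cdeg w i : R := lin_form edge_prob (fun p => inc p i) w.

Lemma edge_prob_01 p : 0 <= edge_prob p <= 1. Proof. exact: mu_01. Qed.

Lemma edge_var_ge0 p : 0 <= edge_var p. Proof. exact/ltW/dmu_gt0. Qed.

Lemma bvarE p : bvar edge_prob p = edge_var p. Proof. by []. Qed.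

Lemma ProbE (A : graph n -> Prop) :
  Prob beta A = cube_E edge_prob (fun w => `[< A w >]%:R).
Proof.
rewrite /Prob /cube_E big_mkcond /=; apply: eq_bigr => w _.
by case: asboolP => _; rewrite ?mulr1 ?mulr0.
Qed.

Lemma var_mx_sym i j : var_mx i j = var_mx j i.
Proof. by rewrite /var_mx eq_sym addrC. Qed.

Lemma var_mx_ge0 i j : 0 <= var_mx i j.
Proof. by rewrite /var_mx; case: eqP => // _; exact/ltW/dmu_gt0. Qed.

Lemma var_mx_le1 i j : var_mx i j <= 1.
Proof. by rewrite /var_mx; case: eqP => // _; exact: dmu_le1. Qed.

Lemma deg_varE i : deg_var i = \sum_j var_mx i j.
Proof.
have := @sum_incident R n i (fun a b => dmu (beta a + beta b)).
move=> /(_ (fun a b => congr1 dmu (addrC _ _))) H.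
rewrite [RHS](bigD1 i) //= {1}/var_mx eqxx add0r.
rewrite (eq_bigr (fun j => dmu (beta i + beta j))); last first.
  by move=> j ji; rewrite /var_mx eq_sym (negPf ji).
by rewrite -H; apply: eq_bigr => p _; rewrite mulrC.
Qed.

Lemma deg_var_ge0 i : 0 <= deg_var i.
Proof. by apply: sumr_ge0 => p _; rewrite mulr_ge0 ?edge_var_ge0 ?inc_ge0. Qed.

Lemma handshake (X : 'I_n -> R) :
  \sum_p edge_var p * (X (src p) + X (tgt p)) = \sum_i deg_var i * X i.
Proof.
transitivity (\sum_p \sum_i edge_var p * inc p i * X i).
  by apply: eq_bigr => p _; rewrite -sum_endpoints mulr_sumr; apply: eq_bigr => i _; rewrite mulrA.
by rewrite exchange_big /=; apply: eq_bigr => i _; rewrite mulr_suml.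
Qed.

(** The left side is row [i] of the Fisher information, assembled from the edges, applied to [x]. *)
Lemma var_mx_sum i (x : 'I_n -> R) :
  \sum_p edge_var p * inc p i * (x (src p) + x (tgt p)) = deg_var i * x i + \sum_j var_mx i j * x j.
Proof.
have := @sum_incident R n i (fun a b => dmu (beta a + beta b) * (x a + x b)).
have sym a b : dmu (beta a + beta b) * (x a + x b) = dmu (beta b + beta a) * (x b + x a).
  by rewrite addrC [x a + _]addrC.
move=> /(_ sym) H.
rewrite (eq_bigr (fun p => inc p i * (dmu (beta (src p) + beta (tgt p)) * (x (src p) + x (tgt p))))).
  rewrite H deg_varE mulr_suml -big_split /= [RHS](bigD1 i) //= {1 2}/var_mx eqxx !mul0r !add0r.
  by apply: eq_bigr => j ji; rewrite /var_mx eq_sym (negPf ji) mulrDr.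
by move=> p _; rewrite mulrCA mulrA.
Qed.

End BetaModel.

(** * Moments of the first-order approximation *)

Section Inequalities.
Context {R : realType}.

Lemma weighted_cauchy (I : finType) (a z : I -> R) : (forall i, 0 <= a i) ->
  (\sum_i a i * z i) ^+ 2 <= (\sum_i a i) * \sum_i a i * z i ^+ 2.
Proof.
move=> a0; set A := \sum_i a i; set S := \sum_i a i * z i.
set S2 := \sum_i a i * z i ^+ 2.
have A0 : 0 <= A by apply: sumr_ge0.
have key t : 0 <= t ^+ 2 * A - 2 * t * S + S2.
  have -> : t ^+ 2 * A - 2 * t * S + S2 = \sum_i a i * (t - z i) ^+ 2.
    by rewrite /A /S /S2 !mulr_sumr -sumrB -big_split /=; apply: eq_bigr => i _; ring.
  by apply: sumr_ge0 => i _; rewrite mulr_ge0 ?sqr_ge0.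
have [A00|An0] := eqVneq A 0.
  have ai i : a i = 0.
    exact: (psumr_eq0P (fun i _ => a0 i) A00).
  by rewrite /S big1 ?expr0n ?A00 ?mul0r // => i _; rewrite ai mul0r.
have Ap : 0 < A by rewrite lt_neqAle eq_sym An0.
have := key (S / A); rewrite (_ : _ + _ = (A * S2 - S ^+ 2) / A); last by field.
by rewrite pmulr_lge0 ?invr_gt0 // subr_ge0.
Qed.

Lemma sqr_sum2 (x y : R) : (x + y) ^+ 2 <= 2 * (x ^+ 2 + y ^+ 2).
Proof. by have := sqr_ge0 (x - y); nra. Qed.

Lemma quart_sum2 (x y : R) : (x + y) ^+ 4 <= 8 * (x ^+ 4 + y ^+ 4).
Proof.
have h := sqr_sum2 x y; have k := sqr_sum2 (x ^+ 2) (y ^+ 2).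
have : ((x + y) ^+ 2) ^+ 2 <= (2 * (x ^+ 2 + y ^+ 2)) ^+ 2.
  by rewrite lerXn2r ?nnegrE ?sqr_ge0 ?mulr_ge0 ?addr_ge0 ?sqr_ge0.
by rewrite exprMn; nra.
Qed.

Lemma cube_norm_sum2 (x y : R) : 0 <= x -> 0 <= y ->
  (x + y) ^+ 3 <= 4 * (x ^+ 3 + y ^+ 3).
Proof.
move=> x0 y0; have : 0 <= (x + y) * (x - y) ^+ 2.
  by rewrite mulr_ge0 ?sqr_ge0 ?addr_ge0.
by nra.
Qed.

Lemma mulr3_ge0 (x y z : R) : 0 <= x -> 0 <= y -> 0 <= z -> 0 <= x * y * z.
Proof. by move=> x0 y0 z0; rewrite mulr_ge0 // mulr_ge0. Qed.

Lemma norm_le_sqr (b x : R) : 0 < b -> `|x| <= (x ^+ 2 / b + b) / 2.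
Proof.
move=> b0; have : 0 <= (`|x| - b) ^+ 2 / b by rewrite divr_ge0 ?sqr_ge0 ?ltW.
have -> : (`|x| - b) ^+ 2 / b = x ^+ 2 / b - 2 * `|x| + b.
  by rewrite -[x ^+ 2]real_normK ?num_real //; field; rewrite lt0r_neq0.
lra.
Qed.

End Inequalities.

(** * Moments of the first-order step and of the errors it leaves *)

Section OneStep.
Context {R : realType} {n : nat} (beta : 'I_n -> R) (b N : R) (S : pred 'I_n).
Implicit Types (p f : upair n) (i j k : 'I_n) (w : graph n).

Hypothesis N_def : N = n.-1%:R.
Hypothesis n_gt3 : (3 < n)%N.
Hypothesis b_ge1 : 1 <= b.
Hypothesis b_leN : b <= N.
Hypothesis dmu_ge : forall i j, i != j -> b^-1 <= dmu (beta i + beta j).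

Local Notation E := (cube_E (edge_prob beta)).
Local Notation deg_var := (deg_var beta).
Local Notation edge_var := (edge_var beta).
Local Notation var_mx := (var_mx beta).
Local Notation cdeg := (cdeg beta).

Let b_gt0 : 0 < b. Proof. by apply: lt_le_trans b_ge1. Qed.

Let N_gt0 : 0 < N. Proof. by apply: lt_le_trans b_leN. Qed.

Lemma n_le2N : n%:R <= 2 * N.
Proof.
rewrite N_def; case: n n_gt3 => [//|m] m3 /=.
rewrite -(natr1 m); have : 1 <= m%:R :> R by rewrite ler1n; case: m m3.
lra.
Qed.

Let bN_le1 : b / N <= 1.
Proof. by rewrite ler_pdivrMr // mul1r. Qed.

Let bN_ge0 : 0 <= b / N.
Proof. by rewrite divr_ge0 ?ltW. Qed.

Lemma deg_var_ge i : N / b <= deg_var i.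
Proof.
rewrite deg_varE (bigD1 i) //= {1}/var_mx eqxx add0r.
apply: (@le_trans _ _ (\sum_(j | j != i) b^-1)).
  rewrite sumr_const -mulr_natr mulrC.
  suff -> : #|[pred j | j != i]| = n.-1 by rewrite N_def.
  by have := cardC1 i; rewrite card_ord.
by apply: ler_sum => j ji; rewrite /var_mx eq_sym (negPf ji) dmu_ge // eq_sym.
Qed.

Lemma deg_var_le i : deg_var i <= N.
Proof.
rewrite deg_varE (bigD1 i) //= {1}/var_mx eqxx add0r.
apply: (@le_trans _ _ (\sum_(j | j != i) 1)).
  by apply: ler_sum => j _; exact: var_mx_le1.
rewrite sumr_const; suff -> : #|[pred j | j != i]| = n.-1 by rewrite N_def.
by have := cardC1 i; rewrite card_ord.
Qed.

Lemma deg_var_gt0 i : 0 < deg_var i.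
Proof. by apply: lt_le_trans (deg_var_ge i); rewrite divr_gt0. Qed.

Lemma deg_var_ge1 i : 1 <= deg_var i.
Proof. by apply: le_trans (deg_var_ge i); rewrite ler_pdivlMr // mul1r. Qed.

Lemma deg_var_inv_le i : (deg_var i)^-1 <= b / N.
Proof. by rewrite -[leRHS]invf_div lef_pV2 ?posrE ?divr_gt0 ?deg_var_gt0 // deg_var_ge. Qed.

Lemma deg_var_inv_gt0 i : 0 < (deg_var i)^-1.
Proof. by rewrite invr_gt0 deg_var_gt0. Qed.

Let deg_var_neq0 i : deg_var i != 0. Proof. exact/lt0r_neq0/deg_var_gt0. Qed.

(** Each term is at most [b / N] and there are at most [2 * N] of them; this is how sums over all
    nodes stay of order [b]. *)
Lemma sum_deg_var_inv : \sum_i (deg_var i)^-1 <= 2 * b.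
Proof.
apply: (@le_trans _ _ (\sum_(i < n) b / N)); first by apply: ler_sum => i _; exact: deg_var_inv_le.
rewrite sumr_const card_ord -[leLHS]mulr_natr mulrAC ler_pdivrMr //.
have := n_le2N; have := b_gt0; nra.
Qed.

(* [delta] is the first-order approximation of the maximizer when the coordinates
   in [S] are free; [coupling] is the off-diagonal part of the Fisher information
   applied to it, and [coupling_form] the corresponding quadratic form. *)
Definition free i : R := (S i)%:R.
Definition step_coef i p : R := free i / deg_var i * inc p i.
Definition delta w i : R := free i / deg_var i * cdeg w i.
Definition edge_delta w p : R := delta w (src p) + delta w (tgt p).
Definition coupling w i : R := \sum_j var_mx i j * delta w j.
Definition quartic w : R := \sum_i deg_var i * delta w i ^+ 4.
Definition coupling_sq w : R := \sum_i coupling w i ^+ 2.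
Definition coupling_form w : R := \sum_i delta w i * coupling w i.
Definition cubic w : R := \sum_p ddmu (edge_par beta p) * edge_delta w p ^+ 3.

Lemma free_ge0 i : 0 <= free i. Proof. exact: ler0n. Qed.

Lemma free_le1 i : free i <= 1. Proof. by rewrite /free; case: (S i). Qed.

Lemma free_sqr i : free i ^+ 2 = free i.
Proof. by rewrite /free; case: (S i); rewrite ?expr1n ?expr0n. Qed.

Let chiV_ge0 i : 0 <= free i / deg_var i.
Proof. by rewrite divr_ge0 ?free_ge0 ?ltW ?deg_var_gt0. Qed.

Let chiV_le i : free i / deg_var i <= (deg_var i)^-1.
Proof. by rewrite ler_piMl ?free_le1 // ltW ?deg_var_inv_gt0. Qed.

Let chiV_leb i : free i / deg_var i <= b / N.
Proof. exact: le_trans (deg_var_inv_le i). Qed.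

Lemma step_coef_ge0 i p : 0 <= step_coef i p.
Proof. by rewrite mulr_ge0 ?inc_ge0. Qed.

Lemma step_coef_le i p : step_coef i p <= inc p i * (b / N).
Proof. by rewrite /step_coef mulrC ler_wpM2l ?inc_ge0. Qed.

Lemma deltaE i w : delta w i = lin_form (edge_prob beta) (step_coef i) w.
Proof. by rewrite /delta mulr_sumr; apply: eq_bigr => p _; rewrite mulrA. Qed.

Lemma dif_delta w f i : delta (upd w f true) i - delta (upd w f false) i = step_coef i f.
Proof. by rewrite !deltaE -[RHS](dif_lin_form (edge_prob beta) _ _ w). Qed.

Lemma delta_near w f i c : `|delta (upd w f c) i - delta w i| <= step_coef i f.
Proof.
rewrite !deltaE (le_trans (upd_lin_form_near _ _ _ _ _)) //.
by rewrite ger0_norm ?step_coef_ge0.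
Qed.

(** Only the two ends of [p] contribute, so squaring the sum costs a factor 2 and not n. *)
Lemma endpoints_sqr p (X : 'I_n -> R) :
  (\sum_i inc p i * X i) ^+ 2 <= 2 * \sum_i inc p i * X i ^+ 2.
Proof. by rewrite !sum_endpoints; exact: sqr_sum2. Qed.

Lemma handshake_inc (X : 'I_n -> R) :
  \sum_f edge_var f * (\sum_j inc f j * X j) = \sum_j deg_var j * X j.
Proof. by rewrite -handshake; apply: eq_bigr => f _; rewrite sum_endpoints. Qed.

Lemma E_cdeg2 i : E (fun w => cdeg w i ^+ 2) = deg_var i.
Proof.
rewrite cube_E_lin_form2; apply: eq_bigr => p _.
by rewrite inc_sqr.
Qed.

Lemma E_cdeg4 i : E (fun w => cdeg w i ^+ 4) <= 12 * deg_var i ^+ 2.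
Proof.
apply: (le_trans (cube_E_lin_form4 (edge_prob_01 beta) _)).
rewrite E_cdeg2 (eq_bigr (fun p => edge_var p * inc p i)); last first.
  by move=> p _; rewrite (exprM _ 2 2) !inc_sqr.
by rewrite -/(deg_var i); have := deg_var_ge1 i; nra.
Qed.

Lemma E_delta2 i : E (fun w => delta w i ^+ 2) <= (deg_var i)^-1.
Proof.
rewrite (eq_cube_E _ (G := fun w => (free i / deg_var i) ^+ 2 * cdeg w i ^+ 2)).
  rewrite cube_EZ E_cdeg2 exprMn free_sqr.
  rewrite [leLHS](_ : _ = free i * (deg_var i)^-1); last by field.
  by rewrite ler_piMl ?free_le1 // ltW ?deg_var_inv_gt0.
by move=> w; rewrite /delta exprMn.
Qed.

Lemma E_delta4 i : E (fun w => delta w i ^+ 4) <= 12 * (deg_var i)^-1 ^+ 2.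
Proof.
rewrite (eq_cube_E _ (G := fun w => (free i / deg_var i) ^+ 4 * cdeg w i ^+ 4)); last first.
  by move=> w; rewrite /delta exprMn.
rewrite cube_EZ exprMn (exprM _ 2 2) !free_sqr.
have h := E_cdeg4 i.
have d0 : 0 <= E (fun w => cdeg w i ^+ 4).
  by apply: cube_E_ge0 => [p|w]; [exact: edge_prob_01|exact: exprn_even_ge0].
have g0 : 0 <= (deg_var i)^-1 ^+ 4 by rewrite exprn_ge0 // ltW ?deg_var_inv_gt0.
apply: (@le_trans _ _ ((deg_var i)^-1 ^+ 4 * (12 * deg_var i ^+ 2))).
  rewrite -mulrA; apply: (@le_trans _ _ ((deg_var i)^-1 ^+ 4 * E (fun w => cdeg w i ^+ 4))).
    by rewrite ler_piMl ?free_le1 // mulr_ge0.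
  by rewrite ler_wpM2l.
by rewrite le_eqVlt; apply/orP; left; apply/eqP; field.
Qed.

Lemma E_quartic : E quartic <= 24 * b.
Proof.
rewrite cube_E_sum; apply: (@le_trans _ _ (\sum_i 12 * (deg_var i)^-1)).
  apply: ler_sum => i _; rewrite cube_EZ.
  apply: (le_trans (ler_wpM2l (deg_var_ge0 _ _) (E_delta4 i))).
  by rewrite le_eqVlt; apply/orP; left; apply/eqP; field.
by rewrite -mulr_sumr; have := sum_deg_var_inv; lra.
Qed.

Definition coupling_coef i f : R := \sum_j var_mx i j * step_coef j f.

Lemma couplingE i w : coupling w i = lin_form (edge_prob beta) (coupling_coef i) w.
Proof.
rewrite /coupling /lin_form /coupling_coef.
under [RHS]eq_bigr do rewrite mulr_suml.
rewrite exchange_big /=; apply: eq_bigr => j _.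
rewrite deltaE /lin_form mulr_sumr; apply: eq_bigr => p _.
by rewrite mulrA.
Qed.

Lemma coupling_coef_ge0 i f : 0 <= coupling_coef i f.
Proof. by apply: sumr_ge0 => j _; rewrite mulr_ge0 ?var_mx_ge0 ?step_coef_ge0. Qed.

Lemma coupling_coef_le i f : coupling_coef i f <= 2 * (b / N).
Proof.
apply: (@le_trans _ _ (\sum_j inc f j * (b / N))); last first.
  by rewrite sum_endpoints; lra.
apply: ler_sum => j _; apply: le_trans (step_coef_le j f).
by rewrite ler_piMl ?var_mx_le1 // step_coef_ge0.
Qed.

Lemma coupling_near w f i c : `|coupling (upd w f c) i - coupling w i| <= 2.
Proof.
rewrite !couplingE (le_trans (upd_lin_form_near _ _ _ _ _)) //.
rewrite ger0_norm ?coupling_coef_ge0 // (le_trans (coupling_coef_le _ _)) //.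
by have := bN_le1; lra.
Qed.

(** An edge enters [coupling] only through its two ends; summing the edge variances at [j] then
    cancels one of the two factors [deg_var j]. *)
Lemma E_coupling2 i : E (fun w => coupling w i ^+ 2) <= 2 * \sum_j var_mx i j * (deg_var j)^-1.
Proof.
rewrite (eq_cube_E _ (G := fun w => lin_form (edge_prob beta) (coupling_coef i) w ^+ 2)); last first.
  by move=> w; rewrite couplingE.
rewrite cube_E_lin_form2.
apply: (@le_trans _ _ (\sum_f edge_var f * (2 * \sum_j inc f j * (var_mx i j * (free j / deg_var j)) ^+ 2))).
  apply: ler_sum => f _; rewrite bvarE ler_wpM2l ?edge_var_ge0 //.
  apply: le_trans (endpoints_sqr _ _); rewrite le_eqVlt; apply/orP; left; apply/eqP.
  by congr (_ ^+ 2); apply: eq_bigr => j _; rewrite /step_coef; ring.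
under eq_bigr do rewrite mulrCA.
rewrite -mulr_sumr handshake_inc ler_wpM2l //; apply: ler_sum => j _.
rewrite !exprMn free_sqr.
rewrite [leLHS](_ : _ = free j * var_mx i j * (var_mx i j * (deg_var j)^-1)); last by field.
by rewrite ler_piMl ?mulr_ge0 ?var_mx_ge0 ?mulr_ile1 ?var_mx_ge0 ?var_mx_le1 ?free_ge0 ?free_le1 // ltW ?deg_var_inv_gt0.
Qed.

(** Column [j] of [var_mx] sums to [deg_var j], which cancels the inverse exactly, so no factor [b]
    is lost here. *)
Lemma E_coupling_sq : E coupling_sq <= 2 * n%:R.
Proof.
rewrite cube_E_sum; apply: (le_trans (ler_sum _ (fun i _ => E_coupling2 i))).
rewrite -mulr_sumr ler_wpM2l // exchange_big /=.
rewrite (eq_bigr (fun=> 1)) ?sumr_const ?card_ord //.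
move=> j _; rewrite -mulr_suml.
have -> : \sum_i var_mx i j = deg_var j by rewrite deg_varE; apply: eq_bigr => i _; rewrite var_mx_sym.
exact: divff.
Qed.

Lemma E_coupling_sq_weighted : \sum_i (deg_var i)^-1 * E (fun w => coupling w i ^+ 2) <= 4 * b.
Proof.
apply: (@le_trans _ _ (b / N * E coupling_sq)).
  rewrite /coupling_sq cube_E_sum mulr_sumr; apply: ler_sum => i _.
  rewrite ler_wpM2r ?deg_var_inv_le //.
  by apply: cube_E_ge0 => [p|w]; [exact: edge_prob_01|exact: sqr_ge0].
apply: (le_trans (ler_wpM2l bN_ge0 E_coupling_sq)).
rewrite mulrAC ler_pdivrMr //.
by have := n_le2N; have := b_gt0; nra.
Qed.

(** Polarization of a symmetric form: Q(x) - Q(y) pairs x - y with x + y. *)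
Lemma coupling_form_diff (x y : 'I_n -> R) :
  \sum_i x i * (\sum_j var_mx i j * x j) - \sum_i y i * (\sum_j var_mx i j * y j) =
  \sum_i (x i - y i) * (\sum_j var_mx i j * x j + \sum_j var_mx i j * y j).
Proof.
have sw (s t : 'I_n -> R) :
    \sum_i s i * (\sum_j var_mx i j * t j) = \sum_i t i * (\sum_j var_mx i j * s j).
  under eq_bigr do rewrite mulr_sumr.
  rewrite exchange_big /=; apply: eq_bigr => j _; rewrite mulr_sumr.
  by apply: eq_bigr => i _; rewrite var_mx_sym; ring.
rewrite [RHS](eq_bigr (fun i => x i * (\sum_j var_mx i j * x j) + x i * (\sum_j var_mx i j * y j)
   - y i * (\sum_j var_mx i j * x j) - y i * (\sum_j var_mx i j * y j))); last by move=> i _; ring.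
by rewrite !sumrB big_split /= (sw y x); ring.
Qed.

Lemma dif_coupling_form_sqr w f : dif f coupling_form w ^+ 2 <=
  2 * \sum_i inc f i * ((deg_var i)^-1 ^+ 2 * (8 * coupling w i ^+ 2 + 32)).
Proof.
rewrite /dif /coupling_form coupling_form_diff.
rewrite (eq_bigr (fun i => inc f i * (free i / deg_var i * (coupling (upd w f true) i + coupling (upd w f false) i)))); last first.
  move=> i _; rewrite dif_delta -/(coupling (upd w f true) i) -/(coupling (upd w f false) i).
  by rewrite /step_coef; ring.
apply: (le_trans (endpoints_sqr _ _)); rewrite ler_wpM2l //; apply: ler_sum => i _.
rewrite ler_wpM2l ?inc_ge0 // exprMn.
rewrite ler_pM ?sqr_ge0 ?lerXn2r ?nnegrE ?chiV_ge0 // ?(ltW (deg_var_inv_gt0 i)) //.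
have := coupling_near w f i true; have := coupling_near w f i false.
set x := coupling _ i; set y := coupling _ i; set z := coupling _ i.
rewrite !ler_norml => /andP[h1 h2] /andP[h3 h4].
(* The two flipped values sum to [2 * y] plus an error e of size at most 4, and (2y + e)^2 <= 8 y^2
   + 2 e^2. *)
have [h5 h6] : z + x - 2 * y <= 4 /\ - 4 <= z + x - 2 * y by split; lra.
have : (z + x - 2 * y) ^+ 2 <= 16 by nra.
by have := sqr_ge0 (z + x - 4 * y); nra.
Qed.

(** The mean is a sum of covariances. The coefficients of [coupling] are at most [2 * (b / N)], and
    the variance-weighted coefficients of [delta] at one node sum to at most 1, so each of the n
    covariances is at most [2 * (b / N)]. *)
Lemma E_coupling_form_norm : `|E coupling_form| <= 4 * b.
Proof.
rewrite cube_E_sum.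
have H i : E (fun w => delta w i * coupling w i) = \sum_p edge_var p * step_coef i p * coupling_coef i p.
  rewrite -cube_E_lin_formM; apply: eq_cube_E => w; by rewrite deltaE couplingE.
have H0 i : 0 <= E (fun w => delta w i * coupling w i).
  by rewrite H; apply: sumr_ge0 => p _; rewrite mulr3_ge0 ?edge_var_ge0 ?step_coef_ge0 ?coupling_coef_ge0.
rewrite ger0_norm ?sumr_ge0 //.
apply: (@le_trans _ _ (\sum_(i < n) 2 * (b / N))).
  apply: ler_sum => i _; rewrite H.
  apply: (@le_trans _ _ (\sum_p edge_var p * step_coef i p * (2 * (b / N)))).
    by apply: ler_sum => p _; rewrite ler_wpM2l ?coupling_coef_le // mulr_ge0 ?edge_var_ge0 ?step_coef_ge0.
  rewrite -mulr_suml ler_piMl //; first by rewrite mulr_ge0.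
  rewrite (eq_bigr (fun p => free i / deg_var i * (edge_var p * inc p i))); last first.
    by move=> p _; rewrite /step_coef; ring.
  by rewrite -mulr_sumr -/(deg_var i) divfK // free_le1.
rewrite sumr_const card_ord -[leLHS]mulr_natr mulrA mulrAC ler_pdivrMr //.
by have := n_le2N; have := b_gt0; nra.
Qed.

Lemma E_coupling_form2 : E (fun w => coupling_form w ^+ 2) <= (15 * b) ^+ 2.
Proof.
apply: (le_trans (cube_poincare (edge_prob_01 beta) coupling_form)).
have h1 : E coupling_form ^+ 2 <= 16 * b ^+ 2.
  rewrite -[leLHS]real_normK ?num_real //.
  apply: (@le_trans _ _ ((4 * b) ^+ 2)); last by rewrite exprMn; lra.
  by rewrite lerXn2r ?nnegrE ?mulr_ge0 ?(ltW b_gt0) ?E_coupling_form_norm.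
(* Enough because 16 + 192 <= 15^2 and [b <= b ^+ 2]. *)
suff : \sum_p bvar (edge_prob beta) p * E (fun w => dif p coupling_form w ^+ 2) <= 192 * b.
  by have := b_ge1; nra.
apply: (@le_trans _ _ (E (fun w => \sum_f edge_var f * (2 * \sum_i inc f i * ((deg_var i)^-1 ^+ 2 * (8 * coupling w i ^+ 2 + 32)))))).
  rewrite cube_E_sum; apply: ler_sum => f _; rewrite cube_EZ bvarE.
  rewrite ler_wpM2l ?edge_var_ge0 //; apply: cube_E_le => [p|w]; first exact: edge_prob_01.
  exact: dif_coupling_form_sqr.
rewrite (eq_cube_E _ (G := fun w => \sum_i (16 * ((deg_var i)^-1 * coupling w i ^+ 2) + 64 * (deg_var i)^-1))); last first.
  move=> w; under eq_bigr do rewrite mulrCA.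
  by rewrite -mulr_sumr handshake_inc mulr_sumr; apply: eq_bigr => i _; field.
rewrite cube_E_sum (eq_bigr (fun i => 16 * ((deg_var i)^-1 * E (fun w => coupling w i ^+ 2)) + 64 * (deg_var i)^-1)); last first.
  by move=> i _; rewrite cube_ED cube_Ecst !cube_EZ.
rewrite big_split /= -!mulr_sumr.
by have := E_coupling_sq_weighted; have := sum_deg_var_inv; have := b_gt0; lra.
Qed.

Lemma edge_delta_near w f p c : `|edge_delta (upd w f c) p - edge_delta w p| <= 2 * (b / N).
Proof.
have h1 := delta_near w f (src p) c; have h2 := delta_near w f (tgt p) c.
have k i : step_coef i f <= b / N.
  apply: (le_trans (step_coef_le i f)); by rewrite ler_piMl ?inc_le1.
have k1 := k (src p); have k2 := k (tgt p).
rewrite /edge_delta; move: h1 h2; rewrite !ler_norml => /andP[? ?] /andP[? ?].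
by apply/andP; split; lra.
Qed.

Lemma E_edge_quartic : E (fun w => \sum_p edge_var p * edge_delta w p ^+ 4) <= 192 * b.
Proof.
apply: (@le_trans _ _ (E (fun w => 8 * quartic w))); last first.
  by rewrite cube_EZ; have := E_quartic; lra.
apply: cube_E_le => [p|w]; first exact: edge_prob_01.
rewrite /quartic -handshake mulr_sumr; apply: ler_sum => p _.
rewrite [leRHS]mulrCA ler_wpM2l ?edge_var_ge0 //; exact: quart_sum2.
Qed.

Lemma edge_quartic_le w : \sum_p edge_var p * edge_delta w p ^+ 4 <= 8 * quartic w.
Proof.
rewrite /quartic -handshake mulr_sumr; apply: ler_sum => p _.
rewrite [leRHS]mulrCA ler_wpM2l ?edge_var_ge0 //; exact: quart_sum2.
Qed.

Lemma sum_ev_le : \sum_p edge_var p <= N ^+ 2.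
Proof.
have := handshake beta (fun=> 1); rewrite -mulr_suml.
have : \sum_i deg_var i * 1 <= n%:R * N.
  apply: (@le_trans _ _ (\sum_(i < n) N)).
    by apply: ler_sum => i _; rewrite mulr1 deg_var_le.
  by rewrite sumr_const card_ord -[leLHS]mulr_natl.
by have := n_le2N; have := N_gt0; nra.
Qed.

(** An envelope for the change of [cubic] per unit change of [delta] at [k]. It is evaluated at [w],
    the same for every flipped edge; the summand with [2 * (b / N)] pays for the flip. *)
Definition cubic_env w k : R := \sum_p edge_var p * inc p k * (6 * edge_delta w p ^+ 2 + 6 * (2 * (b / N)) ^+ 2).

Lemma cubic_env_ge0 w k : 0 <= cubic_env w k.
Proof.
apply: sumr_ge0 => p _; rewrite mulr3_ge0 ?edge_var_ge0 ?inc_ge0 //.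
by rewrite addr_ge0 // mulr_ge0 // sqr_ge0.
Qed.

Lemma dif_cubic_le w f : `|dif f cubic w| <= \sum_k inc f k * (free k / deg_var k * cubic_env w k).
Proof.
rewrite /dif /cubic -sumrB; apply: (le_trans (ler_norm_sum _ _ _)).
apply: (@le_trans _ _ (\sum_p edge_var p * ((\sum_k inc p k * step_coef k f) * (6 * edge_delta w p ^+ 2 + 6 * (2 * (b / N)) ^+ 2)))).
  apply: ler_sum => p _; rewrite -mulrBr normrM.
  apply: (@le_trans _ _ (edge_var p * `|edge_delta (upd w f true) p ^+ 3 - edge_delta (upd w f false) p ^+ 3|)).
    by rewrite ler_wpM2r // ddmu_le.
  rewrite ler_wpM2l ?edge_var_ge0 // sum_endpoints.
  have := edge_delta_near w f p true; have := edge_delta_near w f p false.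
  have D : edge_delta (upd w f true) p - edge_delta (upd w f false) p = step_coef (src p) f + step_coef (tgt p) f.
    by rewrite -!(dif_delta w) /edge_delta; ring.
  set x1 := edge_delta _ p in D *; set x0 := edge_delta _ p in D *; set x := edge_delta w p; set d := 2 * (b / N).
  move=> h0 h1.
  have -> : x1 ^+ 3 - x0 ^+ 3 = (x1 - x0) * (x1 ^+ 2 + x1 * x0 + x0 ^+ 2) by ring.
  rewrite D normrM ger0_norm ?addr_ge0 ?step_coef_ge0 // ler_wpM2l ?addr_ge0 ?step_coef_ge0 //.
  have sq y : `|y - x| <= d -> y ^+ 2 <= 2 * x ^+ 2 + 2 * d ^+ 2.
    rewrite ler_norml => /andP[? ?]; have : (y - x) ^+ 2 <= d ^+ 2 by nra.
    by have := sqr_ge0 (y - 2 * x); nra.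
  have := sq _ h0; have := sq _ h1 => k1 k0.
  have a1 := sqr_ge0 (x1 + x0); have a2 := sqr_ge0 (x1 - x0).
  by rewrite ler_norml; apply/andP; split; nra.
rewrite le_eqVlt; apply/orP; left; apply/eqP.
transitivity (\sum_p \sum_k inc f k * (free k / deg_var k * (edge_var p * inc p k * (6 * edge_delta w p ^+ 2 + 6 * (2 * (b / N)) ^+ 2)))).
  apply: eq_bigr => p _; rewrite mulr_suml mulr_sumr; apply: eq_bigr => k _.
  by rewrite /step_coef; ring.
by rewrite exchange_big /=; apply: eq_bigr => k _; rewrite -!mulr_sumr.
Qed.

Lemma cubic_env_sqr w k : cubic_env w k ^+ 2 <=
  deg_var k * (72 * \sum_p edge_var p * inc p k * (edge_delta w p ^+ 4 + (2 * (b / N)) ^+ 4)).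
Proof.
apply: (le_trans (weighted_cauchy (fun p => 6 * edge_delta w p ^+ 2 + 6 * (2 * (b / N)) ^+ 2)
  (fun p => mulr_ge0 (edge_var_ge0 beta p) (inc_ge0 p k)))).
rewrite -/(deg_var k) ler_wpM2l ?deg_var_ge0 // mulr_sumr; apply: ler_sum => p _.
rewrite [leRHS]mulrCA ler_wpM2l ?(mulr_ge0 (edge_var_ge0 _ _) (inc_ge0 _ _)) //.
move: (2 * (b / N)) (edge_delta w p) => d x.
by have := sqr_ge0 (x ^+ 2 - d ^+ 2); nra.
Qed.

Lemma sum_dif_cubic_sqr w : \sum_f edge_var f * dif f cubic w ^+ 2 <=
  288 * (\sum_p edge_var p * edge_delta w p ^+ 4 + 16 * b ^+ 2).
Proof.
apply: (@le_trans _ _ (\sum_f edge_var f * (2 * \sum_k inc f k * ((deg_var k)^-1 * cubic_env w k) ^+ 2))).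
  apply: ler_sum => f _; rewrite ler_wpM2l ?edge_var_ge0 //.
  apply: le_trans (endpoints_sqr _ _).
  rewrite -[leLHS]real_normK ?num_real // lerXn2r ?nnegrE //.
    by apply: sumr_ge0 => k _; rewrite mulrA mulr3_ge0 ?inc_ge0 ?cubic_env_ge0 // ltW ?deg_var_inv_gt0.
  apply: (le_trans (dif_cubic_le w f)); apply: ler_sum => k _.
  by rewrite ler_wpM2l ?inc_ge0 // ler_wpM2r ?cubic_env_ge0.
under eq_bigr do rewrite mulrCA.
rewrite -mulr_sumr handshake_inc.
apply: (@le_trans _ _ (2 * \sum_k 72 * \sum_p edge_var p * inc p k * (edge_delta w p ^+ 4 + (2 * (b / N)) ^+ 4))).
  rewrite ler_wpM2l //; apply: ler_sum => k _.
  rewrite exprMn.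
  rewrite [leLHS](_ : _ = (deg_var k)^-1 * cubic_env w k ^+ 2); last by field.
  by rewrite -[leRHS](mulKf (deg_var_neq0 k)) ler_wpM2l ?cubic_env_sqr // ltW ?deg_var_inv_gt0.
rewrite -mulr_sumr exchange_big /=.
have -> : \sum_p \sum_k edge_var p * inc p k * (edge_delta w p ^+ 4 + (2 * (b / N)) ^+ 4) =
   2 * (\sum_p edge_var p * edge_delta w p ^+ 4 + (2 * (b / N)) ^+ 4 * \sum_p edge_var p).
  rewrite mulr_sumr -big_split /= mulr_sumr; apply: eq_bigr => p _.
  rewrite (eq_bigr (fun k => inc p k * (edge_var p * (edge_delta w p ^+ 4 + (2 * (b / N)) ^+ 4)))).
    by rewrite sum_endpoints; ring.
  by move=> k _; ring.
have h : (2 * (b / N)) ^+ 4 * \sum_p edge_var p <= 16 * b ^+ 2.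
  apply: (@le_trans _ _ ((2 * (b / N)) ^+ 4 * N ^+ 2)).
    by rewrite ler_wpM2l ?sum_ev_le // exprn_even_ge0.
  (* The discretization error is even smaller than needed, by the factor [(b / N) ^+ 2]. *)
  rewrite [leLHS](_ : _ = 16 * b ^+ 2 * (b / N) ^+ 2); last by field; rewrite lt0r_neq0.
  have q1 : (b / N) ^+ 2 <= 1 by rewrite exprn_ile1.
  have q2 : 0 <= 16 * b ^+ 2 by rewrite pmulr_rge0 // sqr_ge0.
  by rewrite ler_piMr.
lra.
Qed.

(** The signed third moment of an edge increment is of order [deg_var ^- 2]. The absolute third
    moment is only of order [deg_var] to the power -3/2, and its sum over the edges would grow like
    sqrt n. *)
Lemma E_cubic_norm : `|E cubic| <= 8 * b.
Proof.
rewrite cube_E_sum; apply: (le_trans (ler_norm_sum _ _ _)).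
apply: (@le_trans _ _ (\sum_p edge_var p * (4 * (deg_var (src p))^-1 ^+ 2 + 4 * (deg_var (tgt p))^-1 ^+ 2))).
  apply: ler_sum => p _; rewrite cube_EZ normrM.
  apply: ler_pM => //; first exact: ddmu_le.
  rewrite (eq_cube_E _ (G := fun w => lin_form (edge_prob beta)
     (fun f => step_coef (src p) f + step_coef (tgt p) f) w ^+ 3)); last first.
    move=> w; congr (_ ^+ 3); rewrite /edge_delta !deltaE /lin_form -big_split /=.
    by apply: eq_bigr => f _; rewrite mulrDl.
  apply: (le_trans (cube_E_lin_form3 (edge_prob_01 beta) _)).
  have H i : \sum_f edge_var f * step_coef i f ^+ 3 <= (deg_var i)^-1 ^+ 2.
    apply: (@le_trans _ _ (\sum_f (deg_var i)^-1 ^+ 3 * (edge_var f * inc f i))); last first.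
      by rewrite -mulr_sumr -/(deg_var i) le_eqVlt; apply/orP; left; apply/eqP; field.
    apply: ler_sum => f _; rewrite [leRHS]mulrCA ler_wpM2l ?edge_var_ge0 //.
    rewrite /step_coef exprMn [inc f i ^+ 3]exprS inc_sqr -expr2 inc_sqr.
    by rewrite ler_wpM2r ?inc_ge0 // lerXn2r ?nnegrE // ltW ?deg_var_inv_gt0.
  apply: (@le_trans _ _ (4 * (\sum_f edge_var f * step_coef (src p) f ^+ 3) + 4 * (\sum_f edge_var f * step_coef (tgt p) f ^+ 3))).
    rewrite !mulr_sumr -big_split /=; apply: ler_sum => f _.
    rewrite bvarE ger0_norm ?addr_ge0 ?step_coef_ge0 //.
    have := ler_wpM2l (edge_var_ge0 beta f) (cube_norm_sum2 (step_coef_ge0 (src p) f) (step_coef_ge0 (tgt p) f)).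
    lra.
  have := H (src p); have := H (tgt p); lra.
have -> := handshake beta (fun i => 4 * (deg_var i)^-1 ^+ 2).
rewrite (eq_bigr (fun i => 4 * (deg_var i)^-1)); last by move=> i _; field.
by rewrite -mulr_sumr; have := sum_deg_var_inv; lra.
Qed.

Lemma E_cubic2 : E (fun w => cubic w ^+ 2) <= (256 * b) ^+ 2.
Proof.
apply: (le_trans (cube_poincare (edge_prob_01 beta) cubic)).
have h1 : E cubic ^+ 2 <= 64 * b ^+ 2.
  rewrite -[leLHS]real_normK ?num_real //.
  apply: (@le_trans _ _ ((8 * b) ^+ 2)); last by rewrite exprMn; lra.
  by rewrite lerXn2r ?nnegrE ?mulr_ge0 ?(ltW b_gt0) ?E_cubic_norm.
(* Enough because 64 + 288 * (192 + 16) <= 256^2 and [b <= b ^+ 2]. *)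
suff : \sum_p bvar (edge_prob beta) p * E (fun w => dif p cubic w ^+ 2) <= 288 * (192 * b + 16 * b ^+ 2).
  by have := b_ge1; nra.
apply: (@le_trans _ _ (E (fun w => \sum_f edge_var f * dif f cubic w ^+ 2))).
  by rewrite cube_E_sum; apply: ler_sum => f _; rewrite cube_EZ.
apply: (le_trans (cube_E_le (edge_prob_01 beta) sum_dif_cubic_sqr)).
rewrite cube_EZ cube_ED cube_Ecst.
by have := E_edge_quartic; lra.
Qed.

(* Dominates both the distance to the maximizer and the error in its value. *)
Definition step_err w : R := `|coupling_form w| + `|cubic w| + b * quartic w + b / n%:R * coupling_sq w.

Lemma quartic_ge0 w : 0 <= quartic w.
Proof. by apply: sumr_ge0 => i _; rewrite mulr_ge0 ?deg_var_ge0 // exprn_even_ge0. Qed.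

Lemma coupling_sq_ge0 w : 0 <= coupling_sq w.
Proof. by apply: sumr_ge0 => i _; rewrite sqr_ge0. Qed.

Lemma step_err_ge0 w : 0 <= step_err w.
Proof.
rewrite /step_err !addr_ge0 // mulr_ge0 ?quartic_ge0 ?coupling_sq_ge0 ?(ltW b_gt0) //.
by rewrite divr_ge0 // ltW.
Qed.

(** Jensen's inequality, obtained from the pointwise bound |x| <= x^2 / (2c) + c / 2. *)
Lemma E_norm_le (F : graph n -> R) (c : R) : 0 < c ->
  E (fun w => F w ^+ 2) <= c ^+ 2 -> E (fun w => `|F w|) <= c.
Proof.
move=> c0 h; apply: (@le_trans _ _ (E (fun w => (2 * c)^-1 * F w ^+ 2 + c / 2))).
  apply: cube_E_le => [p|w]; first exact: edge_prob_01.
  apply: (le_trans (norm_le_sqr _ c0)).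
  by rewrite le_eqVlt; apply/orP; left; apply/eqP; field; rewrite lt0r_neq0.
rewrite cube_ED cube_Ecst cube_EZ.
have : (2 * c)^-1 * E (fun w => F w ^+ 2) <= (2 * c)^-1 * c ^+ 2.
  by rewrite ler_wpM2l // invr_ge0 mulr_ge0 // ltW.
rewrite (_ : (2 * c)^-1 * c ^+ 2 = c / 2); last by field; rewrite lt0r_neq0.
lra.
Qed.

Lemma E_coupling_form_abs : E (fun w => `|coupling_form w|) <= 15 * b.
Proof. by apply: E_norm_le E_coupling_form2; rewrite mulr_gt0. Qed.

Lemma E_step_err : E step_err <= 300 * b ^+ 2.
Proof.
have n0 : 0 < n%:R :> R by rewrite ltr0n; case: n n_gt3.
have hB := E_coupling_form_abs.
have hC : E (fun w => `|cubic w|) <= 256 * b.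
  by apply: E_norm_le E_cubic2; rewrite mulr_gt0.
have hU : b / n%:R * E coupling_sq <= 2 * b.
  apply: (@le_trans _ _ (b / n%:R * (2 * n%:R))).
    by rewrite ler_wpM2l ?E_coupling_sq // divr_ge0 ?ltW.
  by rewrite le_eqVlt; apply/orP; left; apply/eqP; field; rewrite lt0r_neq0.
(* The contributions add up to 15 + 256 + 24 + 2 = 297, with [b <= b ^+ 2]. *)
rewrite !cube_ED !cube_EZ.
by have := E_quartic; have := b_ge1; nra.
Qed.

End OneStep.

(** * Existence of the maximizers and expansion of the maximal log-likelihood *)

Section Maximizer.
Context {R : realType} {n : nat}.
Implicit Types (w : graph n) (g h : 'I_n -> R) (S : pred 'I_n).

Lemma loglik_concave w g g' t : 0 <= t <= 1 ->
  loglik w g + t * (loglik w g' - loglik w g) <=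
  loglik w (fun i => g i + t * (g' i - g i)).
Proof.
move=> t01; rewrite !loglikE -sumrB mulr_sumr -big_split /=; apply: ler_sum => p _.
have := softplus_convex (g (src p) + g (tgt p)) (g' (src p) + g' (tgt p)) t01.
have -> : g (src p) + t * (g' (src p) - g (src p)) + (g (tgt p) + t * (g' (tgt p) - g (tgt p)))
  = g (src p) + g (tgt p) + t * (g' (src p) + g' (tgt p) - (g (src p) + g (tgt p))) by ring.
lra.
Qed.

(** The displacement is a row vector, the type in which the box of [argmax_of_local_bound] is
    compact. *)
Lemma loglik_continuous w g :
  continuous (fun v : 'rV[R]_n => loglik w (fun i => g i + v ord0 i)).
Proof.
have -> : (fun v : 'rV[R]_n => loglik w (fun i => g i + v ord0 i)) =
  (fun v : 'rV[R]_n => \sum_p ((w p)%:R * (g (src p) + v ord0 (src p) + (g (tgt p) + v ord0 (tgt p)))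
    - softplus (g (src p) + v ord0 (src p) + (g (tgt p) + v ord0 (tgt p))))).
  by apply/funext => v; rewrite loglikE.
apply: (@continuous_big R^o (upair n) +%R 0 xpredT (@add_continuous R^o)) => p _ v.
have H i : (fun x : 'rV[R]_n => g i + x ord0 i) @ v --> g i + v ord0 i.
  exact: (cvg_add (f := fun=> g i) (g := fun x : 'rV[R]_n => x ord0 i) (cvg_cst _) (@coord_continuous R 1 n ord0 i v)).
have K : (fun x : 'rV[R]_n => g (src p) + x ord0 (src p) + (g (tgt p) + x ord0 (tgt p))) @ v -->
   g (src p) + v ord0 (src p) + (g (tgt p) + v ord0 (tgt p)).
  exact: (cvg_add (H (src p)) (H (tgt p))).
have C : continuous (softplus : R -> R) by exact: (derive_continuous derive_softplus).
have L := cvg_comp _ _ K (C _).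
exact: (cvg_sub (cvg_mul (cvg_cst ((w p)%:R : R)) K) L).
Qed.

(** From the open cube, a positive fraction of any displacement stays in the closed cube; concavity
    then turns maximality on the cube into global maximality. The [1 +] in [m] avoids division by 0
    when [d i = 0]. *)
Lemma max_norm_step S h d : (forall i, S i -> `|h i| < 2^-1) ->
  exists2 t : R, 0 < t <= 1 & forall i, S i -> `|h i + t * d i| <= 2^-1.
Proof.
move=> hS; pose m i := (2^-1 - `|h i|) / (1 + `|d i|).
have d1 i : 0 < 1 + `|d i| by rewrite ltr_wpDr.
exists (\big[Num.min/1]_(i | S i) m i).
  rewrite lt_bigmin ?ltr01 //=; first by rewrite bigmin_le_id.
  by move=> i Si; rewrite divr_gt0 // subr_gt0 hS.
move=> i Si; set t := \big[_/_]_(_ | _) _.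
have t0 : 0 <= t.
  apply/ltW; rewrite lt_bigmin ?ltr01 // => j Sj.
  by rewrite divr_gt0 // subr_gt0 hS.
have tm : t <= m i by exact: bigmin_le_cond.
apply: (le_trans (ler_normD _ _)); rewrite normrM (ger0_norm t0).
have : t * (1 + `|d i|) <= 2^-1 - `|h i| by rewrite -ler_pdivlMr.
have : 0 <= `|d i| by [].
nra.
Qed.

(** Maximize over the cube of radius 1/2. At the maximizer the local bound is nonnegative; absorbing
    the linear term with weight [lam / 2] forces squared norm below 1/4, hence an interior point,
    and concavity makes it global. Absorbing it with weight [lam] bounds the gain. *)
Lemma argmax_of_local_bound w S g0 (gr : 'I_n -> R) (G lam : R) :
  0 < lam ->
  (forall h, (forall i, ~~ S i -> h i = 0) -> (forall i, `|h i| <= 2^-1) ->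
     loglik w (fun i => g0 i + h i) - loglik w g0 <=
     \sum_i gr i * h i - lam * \sum_i h i ^+ 2) ->
  \sum_i gr i ^+ 2 <= G -> G < lam ^+ 2 / 4 ->
  exists2 g, is_argmax (loglik w) (fun g => forall i, ~~ S i -> g i = g0 i) g &
    0 <= loglik w g - loglik w g0 <= G / (4 * lam).
Proof.
move=> lam0 loc gG Gl.
(* The side of the box collapses to the point 0 off [S], which encodes the constraint. *)
pose A (i : 'I_n) : set R := `[- ((S i)%:R / 2), (S i)%:R / 2]%classic.
have cA : compact [set v : 'rV[R]_n | forall i, A i (v ord0 i)].
  by apply: (@rV_compact R n A) => i; exact: segment_compact.
have A0 : [set v : 'rV[R]_n | forall i, A i (v ord0 i)] !=set0.
  exists 0 => i /=; rewrite mxE /A /= in_itv /= oppr_le0 andbb.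
  by rewrite divr_ge0.
have cf : {within [set v : 'rV[R]_n | forall i, A i (v ord0 i)],
   continuous (fun v : 'rV[R]_n => loglik w (fun i => g0 i + v ord0 i))}.
  exact/continuous_subspaceT/loglik_continuous.
have [v vA vmax] := compact_EVT_max A0 cA cf.
move: vA; rewrite inE /= => vA.
pose h i := v ord0 i.
have Ah i : (A i (h i)) = (`|h i| <= (S i)%:R / 2) :> Prop.
  by rewrite /A /= in_itv /= -ler_norml.
have hb i : `|h i| <= (S i)%:R / 2 by rewrite -Ah; exact: vA.
have hS i : ~~ S i -> h i = 0.
  move=> nS; have := hb i; rewrite (negPf nS) mul0r => ?.
  by apply/eqP; rewrite -normr_le0.
have h12 i : `|h i| <= 2^-1.
  by apply: (le_trans (hb i)); rewrite ler_piMl //; case: (S i).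
have max g' : (forall i, `|g' i| <= (S i)%:R / 2) ->
    loglik w (fun i => g0 i + g' i) <= loglik w (fun i => g0 i + h i).
  move=> g'b; have := vmax (\row_i g' i).
  rewrite inE /=.
  have -> : (fun i => g0 i + (\row_i0 g' i0) ord0 i) = (fun i => g0 i + g' i).
    by apply/funext => i; rewrite mxE.
  apply=> i; rewrite mxE /A /= in_itv /= -ler_norml; exact: g'b.
have max0 : loglik w g0 <= loglik w (fun i => g0 i + h i).
  have := max (fun=> 0); have -> : (fun i => g0 i + 0) = g0.
    by apply/funext => i; rewrite addr0.
  by apply=> i; rewrite normr0 divr_ge0.
have up := loc h hS h12.
set H2 := \sum_i h i ^+ 2 in up.
have H20 : 0 <= H2 by apply: sumr_ge0 => i _; exact: sqr_ge0.
have amgm (c : R) : 0 < c -> \sum_i gr i * h i <= G / (4 * c) + c * H2.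
  move=> c0; apply: (@le_trans _ _ (\sum_i (gr i ^+ 2 / (4 * c) + c * h i ^+ 2))).
    apply: ler_sum => i _; have : 0 <= (gr i - 2 * c * h i) ^+ 2 / (4 * c).
      by rewrite divr_ge0 ?sqr_ge0 // mulr_ge0 // ltW.
    have -> : (gr i - 2 * c * h i) ^+ 2 / (4 * c) =
       gr i ^+ 2 / (4 * c) - gr i * h i + c * h i ^+ 2 by field; rewrite lt0r_neq0.
    lra.
  rewrite big_split /= -mulr_suml -mulr_sumr lerD2r ler_wpM2r //.
  by rewrite invr_ge0 mulr_ge0 // ltW.
have H2s : H2 < 4^-1.
  have l2 : 0 < lam / 2 by rewrite divr_gt0.
  have := amgm _ l2; have -> : G / (4 * (lam / 2)) = G / (2 * lam) by field; rewrite lt0r_neq0.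
  move=> k; have : lam / 2 * H2 <= G / (2 * lam) by lra.
  rewrite ler_pdivlMr ?mulr_gt0 // => k'.
  have : lam ^+ 2 * H2 < lam ^+ 2 / 4 by lra.
  by rewrite ltr_pM2l // exprn_gt0.
have hlt i : S i -> `|h i| < 2^-1.
  move=> Si; rewrite ltNge; apply/negP => hi.
  have : h i ^+ 2 <= H2.
    by rewrite /H2 (bigD1 i) //= lerDl sumr_ge0 // => j _; exact: sqr_ge0.
  rewrite -[h i ^+ 2]real_normK ?num_real //.
  have : (2^-1) ^+ 2 <= `|h i| ^+ 2 :> R by rewrite lerXn2r ?nnegrE.
  lra.
exists (fun i => g0 i + h i); last first.
  rewrite subr_ge0 max0 /=; have := amgm _ lam0; lra.
split; first by move=> i nS; rewrite hS ?addr0.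
move=> g' g'S; pose d i := g' i - (g0 i + h i).
have [t /andP[t0 t1] ht] := max_norm_step d hlt.
have t01 : 0 <= t <= 1 by rewrite (ltW t0).
have := loglik_concave w (fun i => g0 i + h i) g' t01.
have -> : (fun i => g0 i + h i + t * (g' i - (g0 i + h i))) = (fun i => g0 i + (h i + t * d i)).
  by apply/funext => i; rewrite addrA.
move=> c1; have c2 : loglik w (fun i => g0 i + (h i + t * d i)) <= loglik w (fun i => g0 i + h i).
  apply: (max (fun i => h i + t * d i)) => i; have [Si|nS] := boolP (S i).
    by rewrite mul1r ht.
  by rewrite /d g'S // hS // addr0 subrr mulr0 addr0 normr0 mul0r.
have : t * (loglik w g' - loglik w (fun i => g0 i + h i)) <= 0 by lra.
by rewrite pmulr_rle0 // subr_le0.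
Qed.

(** The signless Laplacian of the complete graph is (n - 2) I + J, and the all-ones matrix J is
    positive semidefinite. *)
Lemma sum_edges_sqr (h : 'I_n -> R) :
  (n%:R - 2) * \sum_i h i ^+ 2 <= \sum_(p : upair n) (h (src p) + h (tgt p)) ^+ 2.
Proof.
have -> : \sum_(p : upair n) (h (src p) + h (tgt p)) ^+ 2 =
    \sum_i h i * \sum_p inc p i * (h (src p) + h (tgt p)).
  rewrite (eq_bigr (fun p => \sum_i h i * (inc p i * (h (src p) + h (tgt p))))).
    by rewrite exchange_big /=; apply: eq_bigr => i _; rewrite mulr_sumr.
  move=> p _; rewrite expr2 -{1}sum_endpoints mulr_suml; apply: eq_bigr => i _.
  by rewrite [inc p i * _]mulrC mulrA.
have H i : \sum_p inc p i * (h (src p) + h (tgt p)) = (n%:R - 2) * h i + \sum_j h j.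
  rewrite (@sum_incident R n i (fun a b => h a + h b)); last by move=> a b; rewrite addrC.
  rewrite [\sum_j h j](bigD1 i) //= big_split /= sumr_const.
  have -> : #|[pred j | j != i]| = n.-1 by have := cardC1 i; rewrite card_ord.
  have -> : n%:R = n.-1%:R + 1 :> R by rewrite natr1 prednK //; case: n i => [[]|].
  by rewrite -[h i *+ _]mulr_natl; ring.
rewrite [leRHS](eq_bigr (fun i => (n%:R - 2) * h i ^+ 2 + h i * \sum_j h j)); last first.
  by move=> i _; rewrite H; ring.
by rewrite big_split /= -mulr_sumr -mulr_suml lerDl -expr2 sqr_ge0.
Qed.

End Maximizer.

(** * The log-likelihood at and around the first-order step *)

Section Expansion.
Context {R : realType} {n : nat} (beta : 'I_n -> R) (b N : R) (S : pred 'I_n).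
Implicit Types (p : upair n) (i j : 'I_n) (w : graph n).

Hypothesis N_def : N = n.-1%:R.
Hypothesis n_gt3 : (3 < n)%N.
Hypothesis b_ge1 : 1 <= b.
Hypothesis b_leN : b <= N.
Hypothesis dmu_ge : forall i j, i != j -> b^-1 <= dmu (beta i + beta j).

Local Notation deg_var := (deg_var beta).
Local Notation edge_var := (edge_var beta).
Local Notation cdeg := (cdeg beta).
Local Notation delta := (delta beta S).
Local Notation edge_delta := (edge_delta beta S).
Local Notation coupling := (coupling beta S).
Local Notation quartic := (quartic beta S).
Local Notation coupling_sq := (coupling_sq beta S).
Local Notation coupling_form := (coupling_form beta S).
Local Notation cubic := (cubic beta S).
Local Notation free := (free (R := R) S).
Local Notation step_err := (step_err beta b S).

Let b_gt0 : 0 < b. Proof. by apply: lt_le_trans b_ge1. Qed.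
Let N_gt0 : 0 < N. Proof. by apply: lt_le_trans b_leN. Qed.
Let n_gt0 : 0 < n%:R :> R. Proof. by rewrite ltr0n; case: n n_gt3. Qed.
Let n_le2N : n%:R <= 2 * N. Proof. exact: n_le2N. Qed.
Let deg_var_neq0 i : deg_var i != 0. Proof. exact/lt0r_neq0/(deg_var_gt0 N_def b_ge1 b_leN dmu_ge). Qed.

Definition first_step w i : R := beta i + delta w i.

Lemma sum_residual w (x : 'I_n -> R) :
  \sum_p ((w p)%:R - edge_prob beta p) * (x (src p) + x (tgt p)) = \sum_i cdeg w i * x i.
Proof.
rewrite (eq_bigr (fun p => \sum_i inc p i * ((w p)%:R - edge_prob beta p) * x i)).
  by rewrite exchange_big /=; apply: eq_bigr => i _; rewrite mulr_suml.
by move=> p _; rewrite -sum_endpoints mulr_sumr; apply: eq_bigr => i _; ring.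
Qed.

Lemma deg_var_delta w i : deg_var i * delta w i = free i * cdeg w i.
Proof. by rewrite /delta; field. Qed.

Lemma cdeg_delta w i : cdeg w i * delta w i = deg_var i * delta w i ^+ 2.
Proof. by rewrite expr2 mulrA deg_var_delta /delta -{1}(free_sqr S i) expr2; ring. Qed.

Lemma sum_edge_delta_sqr w :
  \sum_p edge_var p * edge_delta w p ^+ 2 = \sum_i deg_var i * delta w i ^+ 2 + coupling_form w.
Proof.
rewrite (eq_bigr (fun p => \sum_i delta w i * (edge_var p * inc p i * (delta w (src p) + delta w (tgt p))))).
  rewrite exchange_big /= /coupling_form -big_split /=; apply: eq_bigr => i _.
  by rewrite -mulr_sumr var_mx_sum -/(coupling w i); ring.
move=> p _; rewrite /edge_delta expr2 -{1}sum_endpoints mulr_suml mulr_sumr.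
by apply: eq_bigr => i _; ring.
Qed.

Lemma step_err_quartic w : b * quartic w <= step_err w.
Proof.
have := coupling_sq_ge0 beta S w => U0.
have : 0 <= b / n%:R * coupling_sq w by rewrite mulr_ge0 // divr_ge0 ?ltW.
by have := normr_ge0 (coupling_form w); have := normr_ge0 (cubic w); rewrite /step_err; lra.
Qed.

Lemma step_err_coupling_sq w : b / n%:R * coupling_sq w <= step_err w.
Proof.
have Q0 := quartic_ge0 beta S w.
have : 0 <= b * quartic w by rewrite mulr_ge0 // ltW.
by have := normr_ge0 (coupling_form w); have := normr_ge0 (cubic w); rewrite /step_err; lra.
Qed.

(** A single term of [quartic] already controls a coordinate, so the uniform bound needs neither a
    union bound nor a concentration inequality; 16 is 2^4. *)
Lemma delta_small w i : step_err w <= N / 16 -> `|delta w i| <= 2^-1.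
Proof.
move=> hZ; have bQ := le_trans (step_err_quartic w) hZ.
have : deg_var i * delta w i ^+ 4 <= quartic w.
  rewrite /quartic (bigD1 i) //= lerDl sumr_ge0 // => j _.
  by rewrite mulr_ge0 ?deg_var_ge0 // exprn_even_ge0.
have d0 : 0 <= delta w i ^+ 4 by rewrite exprn_even_ge0.
have hV := deg_var_ge N_def dmu_ge i => hQ.
have k : N / b * delta w i ^+ 4 <= quartic w by apply: le_trans hQ; rewrite ler_wpM2r.
have k2 : N * delta w i ^+ 4 <= N / 16.
  apply: le_trans bQ; have := ler_wpM2l (ltW b_gt0) k.
  by rewrite mulrA (mulrC b) divfK // lt0r_neq0.
have k3 : delta w i ^+ 4 <= (2^-1) ^+ 4.
  rewrite -(ler_pM2l N_gt0) (le_trans k2) //.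
  by rewrite le_eqVlt; apply/orP; left; apply/eqP; field.
have k4 : `|delta w i| ^+ 4 <= (2^-1) ^+ 4.
  by rewrite -normrX ger0_norm.
by rewrite -(@ler_pXn2r _ 4) ?nnegrE.
Qed.

Lemma edge_delta_small w p : step_err w <= N / 16 -> `|edge_delta w p| <= 1.
Proof.
move=> hZ; have h1 := delta_small (src p) hZ; have h2 := delta_small (tgt p) hZ.
by apply: (le_trans (ler_normD _ _)); lra.
Qed.

(** The linear term at [beta] equals the diagonal quadratic form, and the second-order term takes
    away half of it together with half of [coupling_form]. *)
Lemma loglik_step w : step_err w <= N / 16 ->
  `|2 * (loglik w (first_step w) - loglik w beta) - \sum_i deg_var i * delta w i ^+ 2| <=
  `|coupling_form w| + `|cubic w| + 64 * quartic w.
Proof.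
move=> hZ.
pose rem p : R := softplus (edge_par beta p + edge_delta w p) - softplus (edge_par beta p)
  - mu (edge_par beta p) * edge_delta w p - dmu (edge_par beta p) / 2 * edge_delta w p ^+ 2
  - ddmu (edge_par beta p) / 6 * edge_delta w p ^+ 3.
have E : loglik w (first_step w) - loglik w beta =
  \sum_i deg_var i * delta w i ^+ 2 - (\sum_i deg_var i * delta w i ^+ 2 + coupling_form w) / 2 - cubic w / 6 - \sum_p rem p.
  rewrite -sum_edge_delta_sqr.
  have -> : \sum_i deg_var i * delta w i ^+ 2 = \sum_p ((w p)%:R - edge_prob beta p) * edge_delta w p.
    by rewrite sum_residual; apply: eq_bigr => i _; rewrite cdeg_delta.
  rewrite /cubic !loglikE !mulr_suml -!sumrB; apply: eq_bigr => p _.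
  have -> : first_step w (src p) + first_step w (tgt p) = edge_par beta p + edge_delta w p.
    by rewrite /first_step /edge_par /edge_delta; ring.
  by rewrite /rem -/(edge_par beta p) /edge_prob /edge_var; field.
have Hrem : `|\sum_p rem p| <= 32 * quartic w.
  apply: (le_trans (ler_norm_sum _ _ _)).
  apply: (@le_trans _ _ (4 * \sum_p edge_var p * edge_delta w p ^+ 4)).
    rewrite mulr_sumr; apply: ler_sum => p _.
    apply: (le_trans (softplus_taylor3 _ (edge_delta_small p hZ))).
    by rewrite -normrX ger0_norm ?exprn_even_ge0 // mulrA.
  by have := edge_quartic_le beta S w; lra.
rewrite E.
have -> : 2 * (\sum_i deg_var i * delta w i ^+ 2 - (\sum_i deg_var i * delta w i ^+ 2 + coupling_form w) / 2 -
  cubic w / 6 - \sum_p rem p) - \sum_i deg_var i * delta w i ^+ 2 =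
  - coupling_form w - cubic w / 3 - 2 * \sum_p rem p by field.
move: Hrem; rewrite !ler_norml => /andP[h1 h2].
have := ler_norm (coupling_form w); have := ler_norm (- coupling_form w); rewrite normrN.
have := ler_norm (cubic w); have := ler_norm (- cubic w); rewrite normrN.
have := normr_ge0 (cubic w).
move=> c0 c1 c2 b1 b2; apply/andP; split; lra.
Qed.

Definition grad w i : R :=
  free i * \sum_p inc p i * ((w p)%:R - mu (edge_par beta p + edge_delta w p)).

(** On [S] the step cancels the centred degree against the diagonal of the information; what
    survives is minus [coupling] and the second-order remainder of [mu]. *)
Lemma grad_sqr w : step_err w <= N / 16 ->
  \sum_i grad w i ^+ 2 <= 2 * coupling_sq w + 512 * N * quartic w.
Proof.
move=> hZ.
pose rem p : R := mu (edge_par beta p + edge_delta w p) - mu (edge_par beta p) - dmu (edge_par beta p) * edge_delta w p.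
pose Rr i := \sum_p inc p i * rem p.
have E i : grad w i = free i * (- coupling w i - Rr i).
  rewrite /grad -[LHS]/(free i * _).
  have -> : \sum_p inc p i * ((w p)%:R - mu (edge_par beta p + edge_delta w p)) =
    cdeg w i - \sum_p edge_var p * inc p i * edge_delta w p - Rr i.
    by rewrite /cdeg /lin_form /Rr -!sumrB; apply: eq_bigr => p _; rewrite /rem /edge_prob /edge_var; ring.
  rewrite var_mx_sum -/(coupling w i) deg_var_delta.
  rewrite [LHS](_ : _ = (free i - free i ^+ 2) * cdeg w i + free i * (- coupling w i - Rr i)); last by ring.
  by rewrite free_sqr subrr mul0r add0r.
have HR i : Rr i ^+ 2 <= 16 * N * \sum_p edge_var p * inc p i * edge_delta w p ^+ 4.
  have h1 : `|Rr i| <= \sum_p edge_var p * inc p i * (4 * edge_delta w p ^+ 2).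
    apply: (le_trans (ler_norm_sum _ _ _)); apply: ler_sum => p _.
    rewrite normrM (ger0_norm (inc_ge0 p i)).
    have := ler_wpM2l (inc_ge0 (R := R) p i) (mu_taylor1 (edge_par beta p) (edge_delta_small p hZ)).
    rewrite real_normK ?num_real // => k; apply: (le_trans k).
    by rewrite le_eqVlt; apply/orP; left; apply/eqP; rewrite /edge_var; ring.
  have h2 : Rr i ^+ 2 <= (\sum_p edge_var p * inc p i * (4 * edge_delta w p ^+ 2)) ^+ 2.
    rewrite -[leLHS]real_normK ?num_real // lerXn2r ?nnegrE //.
    exact: le_trans h1.
  apply: (le_trans h2).
  apply: (le_trans (weighted_cauchy (fun p => 4 * edge_delta w p ^+ 2)
    (fun p => mulr_ge0 (edge_var_ge0 beta p) (inc_ge0 p i)))).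
  rewrite -/(deg_var i).
  have -> : \sum_p edge_var p * inc p i * (4 * edge_delta w p ^+ 2) ^+ 2 =
      16 * \sum_p edge_var p * inc p i * edge_delta w p ^+ 4.
    by rewrite mulr_sumr; apply: eq_bigr => p _; ring.
  rewrite mulrA; apply: ler_wpM2r.
    apply: sumr_ge0 => p _; rewrite mulr3_ge0 ?edge_var_ge0 ?inc_ge0 // exprn_even_ge0 //.
  by have := deg_var_le beta N_def i; lra.
apply: (@le_trans _ _ (\sum_i (2 * coupling w i ^+ 2 + 2 * (16 * N * \sum_p edge_var p * inc p i * edge_delta w p ^+ 4)))).
  apply: ler_sum => i _; rewrite E exprMn free_sqr.
  have h := HR i.
  apply: (@le_trans _ _ ((- coupling w i - Rr i) ^+ 2)).
    by rewrite ler_piMl ?sqr_ge0 ?free_le1.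
  by have := sqr_ge0 (coupling w i - Rr i); nra.
rewrite big_split /= -!mulr_sumr lerD2l.
rewrite exchange_big /=.
have -> : \sum_p \sum_i edge_var p * inc p i * edge_delta w p ^+ 4 = 2 * \sum_p edge_var p * edge_delta w p ^+ 4.
  rewrite mulr_sumr; apply: eq_bigr => p _.
  rewrite (eq_bigr (fun i => inc p i * (edge_var p * edge_delta w p ^+ 4))) ?sum_endpoints; first by ring.
  by move=> i _; ring.
have := edge_quartic_le beta S w; have := N_gt0; nra.
Qed.

(** The constant 64 is 4 * 8 * 2: moving from [beta] to the step costs 4 in the edge variance,
    [softplus_quadratic_lower] costs 8, and n - 2 >= N / 2 costs 2. *)
Lemma loglik_local w (h : 'I_n -> R) : step_err w <= N / 16 ->
  (forall i, ~~ S i -> h i = 0) -> (forall i, `|h i| <= 2^-1) ->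
  loglik w (fun i => first_step w i + h i) - loglik w (first_step w) <=
  \sum_i grad w i * h i - N / (64 * b) * \sum_i h i ^+ 2.
Proof.
move=> hZ hS h12.
have y1 p : `|h (src p) + h (tgt p)| <= 1.
  have h1 := h12 (src p); have h2 := h12 (tgt p).
  by apply: (le_trans (ler_normD _ _)); lra.
have -> : \sum_i grad w i * h i =
   \sum_p ((w p)%:R - mu (edge_par beta p + edge_delta w p)) * (h (src p) + h (tgt p)).
  rewrite [RHS](eq_bigr (fun p => \sum_i inc p i * ((w p)%:R - mu (edge_par beta p + edge_delta w p)) * h i)).
    rewrite exchange_big /=; apply: eq_bigr => i _; rewrite /grad -mulr_suml.
    have [Si|nS] := boolP (S i); first by rewrite /free Si mul1r.
    by rewrite (hS _ nS) !mulr0.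
  by move=> p _; rewrite -sum_endpoints mulr_sumr; apply: eq_bigr => i _; ring.
have L : N / (64 * b) * \sum_i h i ^+ 2 <= \sum_p edge_var p / 32 * (h (src p) + h (tgt p)) ^+ 2.
  apply: (@le_trans _ _ ((32 * b)^-1 * \sum_(p : upair n) (h (src p) + h (tgt p)) ^+ 2)).
    apply: (@le_trans _ _ ((32 * b)^-1 * ((n%:R - 2) * \sum_i h i ^+ 2))); last first.
      by rewrite ler_wpM2l ?sum_edges_sqr // invr_ge0 mulr_ge0 // ltW.
    rewrite mulrA ler_wpM2r ?sumr_ge0 // => [i _|]; first exact: sqr_ge0.
    rewrite (_ : N / (64 * b) = (32 * b)^-1 * (N / 2)); last by field; rewrite lt0r_neq0.
    rewrite ler_wpM2l ?invr_ge0 ?mulr_ge0 ?(ltW b_gt0) //.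
    have -> : n%:R = N + 1 by rewrite N_def natr1 prednK //; case: n n_gt3.
    have : 3 <= N by rewrite N_def (ler_nat R 3); case: n n_gt3.
    lra.
  rewrite mulr_sumr; apply: ler_sum => p _; rewrite ler_wpM2r ?sqr_ge0 //.
  have := dmu_ge (src_neq_tgt p); rewrite -/(edge_par beta p) -/(edge_var p) invfM => k.
  lra.
apply: (@le_trans _ _ (\sum_p ((w p)%:R - mu (edge_par beta p + edge_delta w p)) * (h (src p) + h (tgt p)) -
   \sum_p edge_var p / 32 * (h (src p) + h (tgt p)) ^+ 2)); last by lra.
rewrite !loglikE -!sumrB; apply: ler_sum => p _.
have -> : first_step w (src p) + first_step w (tgt p) = edge_par beta p + edge_delta w p.
  by rewrite /first_step /edge_par /edge_delta; ring.
have -> : first_step w (src p) + h (src p) + (first_step w (tgt p) + h (tgt p)) =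
    edge_par beta p + edge_delta w p + (h (src p) + h (tgt p)).
  by rewrite /first_step /edge_par /edge_delta; ring.
have := softplus_quadratic_lower (edge_par beta p + edge_delta w p) (y1 p).
have := dmu_near_ge (edge_par beta p) (edge_delta_small p hZ); rewrite -/(edge_var p).
set a := edge_par beta p + edge_delta w p; set y := _ + h (tgt p).
move=> k1 k2; have : edge_var p / 32 * y ^+ 2 <= dmu a / 8 * y ^+ 2.
  by rewrite ler_wpM2r ?sqr_ge0 //; lra.
lra.
Qed.

Lemma argmax_expansion w : step_err w <= N / (64 ^+ 4 * b) ->
  exists2 g, is_argmax (loglik w) (fun g => forall i, ~~ S i -> g i = beta i) g &
    `|2 * (loglik w g - loglik w beta) - \sum_i free i * (cdeg w i ^+ 2 / deg_var i)| <=
    130 ^+ 2 * step_err w.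
Proof.
move=> hZ.
have hZ16 : step_err w <= N / 16.
  apply: (le_trans hZ); rewrite ler_wpM2l ?(ltW N_gt0) // lef_pV2 ?posrE ?mulr_gt0 ?exprn_gt0 //.
  by have := b_ge1; nra.
pose lam := N / (64 * b); have lam0 : 0 < lam by rewrite divr_gt0 ?mulr_gt0.
have Z0 : 0 <= step_err w by exact: step_err_ge0.
have bQ := step_err_quartic w; have bU := step_err_coupling_sq w.
have Q0 := quartic_ge0 beta S w; have U0 := coupling_sq_ge0 beta S w.
have bU' : b * coupling_sq w <= 2 * N * step_err w.
  have : b * coupling_sq w <= n%:R * step_err w.
    have := ler_wpM2l (ltW n_gt0) bU.
    by rewrite (_ : n%:R * (b / n%:R * coupling_sq w) = b * coupling_sq w) //; field; rewrite lt0r_neq0.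
  move=> k; apply: (le_trans k); rewrite ler_wpM2r //.
set G := 2 * coupling_sq w + 512 * N * quartic w.
have bG : b * G <= 516 * N * step_err w.
  have := ler_wpM2l (ltW N_gt0) bQ; rewrite /G; lra.
(* The threshold [64 ^+ 4] is chosen so that [b] times the right side is 1024 times N times that
   threshold bound, against 516 on the left. *)
have Glam : G < lam ^+ 2 / 4.
  rewrite -(ltr_pM2l b_gt0); apply: (le_lt_trans bG).
  apply: (@le_lt_trans _ _ (516 * N * (N / (64 ^+ 4 * b)))).
    by apply: ler_wpM2l hZ; rewrite mulr_ge0 ?ler0n // (ltW N_gt0).
  rewrite /lam; have -> : b * ((N / (64 * b)) ^+ 2 / 4) = 1024 * N * (N / (64 ^+ 4 * b)).
    by field; rewrite lt0r_neq0.
  by rewrite ltr_pM2r ?divr_gt0 ?mulr_gt0 ?exprn_gt0 // ltr_pM2r // ltr_nat.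
have [g [gS gmax] /andP[g0 g1]] := argmax_of_local_bound lam0
  (fun h => loglik_local hZ16) (grad_sqr hZ16) Glam.
have offS i : ~~ S i -> first_step w i = beta i.
  by move=> nS; rewrite /first_step /delta /free (negPf nS) mul0r mul0r addr0.
exists g.
  split=> [i nS|g' g'S]; first by rewrite gS // offS.
  by apply: gmax => i nS; rewrite g'S // offS.
have X : \sum_i free i * (cdeg w i ^+ 2 / deg_var i) = \sum_i deg_var i * delta w i ^+ 2.
  by apply: eq_bigr => i _; rewrite -cdeg_delta /delta; ring.
rewrite X.
have := loglik_step hZ16.
have gap : G / (4 * lam) <= 64 * (b / n%:R * coupling_sq w) + 128 * 64 * (b * quartic w).
  rewrite /G /lam.
  rewrite [leLHS](_ : _ = 64 * (b / n%:R * coupling_sq w) * (n%:R / (2 * N)) + 128 * 64 * (b * quartic w)); last first.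
    by field; rewrite !lt0r_neq0.
  rewrite lerD2r ler_piMr //.
    by rewrite mulr_ge0 ?ler0n // mulr_ge0 // divr_ge0 // ltW.
  by rewrite ler_pdivrMr ?mulr_gt0 // mul1r.
have B0 := normr_ge0 (coupling_form w); have C0 := normr_ge0 (cubic w).
have bQ1 : quartic w <= b * quartic w by rewrite ler_peMl.
have bU0 : 0 <= b / n%:R * coupling_sq w by rewrite mulr_ge0 // divr_ge0 // ltW.
have g2 := le_trans g1 gap; move: g0 g2.
have -> : loglik w g - loglik w beta =
  (loglik w g - loglik w (first_step w)) + (loglik w (first_step w) - loglik w beta) by ring.
move: (loglik w g - _) (loglik w (first_step w) - _) => D2 D1 g0 g2 hD.
(* Twice the gain over the step contributes 2 * 128 * 64 = 128 * 128, and the Taylor remainder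
   64. *)
have c : (128 * 128 + 64 : R) <= 130 ^+ 2 by lra.
apply: (@le_trans _ _ ((128 * 128 + 64) * step_err w)); last by rewrite ler_wpM2r.
apply: (@le_trans _ _ (`|coupling_form w| + `|cubic w| + 64 * quartic w + 2 * D2)); last first.
  by rewrite /step_err; lra.
move: hD; rewrite !ler_norml => /andP[h1 h2]; apply/andP; split; lra.
Qed.

End Expansion.

(** * Stein's identity for the normalized sum of squared degrees *)

Section SteinIdentity.
Context {R : realType} {n : nat} (beta : 'I_n -> R) (b N : R) (S : pred 'I_n).
Implicit Types (p : upair n) (i j k : 'I_n) (w : graph n).

Hypothesis N_def : N = n.-1%:R.
Hypothesis n_gt3 : (3 < n)%N.
Hypothesis b_ge1 : 1 <= b.
Hypothesis b_leN : b <= N.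
Hypothesis dmu_ge : forall i j, i != j -> b^-1 <= dmu (beta i + beta j).

Local Notation E := (cube_E (edge_prob beta)).
Local Notation deg_var := (deg_var beta).
Local Notation edge_var := (edge_var beta).
Local Notation cdeg := (cdeg beta).
Local Notation delta := (delta beta S).
Local Notation edge_delta := (edge_delta beta S).
Local Notation coupling := (coupling beta S).
Local Notation coupling_form := (coupling_form beta S).
Local Notation free := (free (R := R) S).

Let b_gt0 : 0 < b. Proof. by apply: lt_le_trans b_ge1. Qed.
Let N_gt0 : 0 < N. Proof. by apply: lt_le_trans b_leN. Qed.
Let deg_var_gt0 i : 0 < deg_var i. Proof. exact: (deg_var_gt0 N_def b_ge1 b_leN dmu_ge). Qed.
Let deg_var_neq0 i : deg_var i != 0. Proof. exact/lt0r_neq0. Qed.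
Let Vinv_ge0 i : 0 <= (deg_var i)^-1. Proof. by rewrite invr_ge0 ltW. Qed.
Let chiV_ge0 i : 0 <= free i / deg_var i. Proof. by rewrite mulr_ge0 ?free_ge0. Qed.

Definition chi2_stat w : R := \sum_i free i * (cdeg w i ^+ 2 / deg_var i).

Let r : R := \sum_i free i.

Variables (rho sN : R).
Hypothesis rho_ge1 : 1 <= rho.
Hypothesis rho_sqr : rho ^+ 2 = 2 * r.
Hypothesis sN_ge1 : 1 <= sN.
Hypothesis sN_sqr : sN ^+ 2 = N.

Let rho_gt0 : 0 < rho. Proof. by apply: lt_le_trans rho_ge1. Qed.
Let sN_gt0 : 0 < sN. Proof. by apply: lt_le_trans sN_ge1. Qed.
Let r_gt0 : 0 < r.
Proof. by rewrite -(pmulr_rgt0 _ (ltr0Sn R 1)) -rho_sqr exprn_gt0. Qed.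

Definition norm_stat w : R := (chi2_stat w - r) / rho.

Lemma E_chi2_stat : E chi2_stat = r.
Proof.
rewrite cube_E_sum; apply: eq_bigr => i _; rewrite cube_EZ.
rewrite (eq_cube_E _ (G := fun w => (deg_var i)^-1 * cdeg w i ^+ 2)); last by move=> w; rewrite mulrC.
by rewrite cube_EZ E_cdeg2 mulVf // mulr1.
Qed.

Lemma dif_cdeg w p i : cdeg (upd w p true) i - cdeg (upd w p false) i = inc p i.
Proof. exact: (dif_lin_form (edge_prob beta) (fun p => inc p i) p w). Qed.

Lemma cdeg_near w p i c : `|cdeg (upd w p c) i - cdeg w i| <= inc p i.
Proof.
apply: (le_trans (upd_lin_form_near (edge_prob beta) (fun p => inc p i) p w c)).
by rewrite ger0_norm ?inc_ge0.
Qed.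

Lemma dif_chi2_stat w p : dif p chi2_stat w = \sum_i inc p i *
  (free i / deg_var i * (cdeg (upd w p true) i + cdeg (upd w p false) i)).
Proof.
rewrite /dif /chi2_stat -sumrB; apply: eq_bigr => i _.
by rewrite -(dif_cdeg w); ring.
Qed.

Lemma sum_free_deg_var_inv : \sum_i free i * (deg_var i)^-1 <= r.
Proof.
apply: ler_sum => i _; rewrite ler_piMr ?free_ge0 //.
by rewrite invf_le1 // (deg_var_ge1 N_def b_ge1 b_leN dmu_ge).
Qed.

Lemma E_chi2_stat_dev : E (fun w => (chi2_stat w - r) ^+ 2) <= (4 * rho) ^+ 2.
Proof.
(* By Efron--Stein each free node adds 16 + 16 / [deg_var i], at most 32, to the variance, and 32 r
   = (4 rho)^2. *)
have h : E (fun w => chi2_stat w ^+ 2) <= r ^+ 2 + 32 * r.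
  apply: (le_trans (cube_poincare (edge_prob_01 beta) chi2_stat)); rewrite E_chi2_stat lerD2l.
  apply: (@le_trans _ _ (E (fun w => \sum_p edge_var p * (2 * \sum_i inc p i * (free i * ((deg_var i)^-1 ^+ 2 * (8 * cdeg w i ^+ 2 + 8))))))).
    rewrite cube_E_sum; apply: ler_sum => p _; rewrite cube_EZ bvarE ler_wpM2l ?edge_var_ge0 //.
    apply: cube_E_le => [|w]; first exact: edge_prob_01.
    rewrite dif_chi2_stat; apply: (le_trans (endpoints_sqr _ _)); rewrite ler_wpM2l //.
    apply: ler_sum => i _; rewrite ler_wpM2l ?inc_ge0 // !exprMn free_sqr -mulrA.
    rewrite ler_wpM2l ?free_ge0 // ler_wpM2l ?sqr_ge0 //.
    have h1 := le_trans (cdeg_near w p i true) (inc_le1 p i).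
    have h0 := le_trans (cdeg_near w p i false) (inc_le1 p i).
    move: h1 h0; rewrite !ler_norml.
    move: (cdeg (upd w p true) i) (cdeg (upd w p false) i) (cdeg w i) => x y z.
    move=> /andP[a1 a2] /andP[a3 a4].
    have : (x + y - 2 * z) ^+ 2 <= 4 by nra.
    by have := sqr_ge0 (x + y - 4 * z); nra.
  rewrite (eq_cube_E _ (G := fun w => \sum_i (16 * (free i * ((deg_var i)^-1 * cdeg w i ^+ 2)) + 16 * (free i * (deg_var i)^-1)))); last first.
    move=> w; under eq_bigr do rewrite mulrCA.
    by rewrite -mulr_sumr handshake_inc mulr_sumr; apply: eq_bigr => i _; field.
  rewrite cube_E_sum (eq_bigr (fun i => 16 * free i + 16 * (free i * (deg_var i)^-1))); last first.
    by move=> i _; rewrite cube_ED cube_Ecst !cube_EZ E_cdeg2; field.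
  by rewrite big_split /= -!mulr_sumr -/r; have := sum_free_deg_var_inv; lra.
rewrite cube_E_sqr_dev E_chi2_stat exprMn rho_sqr; lra.
Qed.

Lemma E_chi2_stat_abs : E (fun w => `|chi2_stat w - r|) <= 4 * rho.
Proof. by apply: E_norm_le E_chi2_stat_dev; rewrite mulr_gt0. Qed.

(** Bounds the change of [edge_delta] under the flip of one edge, as in [edge_delta_near]. *)
Definition edge_jump : R := 2 * (b / N).

Lemma edge_jump_ge0 : 0 <= edge_jump.
Proof. by rewrite mulr_ge0 // divr_ge0 ?ltW. Qed.

Definition edge_size w p : R := `|edge_delta w p| + edge_jump.

Lemma edge_size_ge0 w p : 0 <= edge_size w p.
Proof. by rewrite addr_ge0 ?edge_jump_ge0. Qed.

(** A flip changes a squared degree by the sum of its two flipped values, which is [2 * cdeg w i] up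
    to 2; the two ends together give [edge_delta]. *)
Lemma dif_norm_stat_main w p : `|dif p norm_stat w - 2 / rho * edge_delta w p| <= 2 / rho * edge_jump.
Proof.
have -> : dif p norm_stat w - 2 / rho * edge_delta w p = rho^-1 * \sum_i inc p i *
   (free i / deg_var i * (cdeg (upd w p true) i + cdeg (upd w p false) i - 2 * cdeg w i)).
  have -> : dif p norm_stat w = rho^-1 * dif p chi2_stat w by rewrite /dif /norm_stat; field; rewrite lt0r_neq0.
  rewrite dif_chi2_stat !sum_endpoints /edge_delta /delta; ring.
rewrite normrM (gtr0_norm (_ : 0 < rho^-1)) ?invr_gt0 // [2 / rho]mulrC -mulrA.
rewrite ler_wpM2l ?invr_ge0 ?(ltW rho_gt0) //.
apply: (le_trans (ler_norm_sum _ _ _)).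
apply: (@le_trans _ _ (\sum_i inc p i * (b / N * 2))); last first.
  by rewrite sum_endpoints /edge_jump; lra.
apply: ler_sum => i _; rewrite normrM (ger0_norm (inc_ge0 p i)) ler_wpM2l ?inc_ge0 //.
rewrite normrM (ger0_norm (chiV_ge0 i)); apply: ler_pM => //.
  apply: le_trans (deg_var_inv_le N_def b_ge1 b_leN dmu_ge i).
  by rewrite ler_piMl ?free_le1.
have h1 := le_trans (cdeg_near w p i true) (inc_le1 p i).
have h0 := le_trans (cdeg_near w p i false) (inc_le1 p i).
move: h1 h0; rewrite !ler_norml => /andP[a1 a2] /andP[a3 a4].
apply/andP; split; lra.
Qed.

Lemma dif_norm_stat_le w p : `|dif p norm_stat w| <= 2 / rho * edge_size w p.
Proof.
have h := dif_norm_stat_main w p.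
have c0 : 0 <= 2 / rho by rewrite divr_ge0 ?(ltW rho_gt0).
have k : `|2 / rho * edge_delta w p| = 2 / rho * `|edge_delta w p| by rewrite normrM ger0_norm.
have -> : 2 / rho * edge_size w p = 2 / rho * `|edge_delta w p| + 2 / rho * edge_jump by rewrite /edge_size mulrDr.
rewrite -k -[dif p norm_stat w](subrK (2 / rho * edge_delta w p)) addrC.
by apply: (le_trans (ler_normD _ _)); rewrite lerD2l.
Qed.

Lemma norm_stat_near w p c : `|norm_stat (upd w p c) - norm_stat w| <= `|dif p norm_stat w|.
Proof.
rewrite /dif; have := upd_id w p; case: (w p) c => -[] => Hw; rewrite -{2}Hw ?subrr ?normr0 //.
by rewrite -normrN opprB.
Qed.

Variables (f df : R -> R) (K : R).
Hypothesis df_le : forall x, `|df x| <= K.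
Hypothesis f_lip : forall x y, `|f y - f x| <= K * `|y - x|.
Hypothesis f_taylor : forall x y, `|f y - f x - df x * (y - x)| <= K * (y - x) ^+ 2.

Let K_ge0 : 0 <= K. Proof. exact: le_trans (df_le 0). Qed.

(** The error of a product rule: the difference of a product, minus its value with [f] frozen and
    the increment of [norm_stat] replaced by its leading part. *)
Definition stein_rem w p i : R :=
  dif p (fun w => cdeg w i * f (norm_stat w)) w
  - (f (norm_stat w) + cdeg w i * (df (norm_stat w) * (2 / rho * edge_delta w p))).

Lemma stein_rem_le w p i : inc p i = 1 :> R -> `|stein_rem w p i| <=
  K * (4 / rho * edge_size w p + 8 / rho ^+ 2 * (`|cdeg w i| * edge_size w p ^+ 2)
       + 2 / rho * (`|cdeg w i| * edge_jump)).
Proof.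
move=> i1; rewrite /stein_rem /dif.
have := dif_norm_stat_main w p; have := dif_norm_stat_le w p; have := norm_stat_near w p true.
have := norm_stat_near w p false; have := dif_cdeg w p i; rewrite i1.
have := cdeg_near w p i false; rewrite i1.
set W1 := norm_stat (upd w p true); set W0 := norm_stat (upd w p false); set W := norm_stat w.
rewrite /dif -/W1 -/W0.
set d1 := cdeg (upd w p true) i; set d0 := cdeg (upd w p false) i; set d := cdeg w i.
set th := 2 / rho * edge_delta w p; set y := edge_size w p; set D := W1 - W0.
move=> hd0 hd hW0 hW1 hD hth.
have y0 : 0 <= y by exact: edge_size_ge0.
have e1 : `|f W1 - f W| <= K * `|D| by apply: (le_trans (f_lip _ _)); rewrite ler_wpM2l.
have e2 : `|f W1 - f W0| <= K * `|D| by exact: f_lip.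
have sq x : `|x| <= `|D| -> x ^+ 2 <= D ^+ 2.
  by move=> h; rewrite -[leLHS]real_normK ?num_real // -[leRHS]real_normK ?num_real // lerXn2r ?nnegrE.
have e3 : `|f W1 - f W0 - df W * D| <= 2 * K * D ^+ 2.
  have -> : f W1 - f W0 - df W * D = (f W1 - f W - df W * (W1 - W)) - (f W0 - f W - df W * (W0 - W)).
    by rewrite /D; ring.
  apply: (le_trans (ler_normB _ _)).
  have t1 := f_taylor W W1; have t0 := f_taylor W W0.
  have s1 := ler_wpM2l K_ge0 (sq _ hW1); have s0 := ler_wpM2l K_ge0 (sq _ hW0).
  lra.
have -> : d1 * f W1 - d0 * f W0 - (f W + d * (df W * th)) =
  (f W1 - f W) + (d0 - d) * (f W1 - f W0) + d * (f W1 - f W0 - df W * D) + d * (df W * (D - th)).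
  have -> : d1 = 1 + d0 by rewrite -hd; ring.
  by ring.
have D2 : D ^+ 2 <= 4 / rho ^+ 2 * y ^+ 2.
  have : `|D| ^+ 2 <= (2 / rho * y) ^+ 2.
    by rewrite lerXn2r ?nnegrE // mulr_ge0 // divr_ge0 // ltW.
  rewrite real_normK ?num_real // => h; apply: (le_trans h).
  by rewrite le_eqVlt; apply/orP; left; apply/eqP; field; rewrite lt0r_neq0.
have n1 : `|(d0 - d) * (f W1 - f W0)| <= K * `|D|.
  by rewrite normrM -[leRHS]mul1r; apply: ler_pM.
have n2 : `|d * (f W1 - f W0 - df W * D)| <= `|d| * (2 * K * (4 / rho ^+ 2 * y ^+ 2)).
  rewrite normrM ler_wpM2l //; apply: (le_trans e3).
  by rewrite ler_wpM2l // mulr_ge0.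
have n3 : `|d * (df W * (D - th))| <= `|d| * (K * (2 / rho * edge_jump)).
  by rewrite !normrM ler_wpM2l //; apply: ler_pM.
have n4 : K * `|D| <= K * (2 / rho * y) by rewrite ler_wpM2l.
apply: (le_trans (ler_normD _ _)); apply: (le_trans (lerD (ler_normD _ _) (lexx _))).
apply: (le_trans (lerD (lerD (ler_normD _ _) (lexx _)) (lexx _))).
have -> : K * (4 / rho * y + 8 / rho ^+ 2 * (`|d| * y ^+ 2) + 2 / rho * (`|d| * edge_jump)) =
   K * (2 / rho * y) + K * (2 / rho * y) + `|d| * (2 * K * (4 / rho ^+ 2 * y ^+ 2))
   + `|d| * (K * (2 / rho * edge_jump)) by ring.
apply: lerD => //; apply: lerD => //; apply: lerD; last exact: le_trans n4.
exact: le_trans n4.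
Qed.

(** Dominates both sqrt(b / N), the size of one entry of [delta], and [b / N]. *)
Let tau : R := b / sN.

Let tau_ge0 : 0 <= tau. Proof. by rewrite divr_ge0 ?ltW. Qed.

Let bN_le_tau : b / N <= tau.
Proof.
rewrite /tau ler_wpM2l ?(ltW b_gt0) // lef_pV2 ?posrE // -sN_sqr expr2.
by rewrite ler_peMr // ltW.
Qed.

Lemma E_delta_abs i : E (fun w => `|delta w i|) <= tau.
Proof.
apply: E_norm_le; first by rewrite divr_gt0.
apply: (le_trans (E_delta2 S N_def b_ge1 b_leN dmu_ge i)).
apply: (le_trans (deg_var_inv_le N_def b_ge1 b_leN dmu_ge i)).
rewrite /tau exprMn exprVn sN_sqr ler_wpM2r ?invr_ge0 ?(ltW N_gt0) //.
by rewrite expr2 ler_peMr // ltW.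
Qed.

Lemma E_cdeg_abs i : E (fun w => `|cdeg w i|) <= sN.
Proof.
apply: E_norm_le => //; rewrite E_cdeg2 sN_sqr.
exact: (deg_var_le beta N_def).
Qed.

Lemma E_edge_size p : E (fun w => edge_size w p) <= 4 * tau.
Proof.
apply: (@le_trans _ _ (E (fun w => `|delta w (src p)| + `|delta w (tgt p)| + edge_jump))).
  apply: cube_E_le => [|w]; first exact: edge_prob_01.
  by rewrite /edge_size lerD2r; exact: ler_normD.
rewrite !cube_ED cube_Ecst /edge_jump.
have := E_delta_abs (src p); have := E_delta_abs (tgt p); have := bN_le_tau; lra.
Qed.

Lemma E_edge_size4 p : E (fun w => edge_size w p ^+ 4) <= 1000 * 2 * (b / N) ^+ 2.
Proof.
have q0 : 0 <= b / N by rewrite divr_ge0 ?ltW.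
have q1 : b / N <= 1 by rewrite ler_pdivrMr // mul1r.
have D i : E (fun w => delta w i ^+ 4) <= 12 * (b / N) ^+ 2.
  apply: (le_trans (E_delta4 S N_def b_ge1 b_leN dmu_ge i)); rewrite ler_wpM2l //.
  by rewrite lerXn2r ?nnegrE // (deg_var_inv_le N_def b_ge1 b_leN dmu_ge).
apply: (@le_trans _ _ (E (fun w => 64 * delta w (src p) ^+ 4 + 64 * delta w (tgt p) ^+ 4 + 8 * edge_jump ^+ 4))).
  apply: cube_E_le => [|w]; first exact: edge_prob_01.
  apply: (le_trans (quart_sum2 _ _)).
  have -> : `|edge_delta w p| ^+ 4 = edge_delta w p ^+ 4 by rewrite -normrX ger0_norm // exprn_even_ge0.
  by have := quart_sum2 (delta w (src p)) (delta w (tgt p)); rewrite -/(edge_delta w p); lra.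
rewrite !cube_ED cube_Ecst !cube_EZ.
have h : edge_jump ^+ 4 <= 16 * (b / N) ^+ 2.
  rewrite /edge_jump; move: q0 q1; move: (b / N) => q q0 q1.
  have -> : (2 * q) ^+ 4 = 16 * q ^+ 2 * q ^+ 2 by ring.
  rewrite ler_piMr ?exprn_ile1 //.
  by rewrite mulr_ge0 ?ler0n // sqr_ge0.
have := D (src p); have := D (tgt p); have : 0 <= (b / N) ^+ 2 by exact: sqr_ge0.
lra.
Qed.

Lemma E_cdeg_edge_size2 p i : E (fun w => `|cdeg w i| * edge_size w p ^+ 2) <= 1001 * tau.
Proof.
(* This weight balances the second moment of [cdeg], at most [N], against the fourth moment of
   [edge_size], of order [(b / N) ^+ 2]: both sides become of order [tau]. *)
pose kap := b / (N * sN); have kap0 : 0 < kap by rewrite divr_gt0 ?mulr_gt0.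
apply: (@le_trans _ _ (E (fun w => kap / 2 * cdeg w i ^+ 2 + (2 * kap)^-1 * edge_size w p ^+ 4))).
  apply: cube_E_le => [|w]; first exact: edge_prob_01.
  have : 0 <= (kap * `|cdeg w i| - edge_size w p ^+ 2) ^+ 2 / (2 * kap).
    by rewrite divr_ge0 ?sqr_ge0 // mulr_ge0 // ltW.
  rewrite [X in 0 <= X -> _](_ : _ = kap / 2 * `|cdeg w i| ^+ 2 - `|cdeg w i| * edge_size w p ^+ 2
     + (2 * kap)^-1 * edge_size w p ^+ 4); last by field; rewrite lt0r_neq0.
  by rewrite real_normK ?num_real //; lra.
rewrite cube_ED !cube_EZ E_cdeg2.
have h1 : kap / 2 * deg_var i <= tau / 2.
  have -> : tau / 2 = kap / 2 * N by rewrite /tau /kap; field; rewrite !lt0r_neq0.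
  by rewrite ler_wpM2l ?(deg_var_le beta N_def) // divr_ge0 // ltW.
have h2 : (2 * kap)^-1 * E (fun w => edge_size w p ^+ 4) <= 1000 * tau.
  have -> : 1000 * tau = (2 * kap)^-1 * (1000 * 2 * (b / N) ^+ 2).
    rewrite /tau /kap -sN_sqr; field; rewrite !lt0r_neq0 //.
  by apply: ler_wpM2l (E_edge_size4 p); rewrite invr_ge0 mulr_ge0 // ltW.
have := tau_ge0; lra.
Qed.

Let cst : R := 16 + 8 * 1001 + 4.

Lemma E_stein_rem p i : inc p i = 1 :> R ->
  E (fun w => `|stein_rem w p i|) <= K * (cst * tau / rho).
Proof.
move=> i1; apply: (@le_trans _ _ (E (fun w => K * (4 / rho * edge_size w p + 8 / rho ^+ 2 * (`|cdeg w i| * edge_size w p ^+ 2)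
       + 2 / rho * (edge_jump * `|cdeg w i|))))).
  apply: cube_E_le => [|w]; first exact: edge_prob_01.
  by rewrite [edge_jump * _]mulrC; exact: stein_rem_le.
rewrite cube_EZ ler_wpM2l // !cube_ED !cube_EZ.
have h1 : 4 / rho * E (fun w => edge_size w p) <= 16 * tau / rho.
  have -> : 16 * tau / rho = 4 / rho * (4 * tau) by ring.
  by apply: ler_wpM2l (E_edge_size p); rewrite divr_ge0 // ltW.
have h2 : 8 / rho ^+ 2 * E (fun w => `|cdeg w i| * edge_size w p ^+ 2) <= 8 * 1001 * tau / rho.
  apply: (@le_trans _ _ (8 / rho ^+ 2 * (1001 * tau))).
    by apply: ler_wpM2l (E_cdeg_edge_size2 p i); rewrite divr_ge0 // sqr_ge0.
  have -> : 8 / rho ^+ 2 * (1001 * tau) = 8 * 1001 * tau / rho * rho^-1.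
    by field; rewrite lt0r_neq0.
  have a0 : 0 <= 8 * 1001 * tau / rho.
    apply: divr_ge0 (ltW rho_gt0); apply: mulr_ge0 tau_ge0.
    by apply: mulr_ge0; exact: ler0n.
  have a1 : rho^-1 <= 1 by rewrite invf_le1.
  exact: ler_piMr a0 a1.
have h3 : 2 / rho * (edge_jump * E (fun w => `|cdeg w i|)) <= 4 * tau / rho.
  apply: (@le_trans _ _ (2 / rho * (edge_jump * sN))).
    apply: ler_wpM2l; first by rewrite divr_ge0 // ltW.
    by apply: ler_wpM2l (E_cdeg_abs i); exact: edge_jump_ge0.
  rewrite le_eqVlt; apply/orP; left; apply/eqP; rewrite /edge_jump /tau -sN_sqr.
  by field; rewrite !lt0r_neq0.
have -> : cst * tau / rho = 16 * tau / rho + 8 * 1001 * tau / rho + 4 * tau / rho.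
  by rewrite /cst; ring.
by apply: lerD => //; apply: lerD.
Qed.

(** One factor [cdeg w i] of each square is integrated by parts over its edges. The term [r * f] so
    produced cancels the centring of [norm_stat], and the factor before the main term is 2 / rho^2 =
    1 / r. *)
Lemma stein_identity : E (fun w => norm_stat w * f (norm_stat w)) =
  r^-1 * E (fun w => df (norm_stat w) * (chi2_stat w + coupling_form w)) +
  rho^-1 * \sum_i free i / deg_var i * \sum_p edge_var p * inc p i * E (fun w => stein_rem w p i).
Proof.
have X1 : E (fun w => chi2_stat w * f (norm_stat w)) =
  \sum_i free i / deg_var i * \sum_p edge_var p * inc p i * E (dif p (fun w => cdeg w i * f (norm_stat w))).
  rewrite (eq_cube_E _ (G := fun w => \sum_i free i / deg_var i * (cdeg w i * (cdeg w i * f (norm_stat w))))).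
    rewrite cube_E_sum; apply: eq_bigr => i _; rewrite cube_EZ.
    by rewrite cube_E_lin_form.
  by move=> w; rewrite /chi2_stat mulr_suml; apply: eq_bigr => i _; ring.
have X2 w : r * f (norm_stat w) + 2 / rho * (df (norm_stat w) * (chi2_stat w + coupling_form w)) =
  \sum_i free i / deg_var i * \sum_p edge_var p * inc p i *
    (f (norm_stat w) + cdeg w i * (df (norm_stat w) * (2 / rho * edge_delta w p))).
  rewrite /r /chi2_stat /coupling_form -big_split /= mulr_suml !mulr_sumr -big_split /=; apply: eq_bigr => i _.
  rewrite [X in _ = _ * X](eq_bigr (fun p => f (norm_stat w) * (edge_var p * inc p i) +
     cdeg w i * df (norm_stat w) * (2 / rho) * (edge_var p * inc p i * edge_delta w p))); last by move=> p _; ring.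
  rewrite big_split /= -!mulr_sumr -/(deg_var i) var_mx_sum -/(coupling w i).
  have c2 := free_sqr (R := R) S i.
  rewrite /delta; move: (norm_stat w) (coupling w i) (cdeg w i) => x u d.
  have -> : free i / deg_var i * (f x * deg_var i + d * df x * (2 / rho) * (deg_var i * (free i / deg_var i * d) + u)) =
     free i * f x + 2 / rho * (df x * (free i ^+ 2 * (d ^+ 2 / deg_var i) + free i / deg_var i * d * u)).
    by field; rewrite deg_var_neq0 lt0r_neq0.
  by rewrite c2.
have X3 : E (fun w => chi2_stat w * f (norm_stat w)) = r * E (fun w => f (norm_stat w)) +
   2 / rho * E (fun w => df (norm_stat w) * (chi2_stat w + coupling_form w)) +
   \sum_i free i / deg_var i * \sum_p edge_var p * inc p i * E (fun w => stein_rem w p i).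
  rewrite -!cube_EZ -cube_ED (eq_cube_E _ X2) X1 cube_E_sum -big_split /=.
  apply: eq_bigr => i _; rewrite cube_EZ -mulrDr; congr (_ * _).
  rewrite cube_E_sum -big_split /=; apply: eq_bigr => p _.
  rewrite cube_EZ -mulrDr; congr (_ * _).
  by rewrite -cube_ED; apply: eq_cube_E => w; rewrite /stein_rem addrC subrK.
rewrite (eq_cube_E _ (G := fun w => rho^-1 * (chi2_stat w * f (norm_stat w) - r * f (norm_stat w)))); last first.
  by move=> w; rewrite {1}/norm_stat; ring.
rewrite cube_EZ cube_EB cube_EZ X3.
have -> : r^-1 = rho^-1 * (2 / rho).
  have -> : r = rho ^+ 2 / 2 by rewrite rho_sqr; field.
  by field; rewrite lt0r_neq0.
ring.
Qed.

(** In the identity, [chi2_stat + coupling_form] is [r] up to an error of mean size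
    [4 * rho + 15 * b], so dividing by [r] leaves the expectation of [df]. *)
Lemma stein_bound :
  `|E (fun w => df (norm_stat w)) - E (fun w => norm_stat w * f (norm_stat w))| <=
  K * (8 / rho + 30 * b / rho ^+ 2 + cst * tau).
Proof.
rewrite stein_identity opprD addrA.
have rE : r = rho ^+ 2 / 2 by rewrite rho_sqr; field.
have h1 : `|E (fun w => df (norm_stat w)) - r^-1 * E (fun w => df (norm_stat w) * (chi2_stat w + coupling_form w))| <=
   K * (8 / rho + 30 * b / rho ^+ 2).
  rewrite -cube_EZ -cube_EB; apply: (le_trans (cube_E_norm (edge_prob_01 beta) _)).
  apply: (@le_trans _ _ (E (fun w => K * r^-1 * (`|chi2_stat w - r| + `|coupling_form w|)))).
    apply: cube_E_le => [|w]; first exact: edge_prob_01.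
    have -> : df (norm_stat w) - r^-1 * (df (norm_stat w) * (chi2_stat w + coupling_form w)) =
        - (df (norm_stat w) * r^-1 * (chi2_stat w - r + coupling_form w)) by field; rewrite lt0r_neq0.
    rewrite normrN !normrM (gtr0_norm (_ : 0 < r^-1)) ?invr_gt0 //.
    apply: ler_pM; rewrite ?mulr_ge0 ?invr_ge0 ?(ltW r_gt0) //; last exact: ler_normD.
    by rewrite ler_wpM2r ?invr_ge0 ?(ltW r_gt0).
  rewrite cube_EZ cube_ED -mulrA ler_wpM2l //.
  have -> : 8 / rho + 30 * b / rho ^+ 2 = r^-1 * (4 * rho + 15 * b).
    by rewrite rE; field; rewrite lt0r_neq0.
  rewrite ler_wpM2l ?invr_ge0 ?(ltW r_gt0) // lerD ?E_chi2_stat_abs //.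
  exact: (E_coupling_form_abs S N_def n_gt3 b_ge1 b_leN dmu_ge).
have h2 : `|rho^-1 * \sum_i free i / deg_var i * \sum_p edge_var p * inc p i * E (fun w => stein_rem w p i)|
    <= K * (cst * tau).
  rewrite normrM (gtr0_norm (_ : 0 < rho^-1)) ?invr_gt0 //.
  apply: (@le_trans _ _ (rho^-1 * \sum_i free i * (K * (cst * tau / rho)))).
    rewrite ler_wpM2l ?invr_ge0 ?(ltW rho_gt0) //.
    apply: (le_trans (ler_norm_sum _ _ _)); apply: ler_sum => i _.
    rewrite normrM (ger0_norm (chiV_ge0 i)).
    apply: (@le_trans _ _ (free i / deg_var i * (deg_var i * (K * (cst * tau / rho))))); last first.
      by rewrite mulrA divfK.
    rewrite ler_wpM2l // /deg_var mulr_suml.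
    apply: (le_trans (ler_norm_sum _ _ _)); apply: ler_sum => p _.
    have ei0 : 0 <= edge_var p * inc p i by rewrite mulr_ge0 ?edge_var_ge0 ?inc_ge0.
    rewrite normrM (ger0_norm ei0).
    have [i1|i0] : inc p i = 1 :> R \/ inc p i = 0 :> R.
      by rewrite /inc; case: (_ || _); [left|right].
    - rewrite ler_wpM2l //; apply: le_trans (E_stein_rem i1).
      exact: (cube_E_norm (edge_prob_01 beta)).
    - by rewrite i0 mulr0 !mul0r.
  rewrite -mulr_suml -/r rE.
  have -> : rho^-1 * (rho ^+ 2 / 2 * (K * (cst * tau / rho))) = K * (cst * tau) / 2.
    by field; rewrite lt0r_neq0.
  have : 0 <= K * (cst * tau).
    apply: mulr_ge0 K_ge0 _; apply: mulr_ge0 tau_ge0; rewrite /cst.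
    apply: addr_ge0 (ler0n _ _); apply: addr_ge0 (ler0n _ _) _.
    by apply: mulr_ge0; exact: ler0n.
  lra.
rewrite mulrDr; apply: (le_trans (ler_normB _ _)); exact: lerD.
Qed.

End SteinIdentity.

(** * Solutions of Stein's equation for smoothed half-lines *)

Section TaylorOn.
Context {R : realType}.
Implicit Types (f g k : R -> R) (K : R) (I : R -> Prop).

(** The regularity that [stein_bound] asks of a test function, with [g] as derivative. It requires
    no derivative of [g], so it survives gluing where [g] has a corner; the Lipschitz bound on [g]
    is what makes gluing possible. *)
Definition taylor_on I f g K := forall x y, I x -> I y ->
  [/\ `|g x| <= K, `|f y - f x| <= K * `|y - x|, `|g x - g y| <= K * `|x - y| &
      `|f y - f x - g x * (y - x)| <= K * (y - x) ^+ 2].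

Definition convex_pred I := forall x y z, I x -> I y -> x <= z <= y -> I z.

Lemma MVT_convex f df I x y : convex_pred I -> (forall x : R, is_derive x 1 f (df x)) ->
  I x -> I y -> exists2 c, I c & f y - f x = df c * (y - x) /\ `|c - x| <= `|y - x|.
Proof.
move=> cI Hf Ix Iy; have [xy|/ltW yx] := leP x y.
  have [c xcy E] := MVT_le xy Hf; exists c; first exact: (cI x y).
  move: xcy => /andP[xc cy]; split => //.
  by rewrite !ger0_norm ?subr_ge0 // lerD2r.
have [c ycx E] := MVT_le yx Hf; exists c; first exact: (cI y x).
move: ycx => /andP[yc cx]; split; first by rewrite -opprB E; ring.
by rewrite !ler0_norm ?subr_le0 // lerN2 lerD2r.
Qed.

Lemma taylor_on_derive I f g k K : convex_pred I ->
  (forall x : R, is_derive x 1 f (g x)) -> (forall x : R, is_derive x 1 g (k x)) ->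
  (forall x, I x -> `|g x| <= K) -> (forall x, I x -> `|k x| <= K) ->
  taylor_on I f g K.
Proof.
move=> cI fg gk gK kK.
have lip x y : I x -> I y -> `|g y - g x| <= K * `|y - x|.
  move=> Ix Iy; have [c Ic [-> _]] := MVT_convex cI gk Ix Iy.
  by rewrite normrM ler_wpM2r ?kK.
move=> x y Ix Iy; split; [exact: gK| |exact: lip|].
  by have [c Ic [-> _]] := MVT_convex cI fg Ix Iy; rewrite normrM ler_wpM2r ?gK.
have [c Ic [-> cx]] := MVT_convex cI fg Ix Iy.
rewrite -mulrBl normrM -[(y - x) ^+ 2]real_normK ?num_real // expr2 mulrA ler_wpM2r //.
apply: (le_trans (lip _ _ Ix Ic)); rewrite ler_wpM2l //.
exact: le_trans (gK _ Ix).
Qed.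

Lemma taylor_on_le I f g K K' : K <= K' -> taylor_on I f g K -> taylor_on I f g K'.
Proof.
move=> KK' T x y Ix Iy; have [h1 h0 h2 h3] := T x y Ix Iy; split.
- exact: le_trans KK'.
- by apply: (le_trans h0); rewrite ler_wpM2r.
- by apply: (le_trans h2); rewrite ler_wpM2r.
- by apply: (le_trans h3); rewrite ler_wpM2r ?sqr_ge0.
Qed.

(** Across [a], with distances u and v on the two sides, the remainders and the change of slope add
    up to K (u^2 + v^2 + u v) <= K (u + v)^2, so the constant does not grow. *)
Lemma taylor_on_glue I f g K a : I a ->
  taylor_on (fun x => I x /\ x <= a) f g K -> taylor_on (fun x => I x /\ a <= x) f g K ->
  taylor_on I f g K.
Proof.
move=> Ia T1 T2.
have K0 : 0 <= K by have [h _ _ _] := T1 a a (conj Ia (lexx a)) (conj Ia (lexx a)); exact: le_trans h.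
(* Two arbitrary predicates cover both orders of [x] and [y]; the last premise says that [a] lies
   between them. *)
have mix x y J J' : taylor_on J f g K -> taylor_on J' f g K -> J x -> J a -> J' a -> J' y ->
  `|x - a| + `|a - y| = `|x - y| ->
  [/\ `|g x| <= K, `|f y - f x| <= K * `|y - x|, `|g x - g y| <= K * `|x - y| &
      `|f y - f x - g x * (y - x)| <= K * (y - x) ^+ 2].
  move=> TJ TJ' Jx Ja J'a J'y E.
  have [h1 h0 h2 h3] := TJ x a Jx Ja; have [k1 k0 k2 k3] := TJ' a y J'a J'y.
  split => //.
    have -> : f y - f x = (f y - f a) + (f a - f x) by ring.
    apply: (le_trans (ler_normD _ _)); rewrite [`|y - x|]distrC -E mulrDr [leRHS]addrC.
    by apply: lerD; [rewrite [`|a - y|]distrC|rewrite [`|x - a|]distrC].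
    rewrite -E mulrDr -[g x](subrK (g a)) -addrA.
    by apply: (le_trans (ler_normD _ _)); exact: lerD.
  have -> : f y - f x - g x * (y - x) = (f y - f a - g a * (y - a)) +
     (f a - f x - g x * (a - x)) + (g a - g x) * (y - a) by ring.
  apply: (le_trans (ler_normD _ _)); apply: (le_trans (lerD (ler_normD _ _) (lexx _))).
  have k4 : `|(g a - g x) * (y - a)| <= K * `|x - a| * `|a - y|.
    by rewrite normrM distrC [`|y - a|]distrC ler_wpM2r.
  move: h3 k3 k4; rewrite -[(a - x) ^+ 2]real_normK ?num_real // -[(y - a) ^+ 2]real_normK ?num_real //.
  rewrite -[(y - x) ^+ 2]real_normK ?num_real // [`|a - x|]distrC [`|y - a|]distrC [`|y - x|]distrC -E.
  have := normr_ge0 (x - a); have := normr_ge0 (a - y).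
  move: `|x - a| `|a - y| => u v u0 v0 h3 k3 k4.
  have : 0 <= K * (u * v) by rewrite mulr_ge0 // mulr_ge0.
  nra.
move=> x y Ix Iy.
have [xa|/ltW ax] := leP x a; have [ya|/ltW ay] := leP y a.
- exact: T1.
- apply: (mix _ _ _ _ T1 T2) => //.
  by rewrite !ler0_norm ?subr_le0 // ?(le_trans xa) //; ring.
- apply: (mix _ _ _ _ T2 T1) => //.
  by rewrite !ger0_norm ?subr_ge0 // ?(le_trans ya) //; ring.
- exact: T2.
Qed.

Lemma taylor_on_eq I f g f' g' K : (forall x, I x -> f x = f' x) ->
  (forall x, I x -> g x = g' x) -> taylor_on I f g K -> taylor_on I f' g' K.
Proof.
by move=> ff gg T x y Ix Iy; rewrite -!ff // -!gg //; exact: T.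
Qed.

Lemma segment_bounded k (a b : R) : continuous k ->
  exists K, forall x, a <= x <= b -> `|k x| <= K.
Proof.
move=> ck; have [ab|ba] := leP a b; last first.
  exists 0 => x /andP[ax xb]; have := le_trans ax xb; by rewrite leNgt ba.
have ca : {within `[a, b], continuous (fun x => `|k x|)}.
  apply: continuous_subspaceT => x.
  exact: (cvg_comp _ _ (ck x) (@norm_continuous _ R^o (k x))).
have [c _ H] := EVT_max ab ca.
by exists `|k c| => x xab; apply: H; rewrite in_itv.
Qed.

End TaylorOn.

(** * Mills ratio bounds and the glued solutions *)

Section SteinSolution.
Context {R : realType} (phi : R -> R).
Hypothesis phi_gt0 : forall x, 0 < phi x.
Hypothesis derive_phi : forall x : R, is_derive x 1 phi (- x * phi x).
Hypothesis phi_small : forall x e : R, 0 < e -> exists2 y, y < x & phi y < e.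
Hypothesis phi_even : forall x, phi (- x) = phi x.

Let phi_neq0 x : phi x != 0. Proof. exact: lt0r_neq0. Qed.

Section Mills.
Variable P : R -> R.
Hypothesis derive_P : forall x : R, is_derive x 1 P (phi x).
Hypothesis P_ge0 : forall x, 0 <= P x.
Hypothesis P_small : forall x e : R, 0 < e -> exists2 y, y < x & P y < e.

(** The Mills ratio of the left tail. By [derive_mills] it solves Stein's equation with right-hand
    side 1. *)
Definition mills x : R := P x / phi x.

Lemma derive_mills (x : R) : is_derive x 1 mills (1 + x * mills x).
Proof.
have H1 := derive_P x; have H2 := derive_phi x; have n0 := phi_neq0 x.
by rewrite /mills; derive_as; field.
Qed.

(** The function P z + phi z / z decreases on the negative axis, and far to the left it lies below
    [P], hence below any [e]. *)
Lemma mills_upper x : x < 0 -> mills x <= - x^-1.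
Proof.
move=> x0; rewrite /mills ler_pdivrMr // -subr_le0.
apply/ler_addgt0Pr => e e0; rewrite add0r.
have [y yx Pe] := P_small x e0; have y0 := lt_trans yx x0.
have H : forall z : R, z \in `]y, x[%R -> is_derive z 1 (fun z => P z - - z^-1 * phi z) (- (z ^- 2) * phi z).
  move=> z; rewrite in_itv /= => /andP[_ zx]; have z0 : z != 0 by rewrite lt_eqF // (lt_trans zx).
  have H1 := derive_P z; have H2 := derive_phi z.
  by derive_as; field.
have C : {within `[y, x], continuous (fun z => P z - - z^-1 * phi z)}.
  apply: continuous_in_subspaceT => z; rewrite inE /= in_itv /= => /andP[_ zx].
  have z0 : z != 0 by rewrite lt_eqF // (le_lt_trans zx).
  apply/differentiable_continuous/derivable1_diffP.
  have H1 := derive_P z; have H2 := derive_phi z.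
  have D : is_derive z 1 (fun z => P z - - z^-1 * phi z) (- (z ^- 2) * phi z) by derive_as; field.
  by case: D.
have [c ci E] := MVT yx H C.
have : P x - - x^-1 * phi x <= P y - - y^-1 * phi y.
  rewrite -subr_le0 E; rewrite mulNr mulNr oppr_le0 mulr_ge0 ?subr_ge0 ?(ltW yx) //.
  by rewrite mulr_ge0 ?(ltW (phi_gt0 _)) // invr_ge0 sqr_ge0.
move=> h; apply: (le_trans h); rewrite mulNr opprK.
have : y^-1 * phi y <= 0 by rewrite mulr_le0_ge0 ?(ltW (phi_gt0 _)) // invr_le0 ltW.
have := ltW Pe; lra.
Qed.

(** The function P z + z phi z / (1 + z^2) increases, and far to the left it is at least [- phi],
    hence above any [- e]. *)
Lemma mills_lower x : - x / (1 + x ^+ 2) <= mills x.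
Proof.
rewrite /mills ler_pdivlMr // -subr_ge0.
apply/ler_addgt0Pr => e e0.
have [y yx Pe] := phi_small x e0.
have pos (z : R) : 0 < 1 + z ^+ 2 by rewrite ltr_wpDr ?sqr_ge0.
have H (z : R) : is_derive z 1 (fun z => P z - - z / (1 + z ^+ 2) * phi z)
    (2 * phi z / (1 + z ^+ 2) ^+ 2).
  have H1 := derive_P z; have H2 := derive_phi z; have n0 := lt0r_neq0 (pos z).
  by derive_as; field.
have [c _ E] := MVT_le (ltW yx) H.
have : P y - - y / (1 + y ^+ 2) * phi y <= P x - - x / (1 + x ^+ 2) * phi x.
  rewrite -subr_ge0 E mulr_ge0 ?subr_ge0 ?(ltW yx) // divr_ge0 ?sqr_ge0 //.
  by rewrite mulr_ge0 // ltW.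
move=> h; have : - phi y <= - (- y / (1 + y ^+ 2) * phi y).
  rewrite lerN2 ler_piMl ?(ltW (phi_gt0 _)) // ler_pdivrMr //.
  by have := sqr_ge0 (y + 1); have := sqr_ge0 y; lra.
have := P_ge0 y; lra.
Qed.

(** The two expressions are the first and second derivatives of [mills], where terms of order x
    cancel; the upper and lower Mills bounds are sharp enough to keep that cancellation. *)
Lemma mills_bounds x : x <= -1 ->
  `|1 + x * mills x| <= 1 /\ `|x + (1 + x ^+ 2) * mills x| <= 1.
Proof.
move=> x1; have x0 : x < 0 by lra.
have xn0 : x != 0 by rewrite lt_eqF.
have u := mills_upper x0; have l := mills_lower x.
have pos : 0 < 1 + x ^+ 2 by rewrite ltr_wpDr ?sqr_ge0.
have m0 : 0 <= mills x by rewrite divr_ge0 ?P_ge0 ?ltW.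
have l' : - x <= (1 + x ^+ 2) * mills x by move: l; rewrite ler_pdivrMr // mulrC.
have u' : - 1 <= x * mills x.
  have := ler_wnM2l (ltW x0) u; by rewrite mulrN divff.
have u2 : (1 + x ^+ 2) * mills x <= - x + 1.
  have : x * (x * mills x) <= x * -1 by rewrite ler_wnM2l // ltW.
  have : mills x <= 1.
    apply: (le_trans u); rewrite -invrN invf_le1; lra.
  nra.
have xm : x * mills x <= 0 by rewrite mulr_le0_ge0 // ltW.
split; rewrite ler_norml; apply/andP; split; lra.
Qed.

Lemma mills_bounded a : exists K, forall x, x <= a ->
  `|1 + x * mills x| <= K /\ `|x + (1 + x ^+ 2) * mills x| <= K.
Proof.
have [d1 D1] : exists dk : R -> R, forall x : R, is_derive x 1 (fun x => 1 + x * mills x) (dk x).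
  by eexists => x; have H := derive_mills x; derive_auto.
have [d2 D2] : exists dk : R -> R, forall x : R,
    is_derive x 1 (fun x => x + (1 + x ^+ 2) * mills x) (dk x).
  by eexists => x; have H := derive_mills x; derive_auto.
have c1 := derive_continuous D1; have c2 := derive_continuous D2.
have [K1 H1] := segment_bounded (-1) a c1.
have [K2 H2] := segment_bounded (-1) a c2.
exists (1 + `|K1| + `|K2|) => x xa.
have := normr_ge0 K1; have := normr_ge0 K2; have := ler_norm K1; have := ler_norm K2.
have [x1|x1] := leP x (-1).
  by have [h1 h2] := mills_bounds x1; split; lra.
have xi : -1 <= x <= a by rewrite ltW.
by have := H1 x xi; have := H2 x xi; split; lra.
Qed.

End Mills.

Variable P : R -> R.
Hypothesis derive_P : forall x : R, is_derive x 1 P (phi x).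
Hypothesis P_01 : forall x, 0 <= P x <= 1.
Hypothesis P_small : forall x e : R, 0 < e -> exists2 y, y < x & P y < e.
Hypothesis P_large : forall x e : R, 0 < e -> exists2 y, x < y & 1 - P y < e.

(** The reflected right tail satisfies the same assumptions as [P], so the Mills bounds serve both
    half-lines. *)
Let Q x : R := 1 - P (- x).

Let Q_ge0 x : 0 <= Q x.
Proof. by rewrite /Q subr_ge0; have /andP[] := P_01 (- x). Qed.

Let P_ge0 x : 0 <= P x. Proof. by have /andP[] := P_01 x. Qed.

Let derive_Q (x : R) : is_derive x 1 Q (phi x).
Proof.
have H1 := derive_P (- x).
have H2 : is_derive x 1 (fun y : R => - y) (- 1) by derive_auto.
have H3 := deriv1_comp (g := fun y : R => - y) H1 H2.
by rewrite /Q; derive_as; rewrite phi_even; ring.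
Qed.

Let Q_small (x e : R) : 0 < e -> exists2 y, y < x & Q y < e.
Proof.
move=> e0; have [y xy h] := P_large (- x) e0.
by exists (- y); [rewrite ltrNl|rewrite /Q opprK].
Qed.

Let F1 := mills P.
Let F2 x : R := (1 - P x) / phi x.

Let F2E x : F2 x = mills Q (- x).
Proof. by rewrite /F2 /mills /Q opprK phi_even. Qed.

Let derive_F1 (x : R) : is_derive x 1 F1 (1 + x * F1 x).
Proof. exact: derive_mills. Qed.

Let derive_F2 (x : R) : is_derive x 1 F2 (- 1 + x * F2 x).
Proof.
have H1 := derive_P x; have H2 := derive_phi x; have n0 := phi_neq0 x.
by rewrite /F2; derive_as; field.
Qed.

Lemma P_le x y : x <= y -> P x <= P y.
Proof.
move=> xy; have [c _ E] := MVT_le xy derive_P.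
by rewrite -subr_ge0 E mulr_ge0 ?subr_ge0 // ltW.
Qed.

Section Glue.
Variables (a d c : R).
Hypothesis d_gt0 : 0 < d.
Hypothesis c_01 : 0 <= c <= 1.

(** The cubic that falls from 1 to 0 on the interval with zero slope at both ends, so the glued
    derivative is continuous. *)
Let s x : R := 1 - 3 * ((x - a) / d) ^+ 2 + 2 * ((x - a) / d) ^+ 3.
Let ds x : R := (- 6 * ((x - a) / d) + 6 * ((x - a) / d) ^+ 2) / d.
Let dds x : R := (- 6 + 12 * ((x - a) / d)) / d ^+ 2.

Let derive_s (x : R) : is_derive x 1 s (ds x).
Proof. by rewrite /s /ds; derive_as; field; exact: lt0r_neq0. Qed.

Let derive_ds (x : R) : is_derive x 1 ds (dds x).
Proof. by rewrite /ds /dds; derive_as; field; exact: lt0r_neq0. Qed.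

Let f1 x : R := (1 - c) * F1 x.
Let g1 x : R := (1 - c) * (1 + x * F1 x).
Let k1 x : R := (1 - c) * (x + (1 + x ^+ 2) * F1 x).
Let f3 x : R := c * F2 x.
Let g3 x : R := c * (- 1 + x * F2 x).
Let k3 x : R := c * (- x + (1 + x ^+ 2) * F2 x).
Let f2 x : R := s x * f1 x + (1 - s x) * f3 x.
Let g2 x : R := ds x * (f1 x - f3 x) + s x * g1 x + (1 - s x) * g3 x.
Let k2 x : R := dds x * (f1 x - f3 x) + 2 * (ds x * (g1 x - g3 x)) + s x * k1 x + (1 - s x) * k3 x.

Let derive_f1 (x : R) : is_derive x 1 f1 (g1 x).
Proof. by have H := derive_F1 x; rewrite /f1; derive_as; rewrite /g1; ring. Qed.

Let derive_g1 (x : R) : is_derive x 1 g1 (k1 x).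
Proof. by have H := derive_F1 x; rewrite /g1; derive_as; rewrite /k1; ring. Qed.

Let derive_f3 (x : R) : is_derive x 1 f3 (g3 x).
Proof. by have H := derive_F2 x; rewrite /f3; derive_as; rewrite /g3; ring. Qed.

Let derive_g3 (x : R) : is_derive x 1 g3 (k3 x).
Proof. by have H := derive_F2 x; rewrite /g3; derive_as; rewrite /k3; ring. Qed.

Let derive_f2 (x : R) : is_derive x 1 f2 (g2 x).
Proof.
have H1 := derive_f1 x; have H2 := derive_f3 x; have H3 := derive_s x.
by rewrite /f2; derive_as; rewrite /g2; ring.
Qed.

Let derive_g2 (x : R) : is_derive x 1 g2 (k2 x).
Proof.
have H1 := derive_f1 x; have H2 := derive_f3 x; have H3 := derive_s x.
have H4 := derive_g1 x; have H5 := derive_g3 x; have H6 := derive_ds x.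
by rewrite /g2; derive_as; rewrite /k2; ring.
Qed.

Let k2_continuous : continuous k2.
Proof.
suff [dk H] : exists dk : R -> R, forall x : R, is_derive x 1 k2 (dk x).
  exact: (derive_continuous H).
eexists => x.
have H1 := derive_f1 x; have H2 := derive_f3 x; have H3 := derive_s x.
have H4 := derive_g1 x; have H5 := derive_g3 x; have H6 := derive_ds x.
have H7 := derive_F1 x; have H8 := derive_F2 x.
rewrite /k2 /k1 /k3 /dds; derive_auto.
Qed.

Let aux_convex (l u : R) : convex_pred (fun x : R => l <= x <= u).
Proof.
move=> x y z /andP[lx _] /andP[_ yu] /andP[xz zy].
by rewrite (le_trans lx) //= (le_trans zy).
Qed.

Let taylor1 : exists K, taylor_on (fun x => x <= a) f1 g1 K.
Proof.
have [K HK] := mills_bounded derive_P P_ge0 P_small a.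
exists K; apply: (taylor_on_derive _ derive_f1 derive_g1).
- by move=> x y z _ ya /andP[_ zy]; exact: le_trans ya.
- move=> x xa; rewrite /g1 normrM; have [h _] := HK x xa.
  apply: le_trans h; rewrite ler_piMl //.
  by have /andP[? ?] := c_01; rewrite ger0_norm; lra.
- move=> x xa; rewrite /k1 normrM; have [_ h] := HK x xa.
  apply: le_trans h; rewrite ler_piMl //.
  by have /andP[? ?] := c_01; rewrite ger0_norm; lra.
Qed.

Let taylor2 : exists K, taylor_on (fun x => a <= x <= a + d) f2 g2 K.
Proof.
have [K1 H1] := segment_bounded a (a + d) (derive_continuous derive_g2).
have [K2 H2] := segment_bounded a (a + d) k2_continuous.
exists (Num.max K1 K2); apply: (taylor_on_derive _ derive_f2 derive_g2) => //.
- by move=> x xi; rewrite le_max H1.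
- by move=> x xi; rewrite le_max H2 ?orbT.
Qed.

Let taylor3 : exists K, taylor_on (fun x => a + d <= x) f3 g3 K.
Proof.
have [K HK] := mills_bounded derive_Q Q_ge0 Q_small (- (a + d)).
exists K; apply: (taylor_on_derive _ derive_f3 derive_g3).
- by move=> x y z ax _ /andP[xz _]; exact: le_trans xz.
- move=> x xa; rewrite /g3 normrM.
  have [h _] : `|1 + - x * mills Q (- x)| <= K /\ `|- x + (1 + (- x) ^+ 2) * mills Q (- x)| <= K.
    by apply: HK; rewrite lerN2.
  rewrite F2E; have -> : - 1 + x * mills Q (- x) = - (1 + - x * mills Q (- x)) by ring.
  rewrite normrN; apply: le_trans h; rewrite ler_piMl //.
  by have /andP[? ?] := c_01; rewrite ger0_norm.
- move=> x xa; rewrite /k3 normrM.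
  have [_ h] : `|1 + - x * mills Q (- x)| <= K /\ `|- x + (1 + (- x) ^+ 2) * mills Q (- x)| <= K.
    by apply: HK; rewrite lerN2.
  rewrite F2E; move: h; rewrite sqrrN => h; apply: le_trans h; rewrite ler_piMl //.
  by have /andP[? ?] := c_01; rewrite ger0_norm.
Qed.

(* [f1] and [f3] solve [f' - x f = 1 - c] and [f' - x f = - c]; the smoothstep
   [s] interpolates between them, which adds [s' (P - c) / phi] to the right-hand
   side. Choosing [c = P (a + d)] or [c = P a] gives this term a sign. *)
Definition stein_f x : R := if x <= a then f1 x else if x <= a + d then f2 x else f3 x.
Definition stein_g x : R := if x <= a then g1 x else if x <= a + d then g2 x else g3 x.

Let s_a : s a = 1. Proof. by rewrite /s subrr mul0r !expr0n /=; ring. Qed.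
Let ds_a : ds a = 0. Proof. by rewrite /ds subrr mul0r !expr0n /=; ring. Qed.
Let add_frac : (a + d - a) / d = 1.
Proof. by rewrite addrAC subrr add0r divff // lt0r_neq0. Qed.
Let s_ad : s (a + d) = 0. Proof. by rewrite /s add_frac !expr1n; ring. Qed.
Let ds_ad : ds (a + d) = 0. Proof. by rewrite /ds add_frac !expr1n; ring. Qed.

Lemma stein_taylor : exists K, taylor_on (fun=> True) stein_f stein_g K.
Proof.
have [K1 T1] := taylor1; have [K2 T2] := taylor2; have [K3 T3] := taylor3.
have aad : a < a + d by rewrite ltrDl.
pose K := `|K1| + `|K2| + `|K3|; exists K.
have := normr_ge0 K1; have := normr_ge0 K2; have := normr_ge0 K3.
have := ler_norm K1; have := ler_norm K2; have := ler_norm K3 => l3 l2 l1 p3 p2 p1.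
apply: (@taylor_on_glue _ _ _ _ _ a) => //.
  apply: (@taylor_on_le _ _ _ _ K1); first by rewrite /K; lra.
  apply: (taylor_on_eq (f := f1) (g := g1)) => [x [_ xa]|x [_ xa]|x y [_ xa] [_ ya]].
  - by rewrite /stein_f xa.
  - by rewrite /stein_g xa.
  - exact: T1.
apply: (@taylor_on_glue _ _ _ _ _ (a + d)); first by split=> //; exact: ltW.
  apply: (@taylor_on_le _ _ _ _ K2); first by rewrite /K; lra.
  apply: (taylor_on_eq (f := f2) (g := g2)) => [x [[_ ax] xad]|x [[_ ax] xad]|x y [[_ ax] xd] [[_ ay] yd]].
  - rewrite /stein_f xad; case: ifP => // xa; have -> : x = a by apply/eqP; rewrite eq_le xa.
    by rewrite /f2 s_a; ring.
  - rewrite /stein_g xad; case: ifP => // xa; have -> : x = a by apply/eqP; rewrite eq_le xa.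
    by rewrite /g2 s_a ds_a; ring.
  - by apply: T2; apply/andP.
apply: (@taylor_on_le _ _ _ _ K3); first by rewrite /K; lra.
apply: (taylor_on_eq (f := f3) (g := g3)) => [x [_ xad]|x [_ xad]|x y [_ xd] [_ yd]].
- rewrite /stein_f leNgt (lt_le_trans aad xad) /=; case: ifP => // xa.
  have -> : x = a + d by apply/eqP; rewrite eq_le xa.
  by rewrite /f2 s_ad; ring.
- rewrite /stein_g leNgt (lt_le_trans aad xad) /=; case: ifP => // xa.
  have -> : x = a + d by apply/eqP; rewrite eq_le xa.
  by rewrite /g2 s_ad ds_ad; ring.
- exact: T3.
Qed.

Let s_01 x : a <= x <= a + d -> 0 <= s x <= 1.
Proof.
move=> /andP[ax xd]; rewrite /s.
have t0 : 0 <= (x - a) / d by rewrite divr_ge0 ?subr_ge0 // ltW.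
have t1 : (x - a) / d <= 1 by rewrite ler_pdivrMr // mul1r lerBlDl.
move: t0 t1; move: ((x - a) / d) => t t0 t1.
have -> : 1 - 3 * t ^+ 2 + 2 * t ^+ 3 = (1 - t) ^+ 2 * (1 + 2 * t) by ring.
apply/andP; split; first by rewrite mulr_ge0 ?sqr_ge0 //; lra.
rewrite -subr_ge0 (_ : _ - _ = t ^+ 2 * (3 - 2 * t)); last by ring.
by rewrite mulr_ge0 ?sqr_ge0 //; lra.
Qed.

Let ds_le0 x : a <= x <= a + d -> ds x <= 0.
Proof.
move=> /andP[ax xd]; rewrite /ds.
have t0 : 0 <= (x - a) / d by rewrite divr_ge0 ?subr_ge0 // ltW.
have t1 : (x - a) / d <= 1 by rewrite ler_pdivrMr // mul1r lerBlDl.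
move: t0 t1; move: ((x - a) / d) => t t0 t1.
rewrite mulr_le0_ge0 ?invr_ge0 ?(ltW d_gt0) //; nra.
Qed.

Lemma stein_equation x : stein_g x - x * stein_f x + c =
  if x <= a then 1 else if x <= a + d then s x + ds x * ((P x - c) / phi x) else 0.
Proof.
rewrite /stein_g /stein_f; case: ifP => _.
  by rewrite /g1 /f1; ring.
case: ifP => _; last by rewrite /g3 /f3; ring.
by rewrite /g2 /f2 /g1 /g3 /f1 /f3 /F1 /F2 /mills; field.
Qed.

Lemma stein_equation_ge x : c = P (a + d) ->
  (x <= a)%R%:R <= stein_g x - x * stein_f x + c.
Proof.
move=> cE; rewrite stein_equation; case: (leP x a) => [//|ax].
case: (leP x (a + d)) => [xd|//].
have xi : a <= x <= a + d by rewrite (ltW ax).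
have /andP[s0 _] := s_01 xi; rewrite addr_ge0 // mulr_le0 ?ds_le0 //.
by rewrite mulr_le0_ge0 ?invr_ge0 ?(ltW (phi_gt0 _)) // cE subr_le0 P_le.
Qed.

Lemma stein_equation_le x : c = P a ->
  stein_g x - x * stein_f x + c <= (x <= a + d)%R%:R.
Proof.
move=> cE; rewrite stein_equation; case: (leP x a) => [xa|ax].
  by rewrite (le_trans xa) // lerDl ltW.
case: (leP x (a + d)) => [xd|//].
have xi : a <= x <= a + d by rewrite (ltW ax).
have /andP[_ s1] := s_01 xi.
have : ds x * ((P x - c) / phi x) <= 0.
  rewrite mulr_le0_ge0 ?ds_le0 // divr_ge0 ?(ltW (phi_gt0 _)) // cE subr_ge0 P_le //.
  exact: ltW.
by rewrite /=; lra.
Qed.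

End Glue.

End SteinSolution.

(** * The standard normal distribution function *)

Section StandardNormal.
Context {R : realType}.

Definition nphi : R -> R := normal_pdf 0 1.
Definition nPhi (x : R) : R := fine (normal_prob 0 1 `]-oo, x] : \bar R).

Lemma nphiE x : nphi x = normal_peak 1 * expR (- x ^+ 2 / 2).
Proof.
rewrite /nphi normal_pdfE ?oner_neq0 // /normal_fun subr0 expr1n.
by rewrite mulr2n.
Qed.

Lemma nphi_gt0 x : 0 < nphi x.
Proof. by rewrite nphiE mulr_gt0 ?expR_gt0 // normal_peak_gt0 // oner_neq0. Qed.

Lemma nphi_even x : nphi (- x) = nphi x.
Proof. by rewrite !nphiE sqrrN. Qed.

Lemma derive_nphi (x : R) : is_derive x 1 nphi (- x * nphi x).
Proof.
have -> : nphi = (fun x => normal_peak 1 * expR (- x ^+ 2 / 2)) by apply/funext => y; exact: nphiE.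
have H : is_derive x 1 (fun y : R => - y ^+ 2 / 2) (- x).
  by derive_as; field.
have H2 := deriv1_comp (g := fun y : R => - y ^+ 2 / 2) (is_derive_expR _) H.
by derive_as; ring.
Qed.

Lemma nphi_small (x e : R) : 0 < e -> exists2 y, y < x & nphi y < e.
Proof.
move=> e0; pose p := normal_peak (1 : R).
have p0 : 0 < p by rewrite normal_peak_gt0 // oner_neq0.
(* Beyond [x], and far enough that y^2 / 2 exceeds [p / e]; the bound exp u >= 1 + u then
   suffices. *)
pose y := - (`|x| + 1 + 2 * (p / e)).
have pe : 0 < p / e by rewrite divr_gt0.
have x0 := normr_ge0 x; have nx := ler_norm (- x); rewrite normrN in nx.
exists y; first by rewrite /y; lra.
have z : 0 < y ^+ 2 / 2.
  by rewrite divr_gt0 // exprn_even_gt0 //= lt_eqF // /y; lra.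
have k : p / e < expR (y ^+ 2 / 2).
  apply: lt_le_trans (expR_ge1Dx _).
  have : 0 < (`|x| + 1) ^+ 2 by rewrite exprn_gt0 // ltr_wpDl.
  have : 0 <= `|x| * (p / e) by rewrite mulr_ge0 // ltW.
  rewrite /y sqrrN; move: (p / e) `|x| pe x0 => q u; nra.
rewrite nphiE -/p mulNr expRN ltr_pdivrMr ?expR_gt0 //.
by rewrite mulrC -ltr_pdivrMr.
Qed.

Local Notation mu := (@lebesgue_measure R).

Let integrable_nphi (A : set R) : measurable A -> mu.-integrable A (EFin \o nphi).
Proof.
move=> mA; apply: (integrableS measurableT) => //.
exact: integrable_normal_pdf.
Qed.

Lemma normal_prob_nPhi x : normal_prob 0 1 `]-oo, x] = (nPhi x)%:E.
Proof. by rewrite /nPhi fineK // fin_num_measure. Qed.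

Lemma derive_nPhi (x : R) : is_derive x 1 nPhi (nphi x).
Proof.
have xu : x < x + 1 by rewrite ltrDl.
have [D E] := @continuous_FTC1 R nphi (BInfty _ true) x (x + 1) xu
  (integrable_nphi (measurable_itv _)) (ltNyr _)
  (derive_continuous derive_nphi (x := x)).
apply: DeriveDef; first exact: D.
by rewrite -derive1E E.
Qed.

Lemma nPhi_01 x : 0 <= nPhi x <= 1.
Proof.
rewrite -!lee_fin -normal_prob_nPhi; apply/andP; split; first exact: measure_ge0.
exact: probability_le1.
Qed.

(** The identity as a random variable under the normal law: its distribution function is [nPhi], so
    the limits of a [cdf] at both infinities apply. *)
Let idTR : measurableTypeR R -> R := idfun.

#[local] HB.instance Definition _ :=
  @isMeasurableFun.Build _ _ _ _ idTR (@measurable_id _ _ setT).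

Let nRV : {RV (normal_prob (0 : R) 1 : probability _ _) >-> R} := idTR.

Let cdf_nPhi x : cdf nRV x = (nPhi x)%:E.
Proof. by rewrite -normal_prob_nPhi. Qed.

Lemma nPhi_small (x e : R) : 0 < e -> exists2 y, y < x & nPhi y < e.
Proof.
move=> e0; have := cvg_cdfNy0 nRV; have -> : cdf nRV = EFin \o nPhi.
  by apply/funext => y; exact: cdf_nPhi.
move=> /fine_cvgP[_] /cvgrPdist_lt /(_ e e0) H.
have [y [h yx]] := filter_ex (filterI H (nbhs_ninfty_lt (num_real x))).
exists y => //; move: h; rewrite /= sub0r normrN.
exact: le_lt_trans (ler_norm _).
Qed.

Lemma nPhi_large (x e : R) : 0 < e -> exists2 y, x < y & 1 - nPhi y < e.
Proof.
move=> e0; have := cvg_cdfy1 nRV; have -> : cdf nRV = EFin \o nPhi.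
  by apply/funext => y; exact: cdf_nPhi.
move=> /fine_cvgP[_] /cvgrPdist_lt /(_ e e0) H.
have [y [h yx]] := filter_ex (filterI H (nbhs_pinfty_gt (num_real x))).
exists y => //; move: h; rewrite /=.
exact: le_lt_trans (ler_norm _).
Qed.

Lemma nPhi_continuous : continuous nPhi.
Proof. exact: (derive_continuous derive_nPhi). Qed.

End StandardNormal.

(** * The likelihood ratio *)

Section LikelihoodRatio.
Context {R : realType} {n : nat} (beta beta0 : 'I_n -> R) (b : R) (r : nat).
Implicit Types (i j : 'I_n) (w : graph n) (x t : R).

Let N : R := n.-1%:R.

Hypothesis n_gt3 : (3 < n)%N.
Hypothesis b_ge1 : 1 <= b.
Hypothesis b_leN : b <= n.-1%:R.
Hypothesis dmu_ge : forall i j, i != j -> b^-1 <= dmu (beta i + beta j).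
Hypothesis r_bounds : (1 <= r <= n)%N.
Hypothesis null : forall i, (i < r)%N -> beta i = beta0 i.

Let S0 : pred 'I_n := [pred i : 'I_n | (r <= i)%N].
Let S1 : pred 'I_n := predT.
Let Sr : pred 'I_n := [pred i : 'I_n | (i < r)%N].

Let rho : R := Num.sqrt (2 * r%:R).
Let sN : R := Num.sqrt N.
Let srt : R := Num.sqrt r%:R.

Local Notation E := (cube_E (edge_prob beta)).
Local Notation W := (norm_stat beta Sr rho).

Definition total_err w : R := step_err beta b S1 w + step_err beta b S0 w.
(** The common scale of all errors: up to constants it dominates b^3 / N (existence), b^2 / rho
    (expansion), and 1 / rho, b / r, b / sN (Stein). *)
Definition err_ratio : R := b ^+ 3 / srt.

Let b_gt0 : 0 < b. Proof. by apply: lt_le_trans b_ge1. Qed.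
Let N_gt0 : 0 < N. Proof. by apply: lt_le_trans b_leN. Qed.
Let r_ge1 : 1 <= r%:R :> R. Proof. by rewrite ler1n; case/andP: r_bounds. Qed.
Let r_gt0 : 0 < r%:R :> R. Proof. by apply: lt_le_trans r_ge1. Qed.

Let sum_free : \sum_i free (R := R) Sr i = r%:R.
Proof.
have rn : (r <= n)%N by case/andP: r_bounds.
rewrite (eq_bigr (fun i : 'I_n => if (i < r)%N then 1 else 0)); last first.
  by move=> i _; rewrite /free /Sr /=; case: ltnP.
by rewrite -big_mkcond /= (big_ord_narrow rn) sumr_const card_ord.
Qed.

Let r_le2N : r%:R <= 2 * N.
Proof.
have := n_le2N (erefl N) n_gt3; apply: le_trans.
by rewrite ler_nat; case/andP: r_bounds.
Qed.

Let srt_ge1 : 1 <= srt.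
Proof. by rewrite -sqrtr1 ler_wsqrtr. Qed.

Let srt_sqr : srt ^+ 2 = r%:R.
Proof. by rewrite sqr_sqrtr // ler0n. Qed.

Let srt_le_rho : srt <= rho.
Proof. by rewrite ler_wsqrtr // ler_peMl // ?ler1n // ltW. Qed.

Let rho_ge1 : 1 <= rho.
Proof. exact: le_trans srt_le_rho. Qed.

Let rho_sqr : rho ^+ 2 = 2 * r%:R.
Proof. by rewrite sqr_sqrtr // mulr_ge0. Qed.

Let sN_sqr : sN ^+ 2 = N.
Proof. by rewrite sqr_sqrtr // ltW. Qed.

Let sN_ge1 : 1 <= sN.
Proof. by rewrite -sqrtr1 ler_wsqrtr // (le_trans b_ge1). Qed.

Let srt_le_sN : srt <= 2 * sN.
Proof.
rewrite -(@ler_pXn2r _ 2) ?nnegrE ?mulr_ge0 ?sqrtr_ge0 //.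
rewrite exprMn srt_sqr sN_sqr; have := r_le2N; have := N_gt0; lra.
Qed.

Let srt_gt0 : 0 < srt. Proof. by apply: lt_le_trans srt_ge1. Qed.
Let rho_gt0 : 0 < rho. Proof. by apply: lt_le_trans rho_ge1. Qed.
Let sN_gt0 : 0 < sN. Proof. by apply: lt_le_trans sN_ge1. Qed.

Lemma err_ratio_ge0 : 0 <= err_ratio.
Proof. by rewrite divr_ge0 ?exprn_ge0 ?ltW. Qed.

Let b_le_b3 : b <= b ^+ 3.
Proof. by rewrite ler_eXnr. Qed.

Let b2_le_b3 : b ^+ 2 <= b ^+ 3.
Proof. by rewrite ler_weXn2l. Qed.

Let b3_ge1 : 1 <= b ^+ 3.
Proof. exact: le_trans b_le_b3. Qed.

Lemma E_total_err : E total_err <= 600 * b ^+ 2.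
Proof.
rewrite cube_ED.
have := E_step_err S1 (erefl N) n_gt3 b_ge1 b_leN dmu_ge.
have := E_step_err S0 (erefl N) n_gt3 b_ge1 b_leN dmu_ge.
lra.
Qed.

Lemma step_err_le_total w :
  step_err beta b S1 w <= total_err w /\ step_err beta b S0 w <= total_err w.
Proof.
have := step_err_ge0 beta S1 b_ge1 w; have := step_err_ge0 beta S0 b_ge1 w.
by rewrite /total_err; split; lra.
Qed.

(** [LR_event] speaks of arbitrary maximizers; equality of their values transfers the expansion from
    the constructed ones. *)
Lemma argmax_value (f : ('I_n -> R) -> R) (S : ('I_n -> R) -> Prop) g g' :
  is_argmax f S g -> is_argmax f S g' -> f g = f g'.
Proof. by move=> [Sg mg] [Sg' mg']; apply/eqP; rewrite eq_le mg // mg'. Qed.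

Lemma LR_expansion w : total_err w <= N / (64 ^+ 4 * b) ->
  exists g1 g0, [/\ is_argmax (loglik w) (fun=> True) g1,
    is_argmax (loglik w) (Theta0 r beta0) g0 &
    `|(2 * (loglik w g1 - loglik w g0) - r%:R) / rho - W w| <=
      2 * 130 ^+ 2 * total_err w / rho].
Proof.
move=> h; have [h1 h0] := step_err_le_total w.
have [g1 [_ m1] e1] := argmax_expansion (erefl N) n_gt3 b_ge1 b_leN dmu_ge (le_trans h1 h).
have [g0 [s0 m0] e0] := argmax_expansion (erefl N) n_gt3 b_ge1 b_leN dmu_ge (le_trans h0 h).
exists g1, g0; split.
- by split=> // g' _; apply: m1.
- split=> [i ir|g' g'T]; first by rewrite s0 /S0 /= -?ltnNge // null.
  by apply: m0 => i; rewrite /S0 /= -ltnNge => ir; rewrite g'T // null.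
have -> : (2 * (loglik w g1 - loglik w g0) - r%:R) / rho - W w =
  ((2 * (loglik w g1 - loglik w beta) - \sum_i free (R := R) S1 i * (cdeg beta w i ^+ 2 / deg_var beta i)) -
   (2 * (loglik w g0 - loglik w beta) - \sum_i free (R := R) S0 i * (cdeg beta w i ^+ 2 / deg_var beta i))) / rho.
  have -> : W w = (\sum_i free (R := R) S1 i * (cdeg beta w i ^+ 2 / deg_var beta i) -
      \sum_i free (R := R) S0 i * (cdeg beta w i ^+ 2 / deg_var beta i) - r%:R) / rho.
    rewrite /norm_stat sum_free /chi2_stat -sumrB; congr ((_ - _) / _); apply: eq_bigr => i _.
    by rewrite -mulrBl /free /S0 /S1 /Sr /= ltnNge; case: leqP => _ /=; ring.
  ring.
rewrite normrM (gtr0_norm (_ : 0 < rho^-1)) ?invr_gt0 //.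
rewrite ler_wpM2r ?invr_ge0 ?(ltW rho_gt0) //.
apply: (le_trans (ler_normB _ _)).
have c0 : 0 <= 130 ^+ 2 :> R by exact: sqr_ge0.
have := ler_wpM2l c0 h1; have := ler_wpM2l c0 h0; lra.
Qed.

(** The first summand encodes the threshold of [LR_expansion], the second its error against the
    margin [t]; both hold once [bad_const t * total_err w < 1]. *)
Definition bad_const t : R := 64 ^+ 4 * b / N + 2 * 130 ^+ 2 / (t * rho).

Lemma bad_const_gt0 t : 0 < t -> 0 < bad_const t.
Proof.
move=> t0; apply: addr_gt0; apply: divr_gt0; rewrite ?mulr_gt0 ?exprn_gt0 //.
Qed.

Lemma good_event t w : 0 < t -> ~~ (1 <= bad_const t * total_err w) ->
  MLEs_exist r beta0 w /\
  forall x, (LR_event r beta0 x w -> W w <= x + t) /\ (W w <= x - t -> LR_event r beta0 x w).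
Proof.
move=> t0; rewrite -ltNge => h.
have Z0 : 0 <= total_err w.
  have := step_err_ge0 beta S1 b_ge1 w; have := step_err_ge0 beta S0 b_ge1 w.
  by rewrite /total_err; lra.
have p1 : 0 < 64 ^+ 4 * b / N by rewrite divr_gt0 // mulr_gt0 // exprn_gt0.
have p2 : 0 < 2 * 130 ^+ 2 / (t * rho) :> R by rewrite divr_gt0 // mulr_gt0 // exprn_gt0.
have h1 : total_err w <= N / (64 ^+ 4 * b).
  rewrite -[leRHS]mul1r -[N / _]invf_div ler_pdivlMr // mulrC.
  apply: le_trans (ltW h); rewrite ler_wpM2r // /bad_const; lra.
have h2 : 2 * 130 ^+ 2 * total_err w / rho <= t.
  have : 2 * 130 ^+ 2 / (t * rho) * total_err w <= 1.
    by apply: le_trans (ltW h); rewrite ler_wpM2r // /bad_const; lra.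
  rewrite -(ler_pM2l t0) mulr1; congr (_ <= _); field; rewrite !lt0r_neq0 //.
have [g1 [g0 [m1 m0 e]]] := LR_expansion h1.
split; first by split; [exists g1|exists g0].
move=> x; move: (le_trans e h2); rewrite ler_norml => /andP[e1 e2]; split.
  move=> [g1' [g0' [m1' [m0' k]]]]; move: k.
  rewrite -(argmax_value m1 m1') -(argmax_value m0 m0') -/rho; lra.
move=> k; exists g1, g0; split => //; split => //; rewrite -/rho; lra.
Qed.

Definition wilks_const t : R := 600 * (2 * 64 ^+ 4 + 2 * 130 ^+ 2 / t).

Lemma prob_bad t : 0 < t ->
  E (fun w => (1 <= bad_const t * total_err w)%R%:R) <= wilks_const t * err_ratio.
Proof.
move=> t0; have B0 := bad_const_gt0 t0.
have Z0 w : 0 <= bad_const t * total_err w.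
  rewrite mulr_ge0 ?(ltW B0) //.
  have := step_err_ge0 beta S1 b_ge1 w; have := step_err_ge0 beta S0 b_ge1 w.
  by rewrite /total_err; lra.
apply: (le_trans (cube_markov (edge_prob_01 beta) ltr01 Z0)).
rewrite divr1 cube_EZ; apply: (le_trans (ler_wpM2l (ltW B0) E_total_err)).
have k1 : b ^+ 3 / N <= 2 * err_ratio.
  rewrite /err_ratio mulrCA ler_wpM2l ?exprn_ge0 ?(ltW b_gt0) //.
  rewrite ler_pdivlMr // mulrC ler_pdivrMr //.
  by apply: le_trans r_le2N; rewrite -srt_sqr expr2 ler_peMr // (ltW srt_gt0).
have k2 : b ^+ 2 / rho <= err_ratio.
  rewrite /err_ratio; apply: ler_pM; rewrite ?exprn_ge0 ?invr_ge0 ?(ltW b_gt0) ?(ltW rho_gt0) //.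
  by rewrite lef_pV2.
have -> : bad_const t * (600 * b ^+ 2) =
   600 * (64 ^+ 4 * (b ^+ 3 / N) + 2 * 130 ^+ 2 / t * (b ^+ 2 / rho)).
  by rewrite /bad_const; field; rewrite !lt0r_neq0.
rewrite /wilks_const -[leRHS]mulrA; apply: ler_wpM2l; first exact: ler0n.
rewrite [leRHS]mulrDl; apply: lerD.
  have -> : 2 * 64 ^+ 4 * err_ratio = 64 ^+ 4 * (2 * err_ratio) by ring.
  by apply: ler_wpM2l k1; rewrite exprn_ge0.
by apply: ler_wpM2l k2; rewrite divr_ge0 ?(ltW t0) // mulr_ge0 // sqr_ge0.
Qed.

Lemma prob_MLEs t : 0 < t ->
  1 - wilks_const t * err_ratio <= Prob beta (MLEs_exist r beta0) <= 1.
Proof.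
move=> t0; rewrite ProbE; apply/andP; split; last first.
  rewrite -[leRHS](cube_Ecst (edge_prob beta)); apply: cube_E_le => [|w]; first exact: edge_prob_01.
  by case: asboolP.
rewrite lerBlDr; apply: (@le_trans _ _ (E (fun w => `[< MLEs_exist r beta0 w >]%:R +
   (1 <= bad_const t * total_err w)%R%:R))); last first.
  by rewrite cube_ED lerD2l prob_bad.
rewrite -[leLHS](cube_Ecst (edge_prob beta)); apply: cube_E_le => [|w]; first exact: edge_prob_01.
case: asboolP => [_|nM]; first by rewrite lerDl.
have [//|g] := boolP (1 <= bad_const t * total_err w); first by rewrite add0r.
by have [] := good_event t0 g.
Qed.

Lemma prob_LR_le t x : 0 < t -> Prob beta (LR_event r beta0 x) <=
  E (fun w => (W w <= x + t)%R%:R) + wilks_const t * err_ratio.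
Proof.
move=> t0; rewrite ProbE; apply: (@le_trans _ _ (E (fun w => (W w <= x + t)%R%:R +
   (1 <= bad_const t * total_err w)%R%:R))); last first.
  by rewrite cube_ED lerD2l prob_bad.
apply: cube_E_le => [|w]; first exact: edge_prob_01.
case: asboolP => [L|_]; last by rewrite addr_ge0.
have [//|g] := boolP (1 <= bad_const t * total_err w); first by rewrite lerDr.
have [_ /(_ x)[/(_ L) -> _]] := good_event t0 g.
by rewrite lerDl.
Qed.

Lemma prob_LR_ge t x : 0 < t ->
  E (fun w => (W w <= x - t)%R%:R) - wilks_const t * err_ratio <=
  Prob beta (LR_event r beta0 x).
Proof.
move=> t0; rewrite ProbE lerBlDr; apply: (@le_trans _ _ (E (fun w =>
  `[< LR_event r beta0 x w >]%:R + (1 <= bad_const t * total_err w)%R%:R))); last first.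
  by rewrite cube_ED lerD2l prob_bad.
apply: cube_E_le => [|w]; first exact: edge_prob_01.
have [k|_] := leP (W w) (x - t); last by rewrite addr_ge0.
case: asboolP => [_|nL]; first by rewrite lerDl.
have [//|g] := boolP (1 <= bad_const t * total_err w); first by rewrite add0r.
by have [_ /(_ x)[_ /(_ k)]] := good_event t0 g.
Qed.

(** The coefficients of [stein_bound]: 30 b / rho^2 is 15 b / r, and [srt <= 2 * sN] doubles the
    last one. *)
Definition stein_const : R := 8 + 15 + (16 + 8 * 1001 + 4) * 2.

Lemma stein_W (f g : R -> R) K : taylor_on (fun=> True) f g K ->
  `|E (fun w => g (W w)) - E (fun w => W w * f (W w))| <= K * (stein_const * err_ratio).
Proof.
move=> T.
have K0 : 0 <= K by have [h _ _ _] := T 0 0 I I; exact: le_trans h.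
have rho2 : rho ^+ 2 = 2 * \sum_i free (R := R) Sr i by rewrite sum_free.
have T1 x : `|g x| <= K by have [] := T x x I I.
have T2 x y : `|f y - f x| <= K * `|y - x| by have [] := T x y I I.
have T3 x y : `|f y - f x - g x * (y - x)| <= K * (y - x) ^+ 2 by have [] := T x y I I.
have := stein_bound (erefl N) n_gt3 b_ge1 b_leN dmu_ge rho_ge1 rho2 sN_ge1 sN_sqr T1 T2 T3.
move=> h; apply: (le_trans h); apply: ler_wpM2l => //.
have k1 : 8 / rho <= 8 * err_ratio.
  apply: ler_wpM2l => //; rewrite -[rho^-1]mul1r; apply: ler_pM; rewrite ?invr_ge0 ?(ltW rho_gt0) //.
  by rewrite lef_pV2.
have k2 : 30 * b / rho ^+ 2 <= 15 * err_ratio.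
  rewrite rho_sqr; have -> : 30 * b / (2 * r%:R) = 15 * (b / r%:R) by field; rewrite lt0r_neq0.
  apply: ler_wpM2l => //; apply: ler_pM; rewrite ?invr_ge0 ?(ltW r_gt0) ?(ltW b_gt0) //.
  by rewrite lef_pV2 // -srt_sqr expr2 ler_peMr // (ltW srt_gt0).
have k3 : b / sN <= 2 * err_ratio.
  rewrite /err_ratio mulrCA; apply: ler_pM; rewrite ?invr_ge0 ?(ltW sN_gt0) ?(ltW b_gt0) //.
  by rewrite ler_pdivlMr // mulrC ler_pdivrMr.
have c0 : 0 <= 16 + 8 * 1001 + 4 :> R.
  apply: addr_ge0 (ler0n _ _); apply: addr_ge0 (ler0n _ _) _.
  by apply: mulr_ge0; exact: ler0n.
have -> : stein_const * err_ratio = 8 * err_ratio + 15 * err_ratio +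
    (16 + 8 * 1001 + 4) * (2 * err_ratio) by rewrite /stein_const; ring.
by apply: lerD; [exact: lerD|exact: ler_wpM2l k3].
Qed.

Lemma prob_W_le (f g : R -> R) K a c : taylor_on (fun=> True) f g K ->
  (forall x, (x <= a)%R%:R <= g x - x * f x + c) ->
  E (fun w => (W w <= a)%R%:R) <= c + K * (stein_const * err_ratio).
Proof.
move=> T h; apply: (@le_trans _ _ (E (fun w => g (W w) - W w * f (W w) + c))).
  by apply: cube_E_le => [|w]; [exact: edge_prob_01|exact: h].
rewrite cube_ED cube_EB cube_Ecst addrC lerD2l.
exact: le_trans (ler_norm _) (stein_W T).
Qed.

Lemma prob_W_ge (f g : R -> R) K a c : taylor_on (fun=> True) f g K ->
  (forall x, g x - x * f x + c <= (x <= a)%R%:R) ->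
  c - K * (stein_const * err_ratio) <= E (fun w => (W w <= a)%R%:R).
Proof.
move=> T h; apply: (@le_trans _ _ (E (fun w => g (W w) - W w * f (W w) + c))); last first.
  by apply: cube_E_le => [|w]; [exact: edge_prob_01|exact: h].
rewrite cube_ED cube_EB cube_Ecst addrC lerD2r.
by have := stein_W T; rewrite ler_norml => /andP[].
Qed.

End LikelihoodRatio.

(** * From b_n and c_n to the assumptions above, and the conclusion *)

Section EdgeVarianceBounds.
Context {R : realType} {n : nat} (beta : 'I_n -> R).
Hypothesis n_gt1 : (1 < n)%N.

Lemma vfun_gt0 (x : R) : 0 < vfun x.
Proof. by rewrite vfunE invr_gt0 dmu_gt0. Qed.

Lemma vfun_le_b_n i j : i != j -> vfun (beta i + beta j) <= b_n beta.
Proof.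
move=> ij; exact: (le_bigmax_cond 0
  (fun p : 'I_n * 'I_n => vfun (beta p.1 + beta p.2)) (j := (i, j)) ij).
Qed.

Lemma b_n_ge1 : 1 <= b_n beta.
Proof.
have n0 : (0 < n)%N by exact: ltnW.
have ij : Ordinal n0 != Ordinal n_gt1 by [].
apply: le_trans (vfun_le_b_n ij).
by rewrite vfunE invf_ge1 ?dmu_gt0 // dmu_le1.
Qed.

Lemma b_n_dmu i j : i != j -> (b_n beta)^-1 <= dmu (beta i + beta j).
Proof.
move=> ij; rewrite -[leRHS]invrK lef_pV2 ?posrE ?invr_gt0 ?dmu_gt0 //.
  by rewrite -vfunE vfun_le_b_n.
by apply: lt_le_trans b_n_ge1.
Qed.

Lemma c_n_le : c_n beta <= b_n beta.
Proof. exact: bigmin_le_id. Qed.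

Lemma c_n_gt0 : 0 < c_n beta.
Proof.
apply: lt_bigmin => [|p _]; last exact: vfun_gt0.
by apply: lt_le_trans b_n_ge1.
Qed.

(** Since 0 < c_n <= b_n, dividing by the square of c_n removes at most two of the five powers. *)
Lemma b_n_cube_le : b_n beta ^+ 3 <= b_n beta ^+ 5 / c_n beta ^+ 2.
Proof.
have b0 : 0 < b_n beta by apply: lt_le_trans b_n_ge1.
rewrite ler_pdivlMr ?exprn_gt0 ?c_n_gt0 // (exprD _ 3 2).
apply: ler_wpM2l; first by rewrite exprn_ge0 // ltW.
by rewrite lerXn2r ?nnegrE ?c_n_le ?(ltW b0) // ltW // c_n_gt0.
Qed.

End EdgeVarianceBounds.

Lemma ln_nat_ge1 (R : realType) n : (3 < n)%N -> 1 <= ln (n%:R : R).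
Proof.
move=> n3; rewrite -[leLHS](expRK (1 : R)) ler_ln ?posrE ?expR_gt0 //.
  by apply: (le_trans expR1_le4); rewrite ler_nat.
by rewrite ltr0n; case: n n3.
Qed.

Theorem theorem1 (R : realType)
  (beta : forall n : nat, 'I_n -> R) (beta0 : forall n : nat, 'I_n -> R)
  (r : nat -> nat) :
  (forall n, (0 < n)%N -> (1 <= r n <= n)%N) ->
  (forall M : nat, \forall n \near \oo, (M <= r n)%N) ->
  (forall n (i : 'I_n), (i < r n)%N -> beta n i = beta0 n i) ->
  (fun n => b_n (beta n) ^+ 5 / c_n (beta n) ^+ 2
            / (Num.sqrt ((r n)%:R) / (ln (n%:R : R)) ^+ 2)) @ \oo --> (0 : R^o) ->
  (fun n => Prob (beta n) (MLEs_exist (r n) (beta0 n))) @ \oo --> (1 : R^o) /\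
  (forall x : R,
     (fun n => (Prob (beta n) (LR_event (r n) (beta0 n) x))%:E) @ \oo -->
       normal_prob 0 1 `]-oo, x]).
Proof.
move=> r_bounds _ null H.
pose e n : R := err_ratio (b_n (beta n)) (r n).
have e_small (edge_jump : R) : 0 < edge_jump -> \forall n \near \oo, (3 < n)%N /\ e n < edge_jump.
  move=> eta0; move/cvgrPdist_lt : H => /(_ edge_jump eta0) H.
  near=> n; have n3 : (3 < n)%N by near: n; exact: nbhs_infty_gt.
  split=> //; have n1 : (1 < n)%N by apply: leq_trans n3.
  have h : `|0 - b_n (beta n) ^+ 5 / c_n (beta n) ^+ 2
      / (Num.sqrt ((r n)%:R) / (ln (n%:R : R)) ^+ 2)| < edge_jump by near: n; exact: H.
  apply: le_lt_trans h; rewrite sub0r normrN; apply: le_trans (ler_norm _).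
  have l1 := ln_nat_ge1 R n3.
  have s0 : 0 <= (Num.sqrt (r n)%:R)^-1 :> R by rewrite invr_ge0 sqrtr_ge0.
  have b0 : 0 <= b_n (beta n) ^+ 3.
    by rewrite exprn_ge0 // (le_trans _ (b_n_ge1 (beta n) n1)).
  rewrite /e /err_ratio [X in _ <= _ * X]invf_div; apply: ler_pM => //.
    exact: b_n_cube_le.
  by rewrite ler_peMl // exprn_ege1.
(* From b^3 < sqrt r follows b^2 <= r <= n <= 2N <= N^2 with N = n - 1 >= 3, hence b <= N. *)
have conditions n : (3 < n)%N -> e n < 1 ->
    [/\ 1 <= b_n (beta n), b_n (beta n) <= n.-1%:R &
     forall i j, i != j -> (b_n (beta n))^-1 <= dmu (beta n i + beta n j)].
  move=> n3 e1; have n1 : (1 < n)%N by apply: leq_trans n3.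
  have b1 := b_n_ge1 (beta n) n1; split => //; last exact: b_n_dmu.
  have /andP[r1 rn] : (1 <= r n <= n)%N by apply: r_bounds; apply: leq_trans n3.
  have s0 : 0 < Num.sqrt (r n)%:R :> R by rewrite sqrtr_gt0 ltr0n.
  have b3 : b_n (beta n) ^+ 3 <= Num.sqrt (r n)%:R.
    by move: e1; rewrite /e /err_ratio ltr_pdivrMr // mul1r => /ltW.
  have bs : b_n (beta n) <= Num.sqrt (r n)%:R by apply: le_trans b3; rewrite ler_eXnr.
  have b2 : b_n (beta n) ^+ 2 <= n%:R.
    apply: (@le_trans _ _ (Num.sqrt (r n)%:R ^+ 2)).
      by rewrite lerXn2r ?nnegrE ?(ltW s0) // (le_trans _ b1).
    by rewrite sqr_sqrtr // ler_nat.
  have nN := n_le2N (erefl (n.-1%:R : R)) n3.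
  have N3 : 3 <= n.-1%:R :> R by rewrite ler_nat -ltnS prednK // (ltn_trans _ n3).
  rewrite -(@ler_pXn2r _ 2) ?nnegrE ?(le_trans _ b1) //.
  by apply: (le_trans b2); nra.
split.
  apply/cvgrPdist_lt => eps eps0.
  pose k := `|wilks_const (1 : R)| + 1; have k0 : 0 < k by rewrite ltr_wpDl.
  (* The bound 1 makes [conditions] applicable; the [+ 1] in [k] keeps the quotient meaningful. *)
  have d0 : 0 < Num.min 1 (eps / k) by rewrite lt_min ltr01 divr_gt0.
  near=> n.
  have [n3 en] : (3 < n)%N /\ e n < Num.min 1 (eps / k) by near: n; exact: e_small.
  move: en; rewrite lt_min => /andP[e1 ek].
  have [b1 bN dm] := conditions n n3 e1.
  have rb : (1 <= r n <= n)%N by apply: r_bounds; apply: leq_trans n3.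
  have /andP[h1 h2] := prob_MLEs n3 b1 bN dm rb (null n) (@ltr01 R).
  rewrite ger0_norm ?subr_ge0 //.
  have en0 : 0 <= e n by exact: (err_ratio_ge0 b1 rb).
  have : wilks_const (1 : R) * e n < eps.
    apply: (@le_lt_trans _ _ (k * e n)).
      by rewrite ler_wpM2r // /k; have := ler_norm (wilks_const (1 : R)); lra.
    by rewrite mulrC -ltr_pdivlMr.
  by move: h1; rewrite -/(e n); lra.
move=> x; rewrite normal_prob_nPhi; apply: cvg_EFin; first by near=> n.
apply/cvgrPdist_lt => eps eps0 /=.
have eps2 : 0 < eps / 2 by rewrite divr_gt0.
(* The margin is spent twice: one [t] for replacing the likelihood ratio by the quadratic form,
   another for smoothing the half-line. *)
have [t t0 [tl tr]] : exists2 t : R, 0 < t &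
    `|nPhi x - nPhi (x - 2 * t)| < eps / 2 /\ `|nPhi x - nPhi (x + 2 * t)| < eps / 2.
  have /cvgrPdist_lt /(_ _ eps2) [/= d d0 D] := @nPhi_continuous R x.
  exists (d / 4); first by rewrite divr_gt0.
  split; apply: D => /=; rewrite ltr_norml; apply/andP; split; lra.
(* The upper approximation descends on [x + t, x + 2t], the lower one on [x - 2t, x - t], with
   centring constants [nPhi (x + 2 * t)] and [nPhi (x - 2 * t)]. *)
have up := stein_taylor nphi_gt0 derive_nphi nphi_small nphi_even derive_nPhi nPhi_01 nPhi_small nPhi_large
  (x + t) t0 (nPhi_01 (x + t + t)).
have lo := stein_taylor nphi_gt0 derive_nphi nphi_small nphi_even derive_nPhi nPhi_01 nPhi_small nPhi_large
  (x - 2 * t) t0 (nPhi_01 (x - 2 * t)).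
have [K1 T1] := up; have [K2 T2] := lo.
have U1 y := stein_equation_ge nphi_gt0 derive_nPhi t0 y (erefl (nPhi (x + t + t))).
have U2 y := stein_equation_le nphi_gt0 derive_nPhi t0 y (erefl (nPhi (x - 2 * t))).
pose k := (`|K1| + `|K2|) * stein_const + `|wilks_const t| + 1.
have sc0 : 0 <= stein_const :> R.
  apply: addr_ge0; first by rewrite addr_ge0.
  apply: mulr_ge0 (ler0n _ _); apply: addr_ge0 (ler0n _ _); apply: addr_ge0 (ler0n _ _) _.
  by apply: mulr_ge0; exact: ler0n.
have k0 : 0 < k by rewrite ltr_wpDl // addr_ge0 // mulr_ge0 // addr_ge0.
have d0 : 0 < Num.min 1 (eps / 2 / k) by rewrite lt_min ltr01 divr_gt0.
near=> n.
have [n3 en] : (3 < n)%N /\ e n < Num.min 1 (eps / 2 / k) by near: n; exact: e_small.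
move: en; rewrite lt_min => /andP[e1 ek].
have [b1 bN dm] := conditions n n3 e1.
have rb : (1 <= r n <= n)%N by apply: r_bounds; apply: leq_trans n3.
have en0 : 0 <= e n by exact: (err_ratio_ge0 b1 rb).
have ke : k * e n < eps / 2 by rewrite mulrC -ltr_pdivlMr.
have L1 := prob_LR_le n3 b1 bN dm rb (null n) x t0.
have L2 := prob_LR_ge n3 b1 bN dm rb (null n) x t0.
have M1 := prob_W_le n3 b1 bN dm rb T1 U1.
have M2 := prob_W_ge n3 b1 bN dm rb T2 U2.
have aux (K : R) : `|K| <= `|K1| + `|K2| ->
    K * (stein_const * e n) + wilks_const t * e n <= k * e n.
  move=> hK; rewrite mulrA -mulrDl ler_wpM2r // /k.
  have : K * stein_const <= (`|K1| + `|K2|) * stein_const.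
    by rewrite ler_wpM2r // (le_trans (ler_norm _)).
  by have := ler_norm (wilks_const t); lra.
have A1 : K1 * (stein_const * e n) + wilks_const t * e n <= k * e n by apply: aux; rewrite lerDl.
have A2 : K2 * (stein_const * e n) + wilks_const t * e n <= k * e n by apply: aux; rewrite lerDr.
move: L1 L2 M1 M2; rewrite -/(e n) (_ : x - 2 * t + t = x - t); last by ring.
rewrite (_ : x + t + t = x + 2 * t); last by ring.
move: tl tr; rewrite !ltr_norml => /andP[q1 q2] /andP[q3 q4] L1 L2 M1 M2.
by apply/andP; split; lra.
Unshelve. all: by end_near.
Qed.
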